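(* Let $(J,\nabla)$ be a pair consisting of an almost complex structure $J$ on $M$ and a torsion-free affine connection $\nabla$ on $M$. The Courant algebroid lift of the $B_n$-Courant algebroid over $M$ by the connection $\nabla^{J}$ on $E=T^*M\oplus(M\times\mathbb{R})$ is a Courant algebroid if and only if $(J,\nabla)$ is a special complex structure.
   Context: Everything is smooth. A pair $(J,\nabla)$ of an almost complex structure $J$ and a torsion-free connection $\nabla$ on $M$ is a special complex structure if $\nabla$ is flat and $d^\nabla J=0$, where $(d^\nabla J)(X,Y)=\nabla_X(JY)-\nabla_Y(JX)-J[X,Y]_{\mathrm{Lie}}$. The $B_n$-Courant algebroid is $\mathbb{E}=TM\oplus T^*M\oplus(M\times\mathbb{R})=TM\oplus E$ with $E=T^*M\oplus(M\times\mathbb{R})$, pairing $\langle X+\alpha+f,Y+\beta+g\rangle=\alpha(Y)+\beta(X)+fg$, anchor $\rho=\mathrm{pr}_{TM}$, and bracket $$[X+\alpha+f,Y+\beta+g]=[X,Y]_{\mathrm{Lie}}+(L_X\beta-\iota_Yd\alpha+g\,df)+(Xg-Yf).$$ The connection $\nabla^{J}$ on $E$ is $\nabla^{J}_X(\alpha+f):=\nabla_X\alpha+Xf+\alpha(JX)$, with $\nabla_X\alpha$ the dual connection on $T^*M$; $\nabla_X\alpha$ lies in $T^*M$ and $Xf+\alpha(JX)$ in $M\times\mathbb{R}$. A tuple $(\mathbb{E},\langle\,,\rangle,\rho,[\,,])$ over $M$ consists of a vector bundle, a non-degenerate symmetric pairing, a bundle map $\rho:\mathbb{E}\to TM$ over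 $\mathrm{id}_M$, and an $\mathbb{R}$-bilinear bracket on $\Gamma(\mathbb{E})$; $\rho^*:T^*M\to\mathbb{E}$ is given by $\langle\rho^*\alpha,b\rangle=\alpha(\rho(b))$. Properties: (Ca1) $[a,b]+[b,a]=\rho^*d\langle a,b\rangle$; (Ca2) $\rho(a)\langle b,c\rangle=\langle[a,b],c\rangle+\langle b,[a,c]\rangle$; (Ca3) $[a,[b,c]]=[[a,b],c]+[b,[a,c]]$; (Ca4) $[a,fb]=(\rho(a)f)b+f[a,b]$; (Ca5) $[fa,b]=-(\rho(b)f)a+f[a,b]+\langle a,b\rangle\rho^*df$. A Courant algebroid satisfies (Ca1)–(Ca3); then (Ca4), (Ca5) follow. Courant algebroid lift: let $\mathbb{E}=TM\oplus E$ with $\mathrm{pr}:E\to M$ a vector bundle, the tuple satisfying (Ca4) and (Ca5), and $D$ a connection on $E$. For $X\in\mathfrak{X}(M)$ let $X^{h}\in\mathfrak{X}(E)$ be its horizontal lift with respect to $D$; for $\varphi\in\Gamma(E)$ let $\varphi^{v}\in\mathfrak{X}(E)$ be its vertical lift, $\varphi^v_q=\frac{d}{dt}|_{t=0}(q+t\varphi_{\mathrm{pr}(q)})$. Set $\phi(X+\varphi)=X^h+\varphi^v$; the image of $\phi$ locally generates $\mathfrak{X}(E)$. The lift by $D$ is the tuple $(TE,g_D,\rho_D,[\,,]_D)$ over the manifold $E$, where $g_D$ is the unique pairing on $TE$ with $g_D(\phi a,\phi b)=\mathrm{pr}^*\langle a,b\rangle$, $\rho_D:TE\to TE$ is the unique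 vector bundle endomorphism with $\rho_D(\phi a)=\rho(a)^h$, and $[\,,]_D$ is the unique bracket on $\mathfrak{X}(E)$ with $[\phi a,\phi b]_D=\phi[a,b]$ such that the lift satisfies (Ca4) and (Ca5). *)

(* Defs.v *)
From HB Require Import structures.
From mathcomp Require Import all_boot all_order all_algebra.
From mathcomp Require Import all_classical all_reals all_analysis.
From mathcomp Require Import ring.
Set Implicit Arguments.
Unset Strict Implicit.
Unset Printing Implicit Defensive.
Import Order.TTheory GRing.Theory Num.Theory.
Import numFieldNormedType.Exports.
Local Open Scope classical_set_scope.
Local Open Scope ring_scope.

(* Vector bundles are given by their fibres together with the set
   of their smooth (global) sections.  Operators on sections (brackets,
   connections) are total functions on all sections, smooth or not; every
   axiom about them quantifies over smooth sections and smooth functions only,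
   and their values elsewhere are irrelevant.  Objects characterised by a
   uniquely solvable condition are written [xget 0 [set x | condition]], the
   default value 0 being irrelevant. *)

(** * Smooth maps between open subsets of normed spaces *)

Fixpoint Ck (R : realType) (V W : normedModType R) (k : nat) (O : set V)
    (f : V -> W) : Prop :=
  if k is k'.+1 then
    (forall x, O x -> differentiable f x) /\ (forall v, Ck k' O ('D_v f))
  else forall x, O x -> {for x, continuous f}.

Definition smooth_on (R : realType) (V W : normedModType R) (O : set V)
    (f : V -> W) : Prop :=
  forall k, Ck k O f.

(** * Manifolds *)

(* Only the values of [cmap] on [dom] matter. *)
Record chart (R : realType) (T : Type) (n : nat) := Chart {
  dom : set T;
  cmap : T -> 'rV[R]_n }.

(* [f \o (cmap c)^-1] is smooth on [cmap c @` U], an open set in all uses. *)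
Definition smooth_in_chart (R : realType) (T : Type) (n : nat)
    (c : chart R T n) (U : set T) (W : normedModType R) (f : T -> W) : Prop :=
  exists g : 'rV[R]_n -> W,
    smooth_on (cmap c @` U) g /\ (forall p, U p -> f p = g (cmap c p)).

Definition is_manifold (R : realType) (T : topologicalType) (n : nat)
    (A : set (chart R T n)) : Prop :=
  [/\ hausdorff_space T,
      @second_countable T,
      (forall p, exists2 c, A c & dom c p),
      (forall c, A c ->
        [/\ open (dom c),
            {in dom c &, injective (cmap c)},
            {in dom c, continuous (cmap c)} &
            forall U, open U -> U `<=` dom c -> open (cmap c @` U)]) &
      (forall c c', A c -> A c' ->
        smooth_in_chart c (dom c `&` dom c') (cmap c'))].

(* A set with an atlas: what is needed in order to speak of smooth functions and
   tangent vectors.  It is used for a manifold M and for the total space of a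
   vector bundle over M; the topology is the one determined by the charts. *)
Record smoothType (R : realType) := SmoothType {
  pt :> Type;
  mdim : nat;
  atlas : set (chart R pt mdim) }.

Definition smooth (R : realType) (M : smoothType R) (f : M -> R) : Prop :=
  forall c, atlas c -> smooth_in_chart c (dom c) (f : M -> R^o).

(** * Tangent vectors: derivations at p of the algebra of smooth functions *)

Section Tangent.
Context (R : realType) (M : smoothType R) (p : M).

(* The first clause extends derivations by 0 to non-smooth functions, so that
   distinct elements of the type [tvec] below are distinct as derivations. *)
Definition is_derivation_at (v : (M -> R) -> R^o) : Prop :=
  [/\ forall f, ~ smooth f -> v f = 0,
      forall (a : R) f g, smooth f -> smooth g ->
        v (fun q => a * f q + g q) = a * v f + v g &
      forall f g, smooth f -> smooth g ->
        v (fun q => f q * g q) = v f * g p + f p * v g].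

Definition tvec_pred : {pred (M -> R) -> R^o} :=
  fun v => `[< is_derivation_at v >].

Lemma tvec_submod_closed : submod_closed tvec_pred.
Proof.
have addE (u v : (M -> R) -> R^o) f : (u + v) f = u f + v f by [].
have scaleE a (u : (M -> R) -> R^o) f : (a *: u) f = a * u f by [].
have zeroE f : (0 : (M -> R) -> R^o) f = 0 by [].
split=> [|a u v /asboolP[u0 uL uM] /asboolP[v0 vL vM]]; apply/asboolP; split.
- by [].
- by move=> a f g _ _; rewrite !zeroE mulr0 addr0.
- by move=> f g _ _; rewrite !zeroE mul0r mulr0 addr0.
- by move=> f nf; rewrite addE scaleE u0// v0// mulr0 addr0.
- by move=> b f g sf sg; rewrite !addE !scaleE uL// vL//; ring.
- by move=> f g sf sg; rewrite !addE !scaleE uM// vM//; ring.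
Qed.

HB.instance Definition _ :=
  GRing.isSubmodClosed.Build R ((M -> R) -> R^o) tvec_pred tvec_submod_closed.

Record tvec := TVec {
  tvec_fun :> (M -> R) -> R^o;
  tvecP : tvec_fun \in tvec_pred }.

HB.instance Definition _ := [isSub for tvec_fun].
HB.instance Definition _ := [Choice of tvec by <:].
HB.instance Definition _ := [SubChoice_isSubLmodule of tvec by <:].

Definition tvec_of (Phi : (M -> R) -> R) : tvec :=
  xget 0 [set v : tvec | forall f, smooth f -> v f = Phi f].

End Tangent.

(** * Dual vector spaces *)

Section Dual.
Context (R : realType) (V : lmodType R).

Definition dual_pred : {pred V -> R^o} := fun l => `[< linear l >].

Lemma dual_submod_closed : submod_closed dual_pred.
Proof.
have addE (u v : V -> R^o) x : (u + v) x = u x + v x by [].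
have scaleE a (u : V -> R^o) x : (a *: u) x = a * u x by [].
split=> [|a u v /asboolP uL /asboolP vL]; apply/asboolP => b x y.
- by rewrite -[RHS]/(b * 0 + 0) mulr0 addr0.
- by rewrite !addE !scaleE uL vL -![_ *: (_ : R^o)]/(_ * _); ring.
Qed.

HB.instance Definition _ :=
  GRing.isSubmodClosed.Build R (V -> R^o) dual_pred dual_submod_closed.

Record dual := Dual {
  dual_fun :> V -> R^o;
  dualP : dual_fun \in dual_pred }.

HB.instance Definition _ := [isSub for dual_fun].
HB.instance Definition _ := [Choice of dual by <:].
HB.instance Definition _ := [SubChoice_isSubLmodule of dual by <:].

End Dual.

(** * Vector bundles *)

Record bundle (R : realType) (M : smoothType R) := Bundle {
  fiber :> M -> lmodType R;
  rank : nat;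
  smooth_sec : set (forall p, fiber p) }.

Notation section E := (forall p, fiber E p).

Section Bundles.
Context (R : realType) (M : smoothType R).

Definition TB : bundle M :=
  @Bundle R M (fun p => tvec p) (mdim M)
    [set X | forall f, smooth f -> smooth (fun p => X p f)].

Definition cotangent : bundle M :=
  @Bundle R M (fun p => dual (tvec p)) (mdim M)
    [set a | forall X : section TB, smooth_sec X -> smooth (fun p => a p (X p))].

Definition line_bundle : bundle M :=
  @Bundle R M (fun _ => R^o) 1 [set f | smooth f].

Definition dsum (E F : bundle M) : bundle M :=
  @Bundle R M (fun p => (E p * F p)%type) (rank E + rank F)
    [set s | smooth_sec (fun p => (s p).1) /\ smooth_sec (fun p => (s p).2)].

End Bundles.

Arguments TB {R}.
Arguments cotangent {R}.
Arguments line_bundle {R}.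

(* The manifold structure of the total space: over an open subset U of the
   domain of a chart c, on which the smooth sections e_1, ..., e_r form a frame,
   the point sum_i y_i e_i(p) has coordinates (cmap c p, y). *)
Definition total_space (R : realType) (M : smoothType R) (E : bundle M) :
    smoothType R :=
  @SmoothType R {p : M & E p} (mdim M + rank E)
    [set C | exists (c : chart R M (mdim M)) (U : set M)
                    (e : 'I_(rank E) -> section E),
      [/\ atlas c /\ (U `<=` dom c /\ open (cmap c @` U)),
          forall i, smooth_sec (e i),
          forall p, U p -> forall u : E p,
            exists! y : 'rV[R]_(rank E), u = \sum_i y 0 i *: e i p,
          dom C = [set q | U (projT1 q)] &
          forall q, dom C q ->
            lsubmx (cmap C q) = cmap c (projT1 q) /\
            projT2 q =
              \sum_i (rsubmx (cmap C q)) 0 i *: e i (projT1 q)]].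

(** * Calculus on M *)

Section Calculus.
Context (R : realType) (M : smoothType R).
Implicit Types (X Y Z : section (TB M)) (a b : section (cotangent M)).

Definition lie X Y : section (TB M) :=
  fun p => tvec_of p
    (fun f => X p (fun q => Y q f) - Y p (fun q => X q f)).

Definition covec_of (Phi : section (TB M) -> M -> R) : section (cotangent M) :=
  fun p => xget (0 : dual (tvec p))
    [set l : dual (tvec p) |
      forall Z : section (TB M), smooth_sec Z -> l (Z p) = Phi Z p].

Definition differential (f : M -> R) : section (cotangent M) :=
  covec_of (fun Z p => Z p f).

Definition d_form a X Y : M -> R :=
  fun p => X p (fun q => a q (Y q)) - Y p (fun q => a q (X q))
           - a p (lie X Y p).

Definition lie_form X b : section (cotangent M) :=
  covec_of (fun Z p => X p (fun q => b q (Z q)) - b p (lie X Z p)).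

Definition connection_op (E : bundle M) :=
  section (TB M) -> section E -> section E.

Definition is_connection (E : bundle M) (D : connection_op E) : Prop :=
  [/\ forall X s, smooth_sec X -> smooth_sec s -> smooth_sec (D X s),
      forall X Y s, smooth_sec X -> smooth_sec Y -> smooth_sec s ->
        forall p, D (fun q => X q + Y q) s p = D X s p + D Y s p,
      forall (f : M -> R) X s, smooth f -> smooth_sec X -> smooth_sec s ->
        forall p, D (fun q => f q *: X q) s p = f p *: D X s p,
      forall X s t, smooth_sec X -> smooth_sec s -> smooth_sec t ->
        forall p, D X (fun q => s q + t q) p = D X s p + D X t p &
      forall (f : M -> R) X s, smooth f -> smooth_sec X -> smooth_sec s ->
        forall p, D X (fun q => f q *: s q) p
                  = (X p f : R) *: s p + f p *: D X s p].

Definition dual_connection (nabla : connection_op (TB M)) :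
    connection_op (cotangent M) :=
  fun X a => covec_of
    (fun Z p => X p (fun q => a q (Z q)) - a p (nabla X Z p)).

Definition torsion_free (nabla : connection_op (TB M)) : Prop :=
  forall X Y, smooth_sec X -> smooth_sec Y ->
  forall p, nabla X Y p - nabla Y X p = lie X Y p.

Definition flat (nabla : connection_op (TB M)) : Prop :=
  forall X Y Z, smooth_sec X -> smooth_sec Y -> smooth_sec Z ->
  forall p, nabla X (nabla Y Z) p - nabla Y (nabla X Z) p
            - nabla (lie X Y) Z p = 0.

Definition endo := forall p : M, {linear tvec p -> tvec p}.

Definition almost_complex (J : endo) : Prop :=
  (forall X, smooth_sec X -> smooth_sec (fun p => J p (X p) : TB M p)) /\
  (forall p u, J p (J p u) = - u).

Definition d_nabla (nabla : connection_op (TB M)) (J : endo) X Y :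
    section (TB M) :=
  fun p => nabla X (fun q => J q (Y q)) p - nabla Y (fun q => J q (X q)) p
           - J p (lie X Y p).

Definition special_complex (J : endo) (nabla : connection_op (TB M)) : Prop :=
  flat nabla /\
  (forall X Y, smooth_sec X -> smooth_sec Y ->
   forall p, d_nabla nabla J X Y p = 0).

End Calculus.

(** * Courant algebroids *)

Record tuple_on (R : realType) (M : smoothType R) (V : bundle M) := TupleOn {
  pairing : forall p, V p -> V p -> R^o;
  anchor : forall p, {linear V p -> tvec p};
  bracket : section V -> section V -> section V }.

Section Courant.
Context (R : realType) (M : smoothType R) (V : bundle M) (t : tuple_on V).
Implicit Types (a b c : section V) (f : M -> R).

Local Notation "[| a , b |]" := (bracket t a b).

Definition pair_sec a b : M -> R := fun p => pairing t (a p) (b p).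

Definition anchor_sec a : section (TB M) := fun p => anchor t p (a p).

Definition anchor_star (al : section (cotangent M)) : section V :=
  fun p => xget (0 : V p)
    [set u : V p | forall v : V p, pairing t u v = al p (anchor t p v)].

Definition is_tuple : Prop :=
  [/\ (forall p (u : V p), linear (pairing t u)),
      (forall p (u v : V p), pairing t u v = pairing t v u),
      (forall p (u : V p), (forall v, pairing t u v = 0) -> u = 0),
      (forall a b, smooth_sec a -> smooth_sec b -> smooth (pair_sec a b)) /\
      (forall a, smooth_sec a -> smooth_sec (anchor_sec a)) /\
      (forall a b, smooth_sec a -> smooth_sec b -> smooth_sec [|a, b|]) &
      (forall (k : R) a b c, smooth_sec a -> smooth_sec b -> smooth_sec c ->
        forall p, [|fun q => k *: a q + b q, c|] p
                    = k *: [|a, c|] p + [|b, c|] p /\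
                  [|c, fun q => k *: a q + b q|] p
                    = k *: [|c, a|] p + [|c, b|] p)].

Definition Ca1 : Prop :=
  forall a b, smooth_sec a -> smooth_sec b ->
  forall p, [|a, b|] p + [|b, a|] p
            = anchor_star (differential (pair_sec a b)) p.

Definition Ca2 : Prop :=
  forall a b c, smooth_sec a -> smooth_sec b -> smooth_sec c ->
  forall p, anchor_sec a p (pair_sec b c)
            = pair_sec [|a, b|] c p + pair_sec b [|a, c|] p.

Definition Ca3 : Prop :=
  forall a b c, smooth_sec a -> smooth_sec b -> smooth_sec c ->
  forall p, [|a, [|b, c|]|] p = [|[|a, b|], c|] p + [|b, [|a, c|]|] p.

Definition Ca4 : Prop :=
  forall f a b, smooth f -> smooth_sec a -> smooth_sec b ->
  forall p, [|a, fun q => f q *: b q|] p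
            = (anchor_sec a p f : R) *: b p + f p *: [|a, b|] p.

Definition Ca5 : Prop :=
  forall f a b, smooth f -> smooth_sec a -> smooth_sec b ->
  forall p, [|fun q => f q *: a q, b|] p
            = - ((anchor_sec b p f : R) *: a p) + f p *: [|a, b|] p
              + pair_sec a b p *: anchor_star (differential f) p.

Definition is_courant_algebroid : Prop := [/\ is_tuple, Ca1, Ca2 & Ca3].

End Courant.

(** * The Courant algebroid lift *)

Section Lift.
Context (R : realType) (M : smoothType R) (E : bundle M).

Definition vlift (phi : section E) : section (TB (total_space E)) :=
  fun q => tvec_of q (fun F : total_space E -> R =>
    derive1 (fun h : R => F (existT _ (projT1 q)
                               (projT2 q + h *: phi (projT1 q))) : R^o) 0).

(* X^h_q = ds(X_p) - (D_X s)^v_q for any smooth section s through q. *)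
Definition hlift (D : connection_op E) (X : section (TB M)) :
    section (TB (total_space E)) :=
  fun q => xget (0 : tvec q)
    [set v : tvec q |
      forall s : section E, smooth_sec s -> s (projT1 q) = projT2 q ->
      forall F : total_space E -> R, smooth F ->
        v F = X (projT1 q) (fun p => F (existT _ p (s p)))
              - vlift (D X s) q F].

Definition phi_lift (D : connection_op E) (a : section (dsum (TB M) E)) :
    section (TB (total_space E)) :=
  fun q => hlift D (fun p => (a p).1) q + vlift (fun p => (a p).2) q.

Definition is_courant_lift (t : tuple_on (dsum (TB M) E))
    (D : connection_op E) (L : tuple_on (TB (total_space E))) : Prop :=
  [/\ is_tuple L,
      forall a b, smooth_sec a -> smooth_sec b -> forall q,
        pairing L (phi_lift D a q) (phi_lift D b q)
        = pair_sec t a b (projT1 q),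
      forall a, smooth_sec a -> forall q,
        anchor L q (phi_lift D a q) = hlift D (anchor_sec t a) q,
      forall a b, smooth_sec a -> smooth_sec b -> forall q,
        bracket L (phi_lift D a) (phi_lift D b) q
        = phi_lift D (bracket t a b) q &
      Ca4 L /\ Ca5 L].

End Lift.

(** * The B_n-Courant algebroid *)

Section Bn.
Context (R : realType) (M : smoothType R).

Definition bnE : bundle M := dsum (cotangent M) (line_bundle M).

Definition bn_bundle : bundle M := dsum (TB M) bnE.

Definition bn_pairing (p : M) (a b : bn_bundle p) : R^o :=
  let: (X, (al, f)) := a in let: (Y, (be, g)) := b in
  al Y + be X + f * g.

Definition bn_anchor (p : M) : {linear bn_bundle p -> tvec p} :=
  (@fst (tvec p) (bnE p) : {linear _ -> _}).

Definition bn_bracket (a b : section bn_bundle) : section bn_bundle :=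
  let X : section (TB M) := fun p => (a p).1 in
  let al : section (cotangent M) := fun p => (a p).2.1 in
  let f : M -> R := fun p => (a p).2.2 in
  let Y : section (TB M) := fun p => (b p).1 in
  let be : section (cotangent M) := fun p => (b p).2.1 in
  let g : M -> R := fun p => (b p).2.2 in
  fun p =>
    (lie X Y p,
     (lie_form X be p - covec_of (d_form al Y) p + g p *: differential f p,
      X p g - Y p f)).

Definition bn_courant : tuple_on bn_bundle :=
  TupleOn bn_pairing bn_anchor bn_bracket.

Definition nablaJ (J : endo M) (nabla : connection_op (TB M)) :
    connection_op bnE :=
  fun X s =>
    let al : section (cotangent M) := fun p => (s p).1 in
    let f : M -> R := fun p => (s p).2 in
    fun p => (dual_connection nabla X al p, X p f + al p (J p (X p))).

End Bn.

(* Main.v *)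
From HB Require Import structures.
Require Import Defs.
From mathcomp Require Import all_boot all_order all_algebra.
From mathcomp Require Import all_classical all_reals all_analysis.
From mathcomp Require Import ring lra.
Set Implicit Arguments.
Unset Strict Implicit.
Unset Printing Implicit Defensive.
Import Order.TTheory GRing.Theory Num.Theory.
Import numFieldNormedType.Exports.
Local Open Scope classical_set_scope.
Local Open Scope ring_scope.

(** Write E for the total space of T*M + R and phi a for the vector field on E
  lifted from a section a of the B_n-Courant algebroid.  On lifted fields the
  bracket, the pairing and the anchor of the lift are those of B_n, which is a
  Courant algebroid ([bn_Ca1], [bn_Ca2], [bn_Ca3]); hence every axiom of the
  lift holds as soon as all its arguments are lifted fields.  Lifted fields
  generate the vector fields on E over the functions, so an axiom holds in
  general as soon as its defect is linear over the functions in each argument.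
  By (Ca4) and (Ca5) this is always so for (Ca1) and (Ca2), whereas the
  Jacobiator [jac] satisfies

    jac a b (F c) = F jac a b c + (rho a (rho b F) - rho b (rho a F) - rho [a, b] F) c

  ([jac_scaler]).  What decides is therefore whether the anchor maps brackets to
  Lie brackets.  If it does, the Jacobi identity extends from lifted fields to
  all fields ([courant_from_generators]).  If (Ca3) holds, the formula, with c
  the lift of the section 1 of the trivial line bundle, which vanishes nowhere,
  shows that it does.  On lifted fields this morphism property reads
  [X^h, Y^h] = [X, Y]^h, the flatness of the connection nabla^J; it passes from
  lifted fields to all of them because the anchor rho kills the image of its
  adjoint, which consists of vertical fields ([anchor_morphism],
  [lift_grad_ex]).

  It remains to compute the curvature of nabla^J.  A tangent vector of E is
  determined by its values on the functions [pull f], for f on M, on the momenta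
  [mom Z], which send al + t to al(Z), and on [height], which sends al + t to t
  ([total_eq]).  The horizontal lift of X sends these to pull (X f), to
  mom (nabla_X Z) and to - mom (J X).  So the difference [X^h, Y^h] - [X, Y]^h
  kills the pulled back functions, sends mom Z to the momentum of R(X, Y) Z and
  height to minus the momentum of (d^nabla J)(X, Y).  It vanishes for all X and
  Y if and only if nabla is flat and d^nabla J = 0.

  All this rests on computing with tangent vectors, which are derivations of the
  algebra of global smooth functions.  Hadamard's lemma ([hadamard]) and cutoff
  functions ([manifold_cutoff]) give the formula v f = sum_i v(z_i) d_i f in
  coordinates z_i that extend to global functions ([coords_derivation]).  That
  lemma is stated for any set with an atlas so that it serves both M and E; on E
  the charts are products of a ball with the whole fibre, and the cutoff
  functions pulled back from M suffice. *)

(** * Maps of class C^k between normed spaces *)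

Section Differentiability.
Context (R : realType) (V W : normedModType R).
Implicit Types f g : V -> W.

Lemma differentiable_intro f x (df : {linear V -> W}) : continuous df ->
  (forall e : R, 0 < e ->
     \forall h \near (0 : V), `|f (h + x) - f x - df h| <= e * `|h|) ->
  differentiable f x /\ 'd f x = df :> (V -> W).
Proof.
move=> dfc H.
have E : f \o shift x = cst (f x) + df +o_ 0 id.
  apply/eqaddoP => e e0; near=> h.
  have -> : (f \o shift x - (cst (f x) + df)) h = f (h + x) - f x - df h.
    by rewrite /= opprD addrA.
  by near: h; exact: H.
have dE := diff_unique dfc E.
by split=> //; apply/diff_locallyP; rewrite dE.
Unshelve. all: by end_near. Qed.

Lemma near_eq_differentiable f g x : (\near x, f x = g x) ->
  differentiable f x -> differentiable g x.
Proof.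
move=> fg /diff_locallyP[dc E].
apply: (proj1 (@differentiable_intro _ _ ('d f x) _ _)) => // e e0.
have /eqaddoP/(_ e e0) {}E := E.
have fgx : f x = g x by exact: nbhs_singleton fg.
have fg' : \forall h \near (0 : V), f (h + x) = g (h + x).
  by move: fg; rewrite (near_shift 0) subr0.
near=> h.
have -> : g (h + x) - g x - 'd f x h = (f \o shift x - (cst (f x) + 'd f x)) h.
  rewrite /= -fgx opprD addrA; congr (_ - _ - _).
  by apply/esym; near: h.
by near: h.
Unshelve. all: by end_near. Qed.

End Differentiability.

Section CkBasics.
Context (R : realType) (V W : normedModType R).
Implicit Types (f g : V -> W) (O : set V).

Lemma Ck_subset k O O' f : O `<=` O' -> Ck k O' f -> Ck k O f.
Proof.
move=> sO; elim: k f => [|k IH] f /=; first by move=> H x /sO; exact: H.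
by case=> H1 H2; split=> [x /sO|v]; [exact: H1|exact/IH].
Qed.

Lemma Ck_local k O f :
  (forall x, O x -> exists2 O', O' x & Ck k O' f) -> Ck k O f.
Proof.
elim: k f => [|k IH] f /= H; first by move=> x /H[U Ux HU]; exact: HU.
split=> [x /H[U Ux [HU _]]|v]; first exact: HU.
by apply: IH => x /H[U Ux [_ HU]]; exists U.
Qed.

Lemma CkW k O f : Ck k.+1 O f -> Ck k O f.
Proof.
elim: k f => [|k IH] f [H1 H2]; first by move=> x /H1 /differentiable_continuous.
by split=> // v; exact: IH.
Qed.

Lemma Ck_ext k O f g : open O -> (forall x, O x -> f x = g x) ->
  Ck k O f -> Ck k O g.
Proof.
move=> oO; elim: k f g => [|k IH] f g fg.
  move=> H x Ox; have fgn : \near x, f x = g x.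
    by near=> y; apply: fg; near: y; exact: open_nbhs_nbhs.
  have fc : f @ x --> g x by rewrite -(fg x Ox); exact: H.
  by apply: cvg_trans fc; exact: near_eq_cvg.
have fgn x : O x -> \near x, f x = g x.
  by move=> Ox; near=> y; apply: fg; near: y; exact: open_nbhs_nbhs.
move=> [H1 H2]; split=> [x Ox|v].
  by apply: near_eq_differentiable (H1 x Ox); exact: fgn.
apply: (IH _ _ _ (H2 v)) => x Ox.
exact: near_eq_derive (fgn _ Ox).
Unshelve. all: by end_near. Qed.

Lemma Ck_cst k O (a : W) : Ck k O (fun=> a).
Proof.
elim: k a => [|k IH] a /=; first by move=> x _; exact: cvg_cst.
split=> [x _|v]; first exact: differentiable_cst.
rewrite (_ : 'D_v _ = fun=> 0) //.
by apply/funext => x; exact: derive_cst.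
Qed.

Lemma Ck_add k O f g : open O -> Ck k O f -> Ck k O g ->
  Ck k O (fun x => f x + g x).
Proof.
move=> oO; elim: k f g => [|k IH] f g /=.
  by move=> H1 H2 x Ox; exact: continuousD (H1 x Ox) (H2 x Ox).
move=> [f1 f2] [g1 g2]; split=> [x Ox|v].
  by apply: differentiableD; [exact: f1|exact: g1].
apply: (Ck_ext oO _ (IH _ _ (f2 v) (g2 v))) => x Ox.
by rewrite -deriveD//; apply: diff_derivable; [exact: f1|exact: g1].
Qed.

Lemma Ck_sum k O n (F : 'I_n -> V -> W) : open O ->
  (forall i, Ck k O (F i)) -> Ck k O (fun x => \sum_i F i x).
Proof.
move=> oO; elim: n F => [|n IH] F H.
  by under eq_fun do rewrite big_ord0; exact: Ck_cst.
under eq_fun do rewrite big_ord_recl.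
by apply: Ck_add => //; exact: IH.
Qed.

End CkBasics.

Section CkReal.
Context (R : realType) (V : normedModType R).
Implicit Types (f g : V -> R^o) (O : set V).

Lemma Ck_mul k O f g : open O -> Ck k O f -> Ck k O g ->
  Ck k O (fun x => f x * g x : R^o).
Proof.
move=> oO; elim: k f g => [|k IH] f g.
  by move=> H1 H2 x Ox; exact: continuousM (H1 x Ox) (H2 x Ox).
move=> F G; have [f1 f2] := F; have [g1 g2] := G; split=> [x Ox|v].
  by apply: differentiableM; [exact: f1|exact: g1].
have := Ck_add oO (IH _ _ (CkW F) (g2 v)) (IH _ _ (CkW G) (f2 v)).
apply: Ck_ext => // x Ox.
rewrite -[RHS]/('D_v (f * g) x) deriveM//; apply: diff_derivable;
  by [exact: f1|exact: g1].
Qed.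

Lemma Ck_scale k O (a : R) f : open O -> Ck k O f ->
  Ck k O (fun x => a * f x : R^o).
Proof. by move=> oO H; apply: Ck_mul => //; exact: Ck_cst. Qed.

Lemma Ck_opp k O f : open O -> Ck k O f -> Ck k O (fun x => - f x : R^o).
Proof.
move=> oO H; apply: (Ck_ext oO _ (Ck_scale (-1) oO H)) => x _.
by rewrite mulN1r.
Qed.

Lemma Ck_sub k O f g : open O -> Ck k O f -> Ck k O g ->
  Ck k O (fun x => f x - g x : R^o).
Proof. by move=> oO H1 H2; apply: Ck_add => //; exact: Ck_opp. Qed.

Lemma Ck_prod k O n (F : 'I_n -> V -> R^o) : open O ->
  (forall i, Ck k O (F i)) -> Ck k O (fun x => \prod_i F i x : R^o).
Proof.
move=> oO; elim: n F => [|n IH] F H.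
  by under eq_fun do rewrite big_ord0; exact: Ck_cst.
under eq_fun do rewrite big_ord_recl.
by apply: Ck_mul => //; exact: IH.
Qed.

Lemma Ck_inv k O f : open O -> (forall x, O x -> f x != 0) -> Ck k O f ->
  Ck k O (fun x => (f x)^-1 : R^o).
Proof.
move=> oO f0; elim: k => [|k IH].
  by move=> H x Ox; exact: continuousV (f0 x Ox) (H x Ox).
move=> F; have [f1 f2] := F; split=> [x Ox|v].
  by apply: differentiableV; [exact: f1|exact: f0].
have fV := IH (CkW F).
have := Ck_opp oO (Ck_mul oO (f2 v) (Ck_mul oO fV fV)).
apply: Ck_ext => // x Ox.
rewrite (deriveV (f0 _ Ox)); last by apply: diff_derivable; exact: f1.
by rewrite -exprVn -[RHS]/(_ * _) mulNr expr2 mulrC.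
Qed.

End CkReal.

Section CkCoord.
Context (R : realType).

Definition bvec m (i : 'I_m) : 'rV[R]_m := delta_mx 0 i.

Lemma derive_coord m i (v x : 'rV[R]_m) :
  'D_v (fun x : 'rV[R]_m => x 0 i : R^o) x = v 0 i.
Proof.
have := @derive_mx _ _ _ _ id x v (@derivable_id _ _ _ _).
by rewrite derive_id => {2}->; rewrite mxE.
Qed.

Lemma Ck_coord k m (O : set 'rV[R]_m) i : Ck k O (fun x => x 0 i : R^o).
Proof.
case: k => [|k] /=; first by move=> x _; exact: coord_continuous.
split=> [x _|v]; first exact: differentiable_coord.
rewrite (_ : 'D_v _ = fun=> v 0 i); first exact: Ck_cst.
by apply/funext => x; exact: derive_coord.
Qed.

Context (V : normedModType R).

Lemma rV_sum m (x : 'rV[R]_m) : x = \sum_i x 0 i *: bvec i.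
Proof. by rewrite [LHS]row_sum_delta. Qed.

Lemma differentiable_rV m (g : V -> 'rV[R]_m) x :
  (forall i, differentiable (fun x => g x 0 i : R^o) x) -> differentiable g x.
Proof.
move=> H; rewrite (_ : g = \sum_i (fun x => g x 0 i *: bvec i)).
  by apply: differentiable_sum => i; apply: differentiableZl.
by apply/funext => y; rewrite fct_sumE [LHS]rV_sum.
Qed.

Lemma continuous_rV m (g : V -> 'rV[R]_m) x :
  (forall i, {for x, continuous (fun x => g x 0 i : R^o)}) ->
  {for x, continuous g}.
Proof.
move=> H; apply/cvgrPdist_le => /= e e0; near=> y.
rewrite [leLHS]/Num.Def.normr/= mx_normrE (bigmax_le _ (ltW e0))//= => i _.
rewrite !mxE/= (ord1 i.1); move: {i}i.2; near: y; apply: filter_forall => /= i.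
exact: ((cvgrPdist_le _ _).1 (H i)).
Unshelve. all: by end_near. Qed.

Lemma derive_comp_rV m (f : 'rV[R]_m -> R^o) (g : V -> 'rV[R]_m) x v :
  (forall i, differentiable (fun x => g x 0 i : R^o) x) ->
  differentiable f (g x) ->
  'D_v (f \o g) x =
    \sum_i 'D_v (fun x => g x 0 i : R^o) x * 'D_(bvec i) f (g x).
Proof.
move=> gi df; have dg := differentiable_rV gi.
rewrite deriveE; last exact: differentiable_comp.
rewrite diff_comp//= (rV_sum ('d g x v)) linear_sum.
apply: eq_bigr => i _; rewrite linearZ -!deriveE//; congr (_ * _).
by rewrite derive_mx ?mxE//; exact: diff_derivable.
Qed.

(** The chain rule writes a derivative of f o g with the derivatives of f along
  the coordinate directions and those of the coordinates of g; induction on k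
  only has to deal with real functions. *)
Lemma Ck_comp k m (O : set V) (O' : set 'rV[R]_m) (f : 'rV[R]_m -> R^o)
    (g : V -> 'rV[R]_m) : open O -> (forall x, O x -> O' (g x)) ->
  Ck k O' f -> (forall i, Ck k O (fun x => g x 0 i : R^o)) ->
  Ck k O (fun x => f (g x)).
Proof.
move=> oO OO'; elim: k f => [|k IH] f F G.
  move=> x Ox; apply: continuous_comp; last exact: F (OO' _ Ox).
  by apply: continuous_rV => i; exact: G.
have [f1 f2] := F.
have G1 x i : O x -> differentiable (fun x => g x 0 i : R^o) x.
  by have [+ _] := G i; exact.
split=> [x Ox|v].
  apply: differentiable_comp; last exact: f1 (OO' _ Ox).
  by apply: differentiable_rV => i; exact: G1.
have Gk i : Ck k O (fun x => g x 0 i : R^o) by apply: CkW; exact: G.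
have H i : Ck k O (fun x => 'D_v (fun x => g x 0 i : R^o) x *
     'D_(bvec i) f (g x) : R^o).
  by apply: Ck_mul => //; [by case: (G i) => _; exact|exact: IH _ (f2 (bvec i)) Gk].
apply: (Ck_ext oO _ (Ck_sum oO H)) => x Ox.
have := @derive_comp_rV _ f g x v (fun i => G1 x i Ox) (f1 _ (OO' _ Ox)).
by move=> ->.
Qed.

End CkCoord.
Arguments bvec {R m}.

(** * Segments and Taylor's formula *)

Section Lines.
Context (R : realType) (V : normedModType R).
Implicit Types (phi : V -> R^o) (O : set V).

Definition seg (x y : V) (t : R) : V := x + t *: (y - x).

Definition is_convex O := forall x y (t : R), O x -> O y -> 0 <= t <= 1 ->
  O (seg x y t).

Lemma is_derive_line phi y h (s : R) : differentiable phi (y + s *: h) ->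
  is_derive s (1 : R) (fun s : R => phi (y + s *: h)) ('D_h phi (y + s *: h)).
Proof.
move=> /(@diff_derivable _ _ _ _ _ h) dphi.
have E : (fun k : R => k^-1 *: (((fun s : R => phi (y + s *: h)) \o shift s)
              (k *: (1 : R)) - phi (y + s *: h))) =
         (fun k : R => k^-1 *: ((phi \o shift (y + s *: h)) (k *: h)
            - phi (y + s *: h))).
  apply/funext => k /=; congr (_ *: (phi _ - _)).
  by rewrite [k *: 1]mulr1 scalerDl addrCA.
by apply: DeriveDef; rewrite /derivable /derive E.
Qed.

Lemma continuous_seg x y : continuous (seg x y).
Proof.
move=> t; rewrite /continuous_at /seg; apply: cvgD; first exact: cvg_cst.
exact: scalel_continuous.
Qed.

Lemma continuous_line_within phi O x y : is_convex O -> O x -> O y ->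
  (forall z, O z -> {for z, continuous phi}) ->
  {in `[0, 1]%classic, continuous (fun t => phi (seg x y t))}.
Proof.
move=> cO Ox Oy H t; rewrite inE/= in_itv/= => t01.
apply: continuous_comp; first exact: continuous_seg.
by apply: H; exact: cO.
Qed.

(** The mean value theorem is applied to phi, then to its derivative along h.
  This costs the factor 1/2 of Taylor's formula, which is irrelevant below. *)
Lemma taylor2 phi y h (C : R) :
  (forall s : R, 0 <= s <= 1 -> differentiable phi (y + s *: h)) ->
  (forall s : R, 0 <= s <= 1 -> differentiable ('D_h phi) (y + s *: h)) ->
  (forall s : R, 0 <= s <= 1 -> `|'D_h ('D_h phi) (y + s *: h)| <= C) ->
  `|phi (y + h) - phi y - 'D_h phi y| <= C.
Proof.
move=> d1 d2 bC.
have line (psi : V -> R^o) (c : R) : 0 <= c <= 1 ->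
  (forall s : R, 0 <= s <= 1 -> differentiable psi (y + s *: h)) ->
  exists2 c' : R, 0 <= c' <= c & psi (y + c *: h) - psi y = 'D_h psi (y + c' *: h) * c.
  move=> /andP[c0 c1] dpsi.
  have [s|//|c'] := @MVT_segment R (fun s : R => psi (y + s *: h))
    (fun s : R => 'D_h psi (y + s *: h)) 0 c c0.
  - rewrite in_itv/= => /andP[s0 sc]; apply: is_derive_line; apply: dpsi.
    by rewrite (ltW s0) (le_trans (ltW sc)).
  - apply: continuous_in_subspaceT => s; rewrite inE/= in_itv/= => /andP[s0 sc].
    apply: differentiable_continuous; apply/derivable1_diffP.
    apply: ex_derive; apply: is_derive_line; apply: dpsi.
    by rewrite s0 (le_trans sc).
  - by rewrite in_itv/= scale0r addr0 subr0 => ? ?; exists c'.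
have [|c /andP[c0 c1]] := line phi 1 _ d1; first by rewrite ler01 lexx.
rewrite scale1r mulr1 => ->.
have c01 : 0 <= c <= 1 by rewrite c0.
have [c' /andP[c'0 c'c] ->] := line _ c c01 d2.
rewrite normrM (ger0_norm c0) -[leRHS]mulr1 ler_pM//; apply: bC.
by rewrite c'0 (le_trans c'c).
Qed.

End Lines.

(** * Hadamard's lemma *)

Section Hadamard.
Context (R : realType) (m : nat).
Local Notation V := 'rV[R]_m.
Variable (O : set V).
Hypotheses (oO : open O) (cO : is_convex O).
Variable x0 : V.
Hypothesis Ox0 : O x0.
Implicit Types (phi : V -> R^o).

Lemma derive_rV phi x (v : V) : differentiable phi x ->
  'D_v phi x = \sum_i v 0 i * 'D_(bvec i) phi x.
Proof.
move=> d; rewrite deriveE// [in LHS](rV_sum v) linear_sum.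
by apply: eq_bigr => i _; rewrite linearZ -deriveE.
Qed.

Lemma normr_coord_le (v : V) i : `|v 0 i| <= `|v|.
Proof.
rewrite [leRHS]/Num.Def.normr/= mx_normrE.
exact: (le_bigmax _ (fun i : 'I_1 * 'I_m => `|v i.1 i.2|) (0, i)).
Qed.

Lemma compact_norm_le (r : R) : compact [set w : V | `|w| <= r].
Proof.
apply: bounded_closed_compact.
  exists r; split; first exact: num_real.
  by move=> s rs x /= xr; exact: le_trans xr (ltW rs).
rewrite (_ : mkset _ = closed_ball_ Num.norm (0 : V) r).
  exact: closed_closed_ball_.
by apply/seteqP; split=> w /=; rewrite /closed_ball_/= sub0r normrN.
Qed.

(** A radius that works at both ends of the segment works along all of it: a
  translate of the segment whose ends lie in the convex set O lies in O. *)
Lemma segment_tube x : O x -> exists2 d : R, 0 < d &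
  forall t w, 0 <= t <= 1 -> `|w| <= d -> O (seg x0 x t + w).
Proof.
move=> Ox.
have ball_in y : O y -> exists2 d : R, 0 < d & forall w : V, `|w| < d -> O (y + w).
  move=> Oy; have /nbhs_ballP[d /= d0 H] : nbhs y O by exact: open_nbhs_nbhs.
  exists d => // w wd; apply: H; rewrite -ball_normE /ball_/=.
  by rewrite opprD addrA subrr sub0r normrN.
have [d0 d00 H0] := ball_in _ Ox0; have [d1 d10 H1] := ball_in _ Ox.
exists (Num.min d0 d1 / 2); first by rewrite divr_gt0// lt_min d00.
move=> t w t01 wd.
have lt2 (d : R) : 0 < d -> d / 2 < d by lra.
have w0 : `|w| < d0.
  by apply: (le_lt_trans wd); apply: lt_le_trans (lt2 _ _) _;
    rewrite ?lt_min ?d00// ge_min lexx.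
have w1 : `|w| < d1.
  by apply: (le_lt_trans wd); apply: lt_le_trans (lt2 _ _) _;
    rewrite ?lt_min ?d00// ge_min lexx orbT.
have -> : seg x0 x t + w = seg (x0 + w) (x + w) t.
  rewrite /seg -addrA [RHS]addrAC -addrA; congr (_ + (_ *: _ + _)).
  by rewrite opprD addrACA subrr addr0.
by apply: cO => //; [exact: H0|exact: H1].
Qed.

(** The tube is the continuous image of a product of compact sets. *)
Lemma tube_bound x (S : V -> R^o) (d : R) :
  (forall t w, 0 <= t <= 1 -> `|w| <= d -> O (seg x0 x t + w)) ->
  (forall z, O z -> {for z, continuous S}) ->
  exists2 C : R, 0 <= C &
  forall t w, 0 <= t <= 1 -> `|w| <= d -> `|S (seg x0 x t + w)| <= C.
Proof.
move=> dO cS.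
pose K : set (R * V) := `[0 : R, 1]%classic `*` [set w : V | `|w| <= d].
have cK : compact K.
  by apply: compact_setX; [exact: segment_compact|exact: compact_norm_le].
have : compact ((fun tw : R * V => S (seg x0 x tw.1 + tw.2)) @` K).
  apply: continuous_compact => //; apply: continuous_in_subspaceT => -[t w].
  rewrite inE/= => -[/=]; rewrite in_itv/= => t01 wd.
  apply: (@continuous_comp _ _ _ (fun tw : R * V => seg x0 x tw.1 + tw.2) S).
    rewrite /continuous_at/=; apply: cvgD; last exact: cvg_snd.
    apply: (@continuous_comp _ _ _ (fun tw : R * V => tw.1) (seg x0 x)).
      exact: cvg_fst.
    exact: continuous_seg.
  by apply: cS; exact: dO.
move=> /compact_bounded[C [_ HC]]; exists (Num.max 0 (C + 1)).
  by rewrite le_max lexx.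
move=> t w t01 wd; rewrite le_max; apply/orP; right; apply: HC; first by rewrite ltrDl.
by exists (t, w) => //; split => //=; rewrite in_itv.
Qed.

Let mu := @lebesgue_measure R.

(** Hadamard's functions are the averages of the partial derivatives of phi over
  the segments from x0.  Differentiating in x under the integral produces a
  factor t; the weight t^j makes the family stable under differentiation. *)
Definition avg (j : nat) phi (x : V) : R^o :=
  \int[mu]_(t in `[0, 1]) (t ^+ j * phi (seg x0 x t)).

Definition contO phi := forall z, O z -> {for z, continuous phi}.

Lemma avg_integrable (f : R -> R) : {in `[0, 1]%classic, continuous f} ->
  mu.-integrable `[0, 1] (EFin \o f).
Proof.
move=> H; apply: continuous_compact_integrable; first exact: segment_compact.
exact: continuous_in_subspaceT.
Qed.

Let continuous_inB (f g : R -> R) : {in `[0, 1]%classic, continuous f} ->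
  {in `[0, 1]%classic, continuous g} ->
  {in `[0, 1]%classic, continuous (fun t => f t - g t)}.
Proof. by move=> cf cg t At; exact: continuousB (cf t At) (cg t At). Qed.

Lemma avg_continuous j phi x : contO phi -> O x ->
  {in `[0, 1]%classic, continuous (fun t : R => t ^+ j * phi (seg x0 x t))}.
Proof.
move=> c Ox t t01; apply: (@continuousM R R (fun t => t ^+ j) (fun t => phi (seg x0 x t))).
  exact: exprn_continuous.
exact: continuous_line_within c _ t01.
Qed.

Lemma smooth_contO phi : smooth_on O phi -> contO phi.
Proof. by move=> H; exact: (H 0%N). Qed.

Lemma smooth_diffO phi : smooth_on O phi -> forall z, O z -> differentiable phi z.
Proof. by move=> H; have [] := H 1%N. Qed.

Lemma smooth_derive phi (v : V) : smooth_on O phi -> smooth_on O ('D_v phi).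
Proof. by move=> H k; have [_] := H k.+1; exact. Qed.

(** The constant C does not depend on t, so the estimate can be integrated in t:
  this is differentiation under the integral sign for [avg]. *)
Lemma taylor_segment phi x : smooth_on O phi -> O x ->
  exists2 d : R, 0 < d & exists2 C : R, 0 <= C &
  (forall h : V, `|h| <= d -> O (x + h)) /\
  forall (t : R) (h : V), 0 <= t <= 1 -> `|h| <= d ->
    `|phi (seg x0 (x + h) t) - phi (seg x0 x t)
      - t * 'D_h phi (seg x0 x t)| <= C * `|h| ^+ 2.
Proof.
move=> sphi Ox; have [d d0 dO] := segment_tube Ox; exists d => //.
(* S bounds the second derivative along any h by S z |h|^2. *)
pose S z : R^o := \sum_i \sum_j `|'D_(bvec i) ('D_(bvec j) phi) z|.
have cS : Ck 0 O S.
  apply: Ck_sum => // i; apply: Ck_sum => // j z Oz.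
  have /= := smooth_contO (smooth_derive (bvec i) (smooth_derive (bvec j) sphi)) Oz.
  by rewrite /continuous_at => /cvg_norm.
have [C C0 HC] := tube_bound dO cS; exists C => //; split=> [h hd|t h t01 hd].
  have := dO 1 h; rewrite /seg scale1r addrCA subrr addr0; apply=> //.
  by rewrite ler01 lexx.
have [t0 t1] := andP t01.
have -> : seg x0 (x + h) t = seg x0 x t + t *: h.
  by rewrite /seg -[RHS]addrA -scalerDr [x + h - x0]addrAC.
set y := seg x0 x t.
have inO s : 0 <= s <= 1 -> O (y + s *: (t *: h)).
  move=> /andP[s0 s1]; apply: dO => //; rewrite scalerA normrZ.
  apply: le_trans hd; rewrite ler_piMl// ger0_norm ?mulr_ge0//.
  by rewrite mulr_ile1.
have Oy : O y by have := inO 0; rewrite scale0r addr0; apply; rewrite lexx ler01.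
have D1 z (v : V) : O z -> 'D_v phi z = \sum_i v 0 i * 'D_(bvec i) phi z.
  by move=> Oz; rewrite derive_rV//; exact: smooth_diffO.
have -> : t * 'D_h phi y = 'D_(t *: h) phi y.
  by rewrite !D1// mulr_sumr; apply: eq_bigr => i _; rewrite mxE mulrA.
apply: taylor2.
- by move=> s s01; apply: smooth_diffO => //; exact: inO.
- by move=> s s01; apply: smooth_diffO; [exact: smooth_derive|exact: inO].
move=> s s01; have Oz := inO s s01; set z := y + _ in Oz *.
have -> : 'D_(t *: h) ('D_(t *: h) phi) z =
    \sum_i \sum_j (t *: h) 0 i * ((t *: h) 0 j * 'D_(bvec i) ('D_(bvec j) phi) z).
  rewrite derive_rV; last exact: smooth_diffO (smooth_derive _ sphi) _ Oz.
  apply: eq_bigr => i _; rewrite -mulr_sumr; congr (_ * _).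
  transitivity ('D_(bvec i) (\sum_j (fun z => (t *: h) 0 j *: 'D_(bvec j) phi z)) z).
    apply: near_eq_derive; near=> w; rewrite fct_sumE; apply: D1.
    by near: w; exact: open_nbhs_nbhs.
  have dj j : derivable (fun z => 'D_(bvec j) phi z) z (bvec i).
    by apply: diff_derivable; exact: smooth_diffO (smooth_derive _ sphi) _ Oz.
  rewrite derive_sum => [|j]; last exact: derivableZ.
  by apply: eq_bigr => j _; rewrite deriveZ.
have hle i : `|(t *: h) 0 i| <= `|h|.
  rewrite mxE normrM -[leRHS]mul1r ler_pM//; last exact: normr_coord_le.
  by rewrite ger0_norm.
apply: (@le_trans _ _ (S z * `|h| ^+ 2)); last first.
  rewrite ler_wpM2r ?exprn_ge0//; apply: le_trans (HC t (s *: (t *: h)) _ _) => //.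
    exact: ler_norm.
  move: s01 => /andP[s0 s1]; rewrite scalerA normrZ.
  apply: le_trans hd; rewrite ler_piMl// ger0_norm ?mulr_ge0//.
  by rewrite mulr_ile1.
rewrite /S mulr_suml; apply: le_trans (ler_norm_sum _ _ _) _.
apply: ler_sum => i _; rewrite mulr_suml; apply: le_trans (ler_norm_sum _ _ _) _.
apply: ler_sum => j _; rewrite mulrA mulrC !normrM ler_wpM2l//.
by rewrite expr2 ler_pM.
Unshelve. all: by end_near. Qed.

Lemma avg_add j (f g : V -> R^o) x : contO f -> contO g -> O x ->
  avg j (fun z => f z + g z) x = avg j f x + avg j g x.
Proof.
move=> cf cg Ox; rewrite /avg -RintegralD//; try exact/avg_integrable/avg_continuous.
by apply: eq_Rintegral => t _; rewrite mulrDr.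
Qed.

Lemma avg_scale j (a : R) (f : V -> R^o) x : contO f -> O x ->
  avg j (fun z => a * f z) x = a * avg j f x.
Proof.
move=> cf Ox; rewrite /avg -RintegralZl//; try exact/avg_integrable/avg_continuous.
by apply: eq_Rintegral => t _; rewrite mulrCA.
Qed.

Lemma avg_ext j (f g : V -> R^o) x : (forall z, O z -> f z = g z) -> O x ->
  avg j f x = avg j g x.
Proof.
move=> fg Ox; apply: eq_Rintegral => t; rewrite inE/= in_itv/= => t01.
by rewrite fg//; exact: cO.
Qed.

Lemma avg_sum j n (a : 'I_n -> R) (F : 'I_n -> V -> R^o) x :
  (forall i, contO (F i)) -> O x ->
  avg j (fun z => \sum_i a i * F i z) x = \sum_i a i * avg j (F i) x.
Proof.
move=> + Ox; elim: n a F => [|n IH] a F cF.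
  under eq_fun do rewrite big_ord0.
  rewrite big_ord0 /avg; under eq_Rintegral do rewrite mulr0.
  by rewrite Rintegral_cst// mul0r.
under eq_fun do rewrite big_ord_recl.
have cZ i : contO (fun z => a i * F i z).
  exact: (@Ck_scale _ _ 0 _ _ _ oO (cF i)).
rewrite avg_add//; last first.
  apply: (@Ck_sum _ _ _ 0 _ _ (fun i z => a (lift ord0 i) * F (lift ord0 i) z : R^o)) => // i.
  exact: cZ.
by rewrite avg_scale// IH// big_ord_recl.
Qed.

Lemma mu01 : fine (mu `[0, 1]%classic) = 1.
Proof. by rewrite /mu lebesgue_measure_itv/= lte_fin ltr01 sube0. Qed.

Lemma avg_derive j phi x : smooth_on O phi -> O x ->
  differentiable (avg j phi) x /\
  forall v, 'D_v (avg j phi) x = \sum_i v 0 i * avg j.+1 ('D_(bvec i) phi) x.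
Proof.
move=> sphi Ox.
pose c i := avg j.+1 ('D_(bvec i) phi) x.
pose L (h : V) : R^o := \sum_i h 0 i * c i.
have Llin : linear L.
  move=> a h k; transitivity (a * L h + L k) => //; rewrite /L mulr_sumr -big_split/=.
  by apply: eq_bigr => i _; rewrite !mxE mulrDl mulrA.
pose df : {linear V -> R^o} := HB.pack L (GRing.isLinear.Build _ _ _ _ _ Llin).
have dfc : continuous df.
  have : Ck 0 setT L.
    rewrite /L; apply: Ck_sum => [|i]; first exact: openT.
    apply: Ck_mul; [exact: openT|exact: Ck_coord|exact: Ck_cst].
  by move=> H z; exact: H.
have [d d0 [C C0 [inO tay]]] := taylor_segment sphi Ox.
have cphi := smooth_contO sphi.
have cDphi v : contO ('D_v phi) by apply: smooth_contO; exact: smooth_derive.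
suff [H1 H2] : differentiable (avg j phi) x /\ 'd (avg j phi) x = df :> (V -> R^o).
  by split=> // v; rewrite deriveE// H2.
apply: differentiable_intro => // e e0.
have Ce : 0 < (if C == 0 then 1 else e / C).
  by case: eqVneq => // Cn0; rewrite divr_gt0// lt_neqAle eq_sym Cn0.
have nd : \forall h \near (0 : V), `|h| <= d := @nbhs0_le _ V _ d0.
have ne := @nbhs0_le _ V _ Ce.
near=> h.
have hd : `|h| <= d by near: h.
have he : `|h| <= (if C == 0 then 1 else e / C) by near: h.
have Oxh := inO h hd.
have -> : df h = avg j.+1 ('D_h phi) x.
  rewrite (avg_ext j.+1 (g := fun z => \sum_i h 0 i * 'D_(bvec i) phi z))//.
    by rewrite avg_sum.
  by move=> z Oz; apply: derive_rV; exact: smooth_diffO.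
have i1 := avg_integrable (@avg_continuous j _ _ cphi Oxh).
have i2 := avg_integrable (@avg_continuous j _ _ cphi Ox).
have i3 := avg_integrable (@avg_continuous j.+1 _ _ (cDphi h) Ox).
have i12 := avg_integrable (continuous_inB (@avg_continuous j _ _ cphi Oxh)
  (@avg_continuous j _ _ cphi Ox)).
rewrite [h + x]addrC /avg -(RintegralB _ i1 i2)// -(RintegralB _ i12 i3)//.
have ci : {in `[0, 1]%classic, continuous (fun t : R =>
    t ^+ j * phi (seg x0 (x + h) t) - t ^+ j * phi (seg x0 x t) -
        t ^+ j.+1 * 'D_h phi (seg x0 x t))}.
  exact: (continuous_inB (continuous_inB (@avg_continuous j _ _ cphi Oxh)
    (@avg_continuous j _ _ cphi Ox)) (@avg_continuous j.+1 _ _ (cDphi h) Ox)).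
apply: (@le_trans _ _ (C * `|h| ^+ 2)).
  apply: le_trans (le_normr_Rintegral _ _) _ => //; first exact: avg_integrable ci.
  apply: (@le_trans _ _ (\int[mu]_(t in `[0, 1]) (C * `|h| ^+ 2))).
    have ciN : {in `[0, 1]%classic, continuous (fun t : R =>
      `|t ^+ j * phi (seg x0 (x + h) t) - t ^+ j * phi (seg x0 x t) -
        t ^+ j.+1 * 'D_h phi (seg x0 x t)|)}.
      by move=> t t01; exact: (continuous_comp (ci t t01) (@norm_continuous _ _ _)).
    have cC : {in `[0, 1]%classic, continuous (fun _ : R => C * `|h| ^+ 2 : R)}.
      by move=> t t01; exact: cvg_cst.
    apply: (le_Rintegral _ (avg_integrable ciN) (avg_integrable cC)) => //.
    move=> t /=; rewrite in_itv/= => t01.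
    rewrite exprSr -mulrA -!mulrBr normrM -[leRHS]mul1r ler_pM//; last exact: tay.
    have [t0 t1] := andP t01.
    by rewrite ger0_norm ?exprn_ge0// exprn_ile1.
  by rewrite Rintegral_cst// mu01 mulr1.
rewrite expr2 mulrA ler_wpM2r//.
move: he; have [->|Cn0] := eqVneq C 0; first by rewrite mul0r => _; exact: ltW.
have C1 : 0 < C by rewrite lt_neqAle eq_sym Cn0.
by rewrite ?(negbTE Cn0) [C * _]mulrC -(ler_pdivlMr _ _ C1).
Unshelve. all: by end_near. Qed.

(** Smoothness of all the averages, for all weights at once, follows by induction
  from [avg_derive]. *)
Lemma avg_smooth j phi : smooth_on O phi -> smooth_on O (avg j phi).
Proof.
move=> + k; elim: k j phi => [|k IH] j phi sphi /=.
  by move=> x Ox; apply: differentiable_continuous; exact: proj1 (avg_derive j sphi Ox).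
split=> [x Ox|v]; first exact: proj1 (avg_derive j sphi Ox).
have H : Ck k O (fun x => \sum_i (v 0 i * avg j.+1 ('D_(bvec i) phi) x) : R^o).
  apply: Ck_sum => // i; apply: Ck_scale => //; apply: IH.
  exact: smooth_derive.
by apply: Ck_ext H => // x Ox; rewrite (proj2 (avg_derive j sphi Ox)).
Qed.

Lemma seg0 x : seg x0 x 0 = x0.
Proof. by rewrite /seg scale0r addr0. Qed.

Lemma seg1 x : seg x0 x 1 = x.
Proof. by rewrite /seg scale1r addrCA subrr addr0. Qed.

(** The fundamental theorem of calculus along the segment from x0 to x. *)
Lemma avg0_increment phi x : smooth_on O phi -> O x ->
  avg 0 ('D_(x - x0) phi) x = phi x - phi x0.
Proof.
move=> sphi Ox.
have dphi (s : R) : 0 <= s <= 1 ->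
   is_derive s (1 : R) (fun t => phi (seg x0 x t)) ('D_(x - x0) phi (seg x0 x s)).
  by move=> s01; apply: is_derive_line; apply: smooth_diffO => //; exact: cO.
rewrite /avg /Rintegral; under eq_integral do rewrite expr0 mul1r.
have cf (s : R) : 0 <= s <= 1 -> {for s, continuous (fun t => phi (seg x0 x t) : R)}.
  move=> s01; apply: differentiable_continuous; apply/derivable1_diffP.
  by have [] := dphi s s01.
rewrite (@continuous_FTC2 _ _ (fun t => phi (seg x0 x t)))//=.
- by rewrite seg0 seg1.
- apply: continuous_in_subspaceT => t t01.
  exact: (continuous_line_within cO Ox0 Ox (smooth_contO (smooth_derive _ sphi))).
- split.
  + move=> t; rewrite in_itv/= => /andP[t0 t1].
    have t01 : 0 <= t <= 1 by rewrite (ltW t0) ltW.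
    by have [] := dphi t t01.
  + by apply: cvg_at_right_filter; apply: cf; rewrite lexx ler01.
  + by apply: cvg_at_left_filter; apply: cf; rewrite lexx ler01.
move=> t; rewrite in_itv/= => /andP[t0 t1].
have t01 : 0 <= t <= 1 by rewrite (ltW t0) ltW.
by have [_] := dphi t t01; rewrite derive1E.
Qed.

(** The increment of phi is the integral of its derivative along x - x0, which is
  expanded in the partial derivatives. *)
Lemma hadamard phi : smooth_on O phi ->
  exists G : 'I_m -> V -> R^o,
  [/\ forall i, smooth_on O (G i),
      forall i, G i x0 = 'D_(bvec i) phi x0 &
      forall x, O x -> phi x = phi x0 + \sum_i (x 0 i - x0 0 i) * G i x].
Proof.
move=> sphi; exists (fun i => avg 0 ('D_(bvec i) phi)); split=> [i|i|x Ox].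
- by apply: avg_smooth; exact: smooth_derive.
- rewrite /avg /seg subrr.
  under eq_Rintegral do rewrite scaler0 addr0 expr0 mul1r.
  by rewrite Rintegral_cst// mu01 mulr1.
have cD i : contO ('D_(bvec i) phi) by apply: smooth_contO; exact: smooth_derive.
rewrite -(avg_sum 0 (fun i => x 0 i - x0 0 i))//.
rewrite -(@avg_ext 0 ('D_(x - x0) phi))//.
  by rewrite avg0_increment// addrCA subrr addr0.
move=> z Oz; rewrite derive_rV; last exact: smooth_diffO.
by apply: eq_bigr => i _; rewrite !mxE.
Qed.

End Hadamard.

(** * Smooth cutoff functions on R^m *)

Section Bump.
Context (R : realType).

(** The functions x^-j exp(-1/x), extended by 0.  The family is stable under
  differentiation, so differentiability of all its members gives smoothness. *)
Definition flat_exp (j : nat) (x : R) : R^o :=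
  if 0 < x then x^-1 ^+ j * expR (- x^-1) else 0.

Lemma flat_exp_le0 j x : x <= 0 -> flat_exp j x = 0.
Proof. by rewrite /flat_exp leNgt; case: ltP. Qed.

Lemma flat_exp_ge0 j x : 0 <= flat_exp j x.
Proof.
rewrite /flat_exp; case: ltP => // x0.
by rewrite mulr_ge0 ?expR_ge0// exprn_ge0// invr_ge0 ltW.
Qed.

Lemma flat_exp_gt0 j x : 0 < x -> 0 < flat_exp j x.
Proof. by move=> x0; rewrite /flat_exp x0 mulr_gt0 ?expR_gt0// exprn_gt0// invr_gt0. Qed.

(** One term of the exponential series at 1/x suffices.  The square on the right
  makes the derivative at 0 vanish. *)
Lemma flat_exp_bound j : exists2 C : R, 0 < C & forall x, flat_exp j x <= C * x ^+ 2.
Proof.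
exists (j.+2`!%:R) => [|x]; first by rewrite ltr0n fact_gt0.
rewrite /flat_exp; case: ltP => [x0|_]; last by rewrite mulr_ge0 ?sqr_ge0.
rewrite expRN ler_pdivrMr ?expR_gt0//.
have y0 : 0 <= x^-1 by rewrite invr_ge0 ltW.
have : x^-1 ^+ j.+2 / j.+2`!%:R <= expR x^-1.
  by apply: le_trans (expR_ge1Dxn j.+1 y0); rewrite lerDr.
rewrite ler_pdivrMr ?ltr0n ?fact_gt0// => H.
have -> : x^-1 ^+ j = x ^+ 2 * x^-1 ^+ j.+2.
  by rewrite !(exprS x^-1) expr2; field; rewrite gt_eqF.
by rewrite [leLHS]mulrC [leRHS]mulrAC ler_pM2r ?exprn_gt0// [leRHS]mulrC.
Qed.

Lemma is_derive_flat_exp j (x : R) :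
  is_derive x (1 : R) (flat_exp j) (- j%:R * flat_exp j.+1 x + flat_exp j.+2 x).
Proof.
have [x0|x0|x0] := ltgtP x 0.
- apply: (@near_eq_is_derive _ _ _ (fun=> 0)).
    near=> y; rewrite flat_exp_le0//; apply: ltW; near: y; exact: lt_nbhsl.
  rewrite !flat_exp_le0 ?ltW// mulr0 addr0; exact: is_derive_cst.
- apply: (@near_eq_is_derive _ _ _ (fun x : R => x^-1 ^+ j * expR (- x^-1))).
    near=> y; rewrite /flat_exp ifT//; near: y.
    by apply: open_nbhs_nbhs; split => //; exact: open_gt.
  have xn0 : x != 0 by rewrite gt_eqF.
  have dV : is_derive x (1 : R) (fun x : R => x^-1) (- x ^- 2).
    apply: is_derive_eq (is_deriveV (f := id) xn0 (is_derive_id _ _)) _.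
    by rewrite scaler1.
  have dE : is_derive x (1 : R) (fun x : R => expR (- x^-1)) (x ^- 2 * expR (- x^-1)).
    apply: is_derive_eq (is_derive1_comp (is_derive_expR _) (is_deriveN dV)) _.
    by rewrite opprK mulrC.
  have -> : (fun x : R => x^-1 ^+ j * expR (- x^-1)) =
            ((fun x : R => x^-1) ^+ j * (fun x : R => expR (- x^-1))).
    by apply/funext => y; rewrite /= fctE exprfctE.
  apply: is_derive_eq (is_deriveM (is_deriveX j dV) dE) _.
  rewrite exprfctE.
  rewrite /flat_exp x0 /GRing.scale/=.
  case: j => [|j]; rewrite /= !(exprS x^-1).
  by field.
by field.
(* At 0 the difference quotient is at most C |h|. *)
- subst x; rewrite !flat_exp_le0// mulr0 addr0.
  have [C C0 HC] := flat_exp_bound j.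
  have H : (h^-1 *: ((flat_exp j \o shift 0) (h *: (1 : R)) - flat_exp j 0)) @[h --> 0^'] --> (0 : R).
    apply/cvgr0Pnorm_le => e e0; near=> h.
    rewrite /= addr0 [h *: 1]mulr1 (flat_exp_le0 j (lexx 0)) subr0 normrM normfV.
    have hn0 : 0 < `|h| by rewrite normr_gt0; near: h; exact: nbhs_dnbhs_neq.
    rewrite mulrC ler_pdivrMr// ger0_norm ?flat_exp_ge0//.
    apply: le_trans (HC h) _; rewrite -real_normK ?num_real// expr2 mulrA.
    rewrite ler_wpM2r ?(ltW hn0)// mulrC -ler_pdivlMr//.
    by near: h; apply: dnbhs0_le; rewrite divr_gt0.
  apply: DeriveDef; first by apply/cvg_ex; exists 0.
  exact: cvg_lim H.
Unshelve. all: by end_near. Qed.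

Lemma Ck_flat_exp k j (V : normedModType R) (O : set V) (g : V -> R^o) : open O ->
  Ck k O g -> Ck k O (fun x => flat_exp j (g x)).
Proof.
move=> oO; elim: k j => [|k IH] j.
  move=> H x Ox; apply: (@continuous_comp _ _ _ g (flat_exp j)); first exact: H.
  apply: differentiable_continuous; apply/derivable1_diffP.
  by have [] := is_derive_flat_exp j (g x).
have dflat x : differentiable (flat_exp j) x.
  by apply/derivable1_diffP; have [] := is_derive_flat_exp j x.
move=> G; have [g1 g2] := G; split=> [x Ox|v].
  by apply: differentiable_comp; [exact: g1|exact: dflat].
have gk := CkW G.
have := Ck_mul oO (g2 v)
  (Ck_add oO (Ck_scale (- j%:R) oO (IH j.+1 gk)) (IH j.+2 gk)).
apply: Ck_ext => // x Ox.
have dg : differentiable g x by exact: g1.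
have -> : 'D_v (fun x => flat_exp j (g x)) x = 'd (flat_exp j) (g x) ('D_v g x).
  rewrite -[LHS]/('D_v (flat_exp j \o g) x) deriveE; last exact: differentiable_comp.
  by rewrite (diff_comp dg (dflat _)) deriveE.
rewrite (@diff1E R R^o (flat_exp j) (g x) (dflat _)) derive1E.
by have [_ ->] := is_derive_flat_exp j (g x).
Qed.

(** The classical smooth step, equal to 0 on x <= 0 and to 1 on x >= 1. *)
Definition step (x : R) : R^o := flat_exp 0 x / (flat_exp 0 x + flat_exp 0 (1 - x)).

Lemma step_den x : flat_exp 0 x + flat_exp 0 (1 - x) != 0.
Proof.
rewrite gt_eqF//; have [x0|x0] := ltP 0 x.
  by rewrite ltr_pwDl ?flat_exp_gt0// flat_exp_ge0.
by rewrite ltr_pwDr ?flat_exp_gt0// ?flat_exp_ge0//; lra.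
Qed.

Lemma step0 x : x <= 0 -> step x = 0.
Proof. by move=> x0; rewrite /step flat_exp_le0// mul0r. Qed.

Lemma step1 x : 1 <= x -> step x = 1.
Proof.
move=> x1; have := step_den x; rewrite /step [flat_exp 0 (1 - x)]flat_exp_le0 ?subr_le0//.
by rewrite addr0 => ?; rewrite divff.
Qed.

Lemma Ck_step k (V : normedModType R) (O : set V) (g : V -> R^o) : open O ->
  Ck k O g -> Ck k O (fun x => step (g x)).
Proof.
move=> oO G; apply: Ck_mul => //; first exact: Ck_flat_exp.
apply: Ck_inv => // [x _|]; first exact: step_den.
apply: Ck_add => //; first exact: Ck_flat_exp.
by apply: Ck_flat_exp => //; apply: Ck_sub => //; exact: Ck_cst.
Qed.

Lemma cutoff_rV m (a : 'rV[R]_m) (r : R) : 0 < r ->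
  exists rho : 'rV[R]_m -> R^o, [/\ smooth_on setT rho,
    forall x, `|x - a| <= r -> rho x = 1 &
    forall x, 2 * r <= `|x - a| -> rho x = 0].
Proof.
move=> r0; have r2 : 0 < 3 * r ^+ 2 by rewrite mulr_gt0// exprn_gt0.
(* The norm is the sup norm, so a product over the coordinates will do:
g i x >= 1 iff |x_i - a_i| <= r, and g i x <= 0 iff |x_i - a_i| >= 2 r. *)
pose g i (x : 'rV[R]_m) : R^o := (4 * r ^+ 2 - (x 0 i - a 0 i) ^+ 2) / (3 * r ^+ 2).
exists (fun x => \prod_i step (g i x)); split=> [k|x xr|x xr].
- apply: Ck_prod => [|i]; first exact: openT.
  apply: Ck_step; first exact: openT.
  have oT : open [set: 'rV[R]_m] by exact: openT.
  apply: Ck_mul => //; last exact: Ck_cst.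
  apply: Ck_sub => //; first exact: Ck_cst.
  have H : Ck k setT (fun x : 'rV[R]_m => x 0 i - a 0 i : R^o).
    by apply: Ck_sub => //; [exact: Ck_coord|exact: Ck_cst].
  exact: (Ck_mul oT (f := fun x => _) H H).
- apply: big1 => i _; rewrite step1// /g ler_pdivlMr// mul1r.
  have := normr_coord_le (x - a) i; rewrite !mxE => xi.
  have : `|x 0 i - a 0 i| ^+ 2 <= r ^+ 2.
    by rewrite lerXn2r ?nnegrE// ?(ltW r0)//; exact: le_trans xi xr.
  by rewrite real_normK ?num_real//; lra.
- have xa0 : `|x - a| != 0.
    by rewrite gt_eqF// (lt_le_trans _ xr)// mulr_gt0.
  have [[i0 i] xi] := mx_norm_neq0 xa0.
  have {}xi : `|x - a| = `|x 0 i - a 0 i|.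
    by rewrite [LHS]xi/= (ord1 i0) !mxE.
  rewrite (bigD1 i)//= step0 ?mul0r// /g pmulr_lle0 ?invr_gt0//.
  have : (2 * r) ^+ 2 <= `|x 0 i - a 0 i| ^+ 2.
    rewrite lerXn2r ?nnegrE// ?mulr_ge0// ?(ltW r0)//.
    by rewrite -xi.
  by rewrite real_normK ?num_real// exprMn; lra.
Qed.

End Bump.

(** * Local smoothness and derivations on a set with an atlas *)

Section LocalSmoothness.
Context (R : realType) (N : smoothType R).
Implicit Types (p q : N) (P : set N) (f g : N -> R).

(** Neighbourhoods are expressed in charts because a total space carries no other
  topology than that of its charts. *)
Definition near_pt p P := forall c, atlas c -> dom c p ->
  exists O : set 'rV[R]_(mdim N), [/\ open O, O (cmap c p) &
    forall q, dom c q -> O (cmap c q) -> P q].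

Definition smooth_via (c : chart R N (mdim N)) f p :=
  exists (O : set 'rV[R]_(mdim N)) (g : 'rV[R]_(mdim N) -> R^o),
   [/\ open O, O (cmap c p), smooth_on O g &
    forall q, dom c q -> O (cmap c q) -> f q = g (cmap c q)].

Definition smooth_at f p := forall c, atlas c -> dom c p -> smooth_via c f p.

(** What makes smoothness a local property: see [smoothP]. *)
Definition good_atlas : Prop :=
  (forall p, exists2 c : chart R N (mdim N), atlas c & dom c p) /\
  (forall c : chart R N (mdim N), atlas c ->
     {in dom c &, injective (cmap c)} /\ open (cmap c @` dom c)).

Lemma near_pt_sub p P Q : P `<=` Q -> near_pt p P -> near_pt p Q.
Proof.
move=> PQ H c ac dp; have [W [oW Wp HW]] := H c ac dp.
by exists W; split=> // q dq Wq; apply: PQ; exact: HW.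
Qed.

Lemma smooth_at_near f g p : near_pt p (fun q => f q = g q) ->
  smooth_at g p -> smooth_at f p.
Proof.
move=> H K c ac dp; have [W [oW Wp HW]] := H c ac dp.
have [Z [h [oZ Zp sh HZ]]] := K c ac dp.
exists (W `&` Z), h; split=> //; first exact: openI.
  by move=> k; apply: Ck_subset (sh k) => x [].
by move=> q dq [Wq Zq]; rewrite HW// HZ.
Qed.

Section InChart.
Context (c : chart R N (mdim N)).

Lemma smooth_via_ext f g p : (forall q, dom c q -> f q = g q) ->
  smooth_via c g p -> smooth_via c f p.
Proof.
move=> fg [W [h [oW Wp sh HW]]]; exists W, h; split=> // q dq Wq.
by rewrite fg// HW.
Qed.

Lemma smooth_via_coord i p : smooth_via c (fun q => cmap c q 0 i) p.
Proof.
exists setT, (fun x => x 0 i); split=> //; first exact: openT.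
by move=> k; exact: Ck_coord.
Qed.

Lemma smooth_via_cst (a : R) p : smooth_via c (fun=> a) p.
Proof.
exists setT, (fun=> a); split=> //; first exact: openT.
by move=> k; exact: Ck_cst.
Qed.

Lemma smooth_via_add f g p : smooth_via c f p -> smooth_via c g p ->
  smooth_via c (fun q => f q + g q) p.
Proof.
move=> [W [h [oW Wp sh HW]]] [Z [k [oZ Zp sk HZ]]].
exists (W `&` Z), (fun x => h x + k x); have oWZ := openI oW oZ; split=> //.
  move=> n; apply: Ck_add => //.
    by apply: Ck_subset (sh n) => x [].
  by apply: Ck_subset (sk n) => x [].
by move=> q dq [Wq Zq]; rewrite HW// HZ.
Qed.

Lemma smooth_via_mul f g p : smooth_via c f p -> smooth_via c g p ->
  smooth_via c (fun q => f q * g q) p.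
Proof.
move=> [W [h [oW Wp sh HW]]] [Z [k [oZ Zp sk HZ]]].
exists (W `&` Z), (fun x => h x * k x); have oWZ := openI oW oZ; split=> //.
  move=> n; apply: Ck_mul => //.
    by apply: Ck_subset (sh n) => x [].
  by apply: Ck_subset (sk n) => x [].
by move=> q dq [Wq Zq]; rewrite HW// HZ.
Qed.

Lemma smooth_via_sum n (F : 'I_n -> N -> R) p : (forall i, smooth_via c (F i) p) ->
  smooth_via c (fun q => \sum_i F i q) p.
Proof.
elim: n F => [|n IH] F H.
  by under eq_fun do rewrite big_ord0; exact: smooth_via_cst.
under eq_fun do rewrite big_ord_recl.
by apply: smooth_via_add => //; exact: IH.
Qed.

End InChart.

Lemma smooth_at_cst (a : R) p : smooth_at (fun=> a) p.
Proof. by move=> c _ _; exact: smooth_via_cst. Qed.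

Lemma smooth_at_add f g p : smooth_at f p -> smooth_at g p ->
  smooth_at (fun q => f q + g q) p.
Proof. by move=> H K c ac dp; apply: smooth_via_add; [exact: H|exact: K]. Qed.

Lemma smooth_at_mul f g p : smooth_at f p -> smooth_at g p ->
  smooth_at (fun q => f q * g q) p.
Proof. by move=> H K c ac dp; apply: smooth_via_mul; [exact: H|exact: K]. Qed.

Lemma smooth_at_sum n (F : 'I_n -> N -> R) p : (forall i, smooth_at (F i) p) ->
  smooth_at (fun q => \sum_i F i q) p.
Proof. by move=> H c ac dp; apply: smooth_via_sum => i; exact: H. Qed.

Lemma smooth_at_opp f p : smooth_at f p -> smooth_at (fun q => - f q) p.
Proof.
move=> H; rewrite (_ : (fun q => _) = (fun q => -1 * f q)).
  by apply: smooth_at_mul => //; exact: smooth_at_cst.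
by apply/funext => q; rewrite mulN1r.
Qed.

Lemma smooth_at_sub f g p : smooth_at f p -> smooth_at g p ->
  smooth_at (fun q => f q - g q) p.
Proof. by move=> H K; apply: smooth_at_add => //; exact: smooth_at_opp. Qed.

Definition tuple_fun m (z : 'I_m -> N -> R) (q : N) : 'rV[R]_m := \row_i z i q.

(** The common domain of local expressions of the z i is a finite intersection of
  open sets, hence open, and so is the part of it that g maps into O. *)
Lemma smooth_at_comp m (z : 'I_m -> N -> R) (O : set 'rV[R]_m)
    (G : 'rV[R]_m -> R^o) p :
  (forall i, smooth_at (z i) p) -> open O -> smooth_on O G ->
  O (tuple_fun z p) -> smooth_at (fun q => G (tuple_fun z q)) p.
Proof.
move=> Hz oO sG Op c ac dp.
have /choice[W HW] : forall i, exists Wg : set 'rV[R]_(mdim N) * ('rV[R]_(mdim N) -> R^o),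
   [/\ open Wg.1, Wg.1 (cmap c p), smooth_on Wg.1 Wg.2 &
    forall q, dom c q -> Wg.1 (cmap c q) -> z i q = Wg.2 (cmap c q)].
  by move=> i; have [W [g Wg]] := Hz i c ac dp; exists (W, g).
pose g x : 'rV[R]_m := \row_i (W i).2 x.
have gE q : dom c q -> (forall i, (W i).1 (cmap c q)) ->
    g (cmap c q) = tuple_fun z q.
  move=> dq Wq; apply/rowP => i; rewrite !mxE.
  by have [_ _ _ ->] := HW i.
have gi i : (fun x => g x 0 i : R^o) = (W i).2 by apply/funext => x; rewrite mxE.
pose Z := [set x | (forall i, (W i).1 x) /\ O (g x)].
have oZ : open Z.
  rewrite openE => x [Wx Ogx].
  have cg : {for x, continuous g}.
    apply: continuous_rV => i; rewrite gi; have [_ _ sWi _] := HW i.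
    exact: (sWi 0%N) _ (Wx i).
  have n1 : \near x, forall i, (W i).1 x.
    apply: (@filter_forall _ _ (fun i => (W i).1) (nbhs x) _) => i.
    have [oWi _ _ _] := HW i.
    by apply: open_nbhs_nbhs; split => //; exact: Wx.
  have n2 : \near x, O (g x) by apply: cg; exact: open_nbhs_nbhs.
  by rewrite /interior; near=> y; split; near: y.
exists Z, (fun x => G (g x)); split=> //.
- split; first by move=> i; have [] := HW i.
  by rewrite gE// => i; have [] := HW i.
- move=> k; apply: (Ck_comp (O' := O)) => // [x []//|i].
  by rewrite gi; have [_ _ sWi _] := HW i; apply: Ck_subset (sWi k) => x [].
- by move=> q dq [Wq _]; rewrite gE.
Unshelve. all: by end_near. Qed.

Hypothesis gN : good_atlas.

Lemma near_pt_pt p P : near_pt p P -> P p.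
Proof.
move=> H; have [c ac dp] := proj1 gN p.
by have [W [_ Wp]] := H c ac dp; exact.
Qed.

(** A function that is smooth near every point has in each chart a single smooth
  expression on the whole image: the composite with the inverse of the chart. *)
Lemma smoothP f : smooth f <-> forall p, smooth_at f p.
Proof.
split=> [H p c ac dp|H c ac].
  have [_ oc] := proj2 gN c ac; have [g [sg gE]] := H c ac.
  exists (cmap c @` dom c), g; split=> // q dq _; exact: gE.
have [ic oc] := proj2 gN c ac.
pose h (x : 'rV[R]_(mdim N)) : R^o :=
  if pselect (exists2 q, dom c q & cmap c q = x) is left e
  then f (projT1 (cid2 e)) else 0.
have hE q : dom c q -> h (cmap c q) = f q.
  move=> dq; rewrite /h; case: pselect => [e|[]]; last by exists q.
  by case: cid2 => q' /= dq' qq'; rewrite (ic q' q)// inE.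
exists h; split=> [k|p dp]; last by rewrite hE.
apply: Ck_local => _ [p dp <-].
have [W [g [oW Wp sg gE]]] := H p c ac dp.
exists (W `&` cmap c @` dom c); first by split=> //; exists p.
apply: (@Ck_ext _ _ _ k _ g); first exact: openI.
  by move=> x [Wx [q dq qx]]; move: Wx; rewrite -qx => Wq; rewrite hE// gE.
by apply: Ck_subset (sg k) => x [].
Qed.

Lemma smooth_chart f (c : chart R N (mdim N)) : smooth f -> atlas c ->
  exists g : 'rV[R]_(mdim N) -> R^o,
    smooth_on (cmap c @` dom c) g /\ forall q, dom c q -> f q = g (cmap c q).
Proof. by move=> sf ac; exact: sf. Qed.

Lemma smooth_smooth_at f p : smooth f -> smooth_at f p.
Proof. by move=> /smoothP. Qed.

Lemma smooth_cst (a : R) : smooth (fun _ : N => a).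
Proof. by apply/smoothP => p; exact: smooth_at_cst. Qed.

Lemma smooth_add f g : smooth f -> smooth g -> smooth (fun q => f q + g q).
Proof. by move=> /smoothP F /smoothP G; apply/smoothP => p; exact: smooth_at_add. Qed.

Lemma smooth_mul f g : smooth f -> smooth g -> smooth (fun q => f q * g q).
Proof. by move=> /smoothP F /smoothP G; apply/smoothP => p; exact: smooth_at_mul. Qed.

Lemma smooth_opp f : smooth f -> smooth (fun q => - f q).
Proof. by move=> /smoothP F; apply/smoothP => p; exact: smooth_at_opp. Qed.

Lemma smooth_sub f g : smooth f -> smooth g -> smooth (fun q => f q - g q).
Proof. by move=> /smoothP F /smoothP G; apply/smoothP => p; exact: smooth_at_sub. Qed.

Lemma smooth_sum n (F : 'I_n -> N -> R) : (forall i, smooth (F i)) ->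
  smooth (fun q => \sum_i F i q).
Proof.
move=> H; apply/smoothP => p; apply: smooth_at_sum => i.
exact: smooth_smooth_at.
Qed.

Section Derivations.
Context (p : N).
Implicit Types (v w : tvec p).

Lemma tvec_derivation v : is_derivation_at p v.
Proof. by case: v => v /= /asboolP. Qed.

Lemma tvec_eq v w : (forall f, smooth f -> v f = w f) -> v = w.
Proof.
move=> H; apply: val_inj; apply/funext => f.
have [sf|nsf] := pselect (smooth f); first exact: H.
have [v0 _ _] := tvec_derivation v; have [w0 _ _] := tvec_derivation w.
by rewrite [LHS](v0 f nsf) [RHS](w0 f nsf).
Qed.

Lemma tvecD v w f : (v + w) f = v f + w f.
Proof. by []. Qed.

Lemma tvecB v w f : (v - w) f = v f - w f.
Proof. by []. Qed.

Lemma tvecN v f : (- v) f = - v f.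
Proof. by []. Qed.

Lemma tvecZ (a : R) v f : (a *: v) f = a * v f.
Proof. by []. Qed.

Lemma tvec0 f : (0 : tvec p) f = 0.
Proof. by []. Qed.

Lemma tvec_sum n (F : 'I_n -> tvec p) f : (\sum_i F i) f = \sum_i F i f.
Proof. by elim/big_ind2 : _ => // x1 x2 y1 y2 <- <-. Qed.

Lemma tv_lin v (a : R) f g : smooth f -> smooth g ->
  v (fun q => a * f q + g q) = a * v f + v g.
Proof. by have [_ + _] := tvec_derivation v; exact. Qed.

Lemma tv_mul v f g : smooth f -> smooth g ->
  v (fun q => f q * g q) = v f * g p + f p * v g.
Proof. by have [_ _] := tvec_derivation v; exact. Qed.

Lemma tv_add v f g : smooth f -> smooth g ->
  v (fun q => f q + g q) = v f + v g.
Proof.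
move=> sf sg; rewrite -[v f]mul1r -tv_lin//; congr (v _).
by apply/funext => q; rewrite mul1r.
Qed.

Lemma tv_zero v : v (fun=> 0) = 0.
Proof.
have s0 := smooth_cst 0.
have := tv_add v s0 s0; rewrite (_ : (fun _ => _ + _) = fun=> 0).
  by move=> /eqP; rewrite -subr_eq0 opprD addrA subrr sub0r oppr_eq0 => /eqP.
by apply/funext => q; rewrite addr0.
Qed.

Lemma tv_scale v (a : R) f : smooth f -> v (fun q => a * f q) = a * v f.
Proof.
move=> sf; rewrite -[RHS]addr0 -(tv_zero v) -tv_lin//; last exact: smooth_cst.
by congr (v _); apply/funext => q; rewrite addr0.
Qed.

Lemma tv_opp v f : smooth f -> v (fun q => - f q) = - v f.
Proof.
move=> sf; rewrite -mulN1r -tv_scale//; congr (v _).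
by apply/funext => q; rewrite mulN1r.
Qed.

Lemma tv_sub v f g : smooth f -> smooth g ->
  v (fun q => f q - g q) = v f - v g.
Proof. by move=> sf sg; rewrite tv_add ?tv_opp//; exact: smooth_opp. Qed.

Lemma tv_cst v (a : R) : v (fun=> a) = 0.
Proof.
have s1 := smooth_cst 1.
have v1 : v (fun=> 1) = 0.
  have := tv_mul v s1 s1; rewrite (_ : (fun _ => _ * _) = fun=> 1).
    rewrite mulr1 mul1r => /eqP.
    by rewrite -subr_eq0 opprD addrA subrr sub0r oppr_eq0 => /eqP.
  by apply/funext => q; rewrite mulr1.
rewrite -[RHS](mulr0 a) -v1 -tv_scale//; congr (v _).
by apply/funext => q; rewrite mulr1.
Qed.

Lemma tv_sum v n (F : 'I_n -> N -> R) : (forall i, smooth (F i)) ->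
  v (fun q => \sum_i F i q) = \sum_i v (F i).
Proof.
elim: n F => [|n IH] F H.
  by under eq_fun do rewrite big_ord0; rewrite big_ord0 tv_zero.
under eq_fun do rewrite big_ord_recl.
by rewrite tv_add ?IH ?big_ord_recl//; exact: smooth_sum.
Qed.

(** A functional that satisfies the rules of a derivation on smooth functions
  becomes a tangent vector once it is replaced by 0 on the other functions. *)
Lemma tvec_ofE (Phi : (N -> R) -> R) :
  (forall (a : R) f g, smooth f -> smooth g ->
     Phi (fun q => a * f q + g q) = a * Phi f + Phi g) ->
  (forall f g, smooth f -> smooth g ->
     Phi (fun q => f q * g q) = Phi f * g p + f p * Phi g) ->
  forall f, smooth f -> tvec_of p Phi f = Phi f.
Proof.
move=> HL HM.
pose Psi f : R^o := if `[< smooth f >] then Phi f else 0.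
have PsiE f : smooth f -> Psi f = Phi f by move=> sf; rewrite /Psi asboolT.
have dPsi : Psi \in @tvec_pred R N p.
  apply/asboolP; split.
  - by move=> f nf; rewrite /Psi asboolF.
  - move=> a f g sf sg; rewrite !PsiE//; first exact: HL.
    by apply: smooth_add => //; apply: smooth_mul => //; exact: smooth_cst.
  - by move=> f g sf sg; rewrite !PsiE//; [exact: HM|exact: smooth_mul].
have ex : exists v : tvec p, forall f, smooth f -> v f = Phi f.
  by exists (TVec dPsi) => f sf; rewrite [LHS]PsiE.
exact: (@xgetPex _ 0 [set v : tvec p | forall f, smooth f -> v f = Phi f] ex).
Qed.

End Derivations.

(** Vanishing near every point outside U, rather than at it, lets products with
  functions that are smooth only on U be smooth everywhere. *)
Definition is_cutoff (p : N) (U : set N) (chi : N -> R) :=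
  [/\ smooth chi, chi p = 1 &
      forall q, ~ U q -> near_pt q (fun q' => chi q' = 0)].

Lemma cutoff_out p U chi q : is_cutoff p U chi -> ~ U q -> chi q = 0.
Proof. by move=> [_ _ H] /H /near_pt_pt. Qed.

Lemma cutoff_smooth p U chi f : is_cutoff p U chi ->
  (forall q, U q -> smooth_at f q) -> smooth (fun q => chi q * f q).
Proof.
move=> [schi _ H] sf; apply/smoothP => q.
have [Uq|nUq] := pselect (U q).
  by apply: smooth_at_mul; [exact: smooth_smooth_at|exact: sf].
apply: (@smooth_at_near _ (fun=> 0)); last exact: smooth_at_cst.
by apply: near_pt_sub (H q nUq) => q' ->; rewrite mul0r.
Qed.

(** Derivations act on global functions only, so the coordinates z i on U are
  required to be restrictions of global smooth functions.  Convexity of O is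
  what Hadamard's lemma needs. *)
Definition coords_on m (z : 'I_m -> N -> R) (U : set N) (O : set 'rV[R]_m) :=
  [/\ forall i, smooth (z i),
      forall q, U q -> exists chi, is_cutoff q U chi,
      open O /\ is_convex O,
      forall q, U q -> O (tuple_fun z q) &
      forall f, smooth f -> exists g : 'rV[R]_m -> R^o,
        smooth_on O g /\ forall q, U q -> f q = g (tuple_fun z q)].

(** Multiply Hadamard's expansion of g at p by a cutoff function chi: all the
  functions become global, and in
    chi f = chi f(p) + sum_i (z_i - z_i(p)) (chi G_i)
  the Leibniz rule leaves v f on the left and sum_i v(z_i) G_i(p) on the right. *)
Lemma coords_derivation m (z : 'I_m -> N -> R) U O p (v : tvec p) f
    (g : 'rV[R]_m -> R^o) :
  coords_on z U O -> U p -> smooth f -> smooth_on O g ->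
  (forall q, U q -> f q = g (tuple_fun z q)) ->
  v f = \sum_i v (z i) * 'D_(bvec i) g (tuple_fun z p).
Proof.
move=> [sz cut [oO cO] zO _] Up sf sg fg.
have [chi cchi] := cut p Up; have [schi chi1 chi0] := cchi.
have [G [sG Gp gE]] := hadamard oO cO (zO p Up) sg.
pose H i q : R := chi q * G i (tuple_fun z q).
have sH i : smooth (H i).
  apply: (cutoff_smooth cchi) => q Uq.
  apply: (smooth_at_comp _ oO (sG i)); last exact: zO.
  by move=> j; exact: smooth_smooth_at.
have sd i : smooth (fun q => z i q - z i p).
  by apply: smooth_sub => //; exact: smooth_cst.
have E : (fun q => chi q * f q) =
   (fun q => chi q * f p + \sum_i (z i q - z i p) * H i q).
  apply/funext => q; have [Uq|nUq] := pselect (U q); last first.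
    rewrite (cutoff_out cchi nUq) !mul0r big1 ?addr0// => i _.
    by rewrite /H (cutoff_out cchi nUq) mul0r mulr0.
  rewrite fg// gE; last exact: zO.
  rewrite -fg// mulrDr; congr (_ + _); rewrite mulr_sumr.
  by apply: eq_bigr => i _; rewrite /H !mxE mulrCA.
have := congr1 v E; rewrite tv_mul// tv_add; first last.
- by apply: smooth_sum => i; exact: smooth_mul.
- by apply: smooth_mul => //; exact: smooth_cst.
rewrite tv_mul//; last exact: smooth_cst.
rewrite tv_cst mulr0 addr0 chi1 mul1r => /addrI ->.
rewrite tv_sum; last by move=> i; exact: smooth_mul.
apply: eq_bigr => i _; rewrite tv_mul// subrr mul0r addr0.
rewrite tv_sub//; last exact: smooth_cst.
by rewrite tv_cst subr0 /H chi1 mul1r Gp.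
Qed.

Lemma coords_eq m (z : 'I_m -> N -> R) U O p (v w : tvec p) :
  coords_on z U O -> U p -> (forall i, v (z i) = w (z i)) -> v = w.
Proof.
move=> Hz Up vw; apply: tvec_eq => f sf.
have [_ _ _ _ /(_ f sf)[g [sg fg]]] := Hz.
rewrite (coords_derivation v Hz Up sf sg fg) (coords_derivation w Hz Up sf sg fg).
by apply: eq_bigr => i _; rewrite vw.
Qed.

End LocalSmoothness.

Lemma Ck_row (R : realType) (V : normedModType R) k m (O : set V)
    (g : V -> 'rV[R]_m) i : open O -> Ck k O g ->
  Ck k O (fun x => g x 0 i : R^o).
Proof.
move=> oO; elim: k g => [|k IH] g.
  move=> H x Ox; apply: (@continuous_comp _ _ _ g (fun y : 'rV[R]_m => y 0 i : R^o)).
    exact: H.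
  exact: coord_continuous.
move=> [g1 g2]; split=> [x Ox|v].
  apply: (@differentiable_comp _ _ _ _ g (fun y : 'rV[R]_m => y 0 i : R^o)).
    exact: g1.
  exact: differentiable_coord.
apply: (Ck_ext oO _ (IH _ (g2 v))) => x Ox.
by rewrite derive_mx ?mxE//; apply: diff_derivable; exact: g1.
Qed.

Lemma ball_convex (R : realType) (m : nat) (a : 'rV[R]_m) (r : R) :
  is_convex [set x | `|x - a| < r].
Proof.
move=> x y t /= xr yr /andP[t0 t1].
have -> : seg x y t - a = (1 - t) *: (x - a) + t *: (y - a).
  by apply/rowP => i; rewrite /seg !mxE; ring.
apply: le_lt_trans (ler_normD _ _) _; rewrite !normrZ.
rewrite (ger0_norm t0) ger0_norm ?subr_ge0//.
have [->|tn0] := eqVneq t 0; first by rewrite subr0 mul1r mul0r addr0.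
have t0' : 0 < t by rewrite lt_neqAle eq_sym tn0.
have -> : r = (1 - t) * r + t * r by ring.
by apply: ler_ltD; [rewrite ler_wpM2l ?subr_ge0// ltW|rewrite ltr_pM2l].
Qed.

(** * Local frames on a manifold *)

Section LocalFrames.
Context (R : realType) (M : smoothType R).
Local Notation n := (mdim M).

(** Global functions z i that restrict to coordinates on U, and global vector
  fields X j that restrict there to the coordinate frame. *)
Definition frame_at (p0 : M) :=
  exists (c : chart R M n) (U : set M) (z : 'I_n -> M -> R)
     (X : 'I_n -> section (TB M)),
  [/\ [/\ atlas c, U `<=` dom c & U p0],
      forall q, U q -> near_pt q U,
      forall q, U q -> tuple_fun z q = cmap c q,
      coords_on z U (cmap c @` U) &
      (forall j, smooth_sec (X j)) /\
      forall q, U q -> forall i j, X j q (z i) = (i == j)%:R].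

Definition framed := good_atlas M /\ forall p, frame_at p.

End LocalFrames.

Section Manifold.
Context (R : realType) (n : nat) (T : topologicalType) (A : set (chart R T n)).
Hypothesis HM : is_manifold A.
Let M := SmoothType A.

Lemma manifold_good_atlas : good_atlas M.
Proof.
have [_ _ cov cA _] := HM; split => [//|c /cA[oc ic _ imc]].
by split=> //; exact: imc.
Qed.
Let gM := manifold_good_atlas.

Lemma manifold_near_pt (W : set T) (p : M) : open W -> W p -> near_pt p (W : set M).
Proof.
move=> oW Wp c Ac dp; have [_ _ _ cA _] := HM; have [oc ic _ imc] := cA c Ac.
exists (cmap c @` (W `&` dom c)); split.
- exact: imc (openI oW oc) (@subIsetr _ _ _).
- by exists p.
- move=> q dq [q' [Wq' dq'] qq'].
  by rewrite -(ic q' q)// inE.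
Qed.

Lemma manifold_smooth_at_chart c (p : M) i : A c -> dom c p ->
  smooth_at (fun q : M => cmap c q 0 i) p.
Proof.
move=> Ac dp c' Ac' dp'; have [_ _ _ cA tA] := HM.
have [oc _ _ _] := cA c Ac; have [oc' ic' _ imc'] := cA c' Ac'.
have [g [sg gE]] := tA c' c Ac' Ac.
have oim : open (cmap c' @` (dom c' `&` dom c)).
  exact: imc' (openI oc' oc) (@subIsetl _ _ _).
exists (cmap c' @` (dom c' `&` dom c)), (fun x => g x 0 i); split=> //.
- by exists p.
- by move=> k; exact: Ck_row.
- move=> q dq [q' [dq' dcq'] qq'].
  have {}qq' : q' = q by apply: ic' => //; rewrite inE.
  by rewrite qq' in dcq'; rewrite gE.
Qed.

(** The bump on R^n is transported by a chart and extended by 0.  Its support is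
  the image K of a closed ball under the inverse of the chart, hence compact; as
  the space is separated, K is closed, so the extension is 0 near every point
  outside K. *)
Lemma manifold_cutoff (W : set T) (p0 : M) : open W -> W p0 ->
  exists (c : chart R T n) (U : set T) (chi : M -> R),
  [/\ [/\ A c, U `<=` W `&` dom c, open U & U p0],
      open (cmap c @` U) /\ is_convex (cmap c @` U),
      smooth chi,
      forall q, U q -> chi q = 1 &
      forall q : M, ~ (W `&` dom c) q -> near_pt q (fun q' => chi q' = 0)].
Proof.
move=> oW Wp0; have [hT _ cov cA tA] := HM.
have [c Ac dp0] := cov p0; have [oc ic cc imc] := cA c Ac.
set W' := W `&` dom c; have oW' : open W' by exact: openI.
have oim : open (cmap c @` W') := imc _ oW' (@subIsetr _ _ _).
have : nbhs (cmap c p0) (cmap c @` W').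
  by apply: open_nbhs_nbhs; split=> //; exists p0.
move=> /nbhs_ballP[e /= e0 He].
have {}He x : `|x - cmap c p0| < e -> exists2 q, W' q & cmap c q = x.
  by move=> xe; apply: He; rewrite -ball_normE /ball_/= distrC.
pose r := e / 3; have r0 : 0 < r by rewrite divr_gt0.
have re : r < e by rewrite /r; lra.
have r2e : 2 * r < e by rewrite /r; lra.
have [rho [srho rho1 rho0]] := cutoff_rV (cmap c p0) r0.
pose chi (q : M) : R := if `[< dom c q >] then rho (cmap c q) else 0.
pose U : set T := [set q | dom c q /\ `|cmap c q - cmap c p0| < r].
have UW : U `<=` W'.
  move=> q [dq qr]; have [q' W'q' qq'] := He _ (lt_trans qr re).
  have : q' = q by apply: ic; rewrite ?inE//; exact: W'q'.2.
  by move=> <-.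
have oU : open U.
  rewrite openE => q [dq qr]; rewrite /interior.
  have n1 : \near q, dom c q by exact: open_nbhs_nbhs.
  have n2 : \forall x \near cmap c q, `|x - cmap c p0| < r.
    have : nbhs (cmap c q) (ball (cmap c p0) r).
      apply: open_nbhs_nbhs; split; first exact: ball_open.
      by rewrite -ball_normE /ball_/= distrC.
    by apply: filterS => x; rewrite -ball_normE /ball_/= distrC.
  have n3 : \forall q' \near q, `|cmap c q' - cmap c p0| < r.
    exact: (cc q (mem_set dq)) _ n2.
  by near=> q'; split; near: q'.
have imU : cmap c @` U = [set x | `|x - cmap c p0| < r].
  apply/seteqP; split=> [_ [q [_ qr] <-]//|x xr].
  have [q W'q qx] := He _ (lt_trans xr re).
  by exists q => //; split; [exact: W'q.2|rewrite qx].
pose inv x : T := xget p0 [set q | dom c q /\ cmap c q = x].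
have invK q : dom c q -> inv (cmap c q) = q.
  move=> dq; have [dq' qq'] : dom c (inv (cmap c q)) /\ cmap c (inv (cmap c q)) = cmap c q.
    by apply: (@xgetPex _ p0 [set q' | dom c q' /\ cmap c q' = cmap c q]); exists q.
  by apply: ic; rewrite ?inE.
pose B := [set x : 'rV[R]_n | `|x - cmap c p0| <= 2 * r].
have cB : compact B.
  apply: bounded_closed_compact.
    exists (2 * r + `|cmap c p0|); split; first exact: num_real.
    move=> s rs x /= xr; apply: le_trans (ltW rs).
    by rewrite -[x in leLHS](subrK (cmap c p0)); apply: le_trans (ler_normD _ _) _; rewrite lerD2r.
  rewrite (_ : B = closed_ball_ Num.norm (cmap c p0) (2 * r)).
    exact: closed_closed_ball_.
  by apply/seteqP; split=> w; rewrite /B /closed_ball_/= distrC.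
(* [inv] is the inverse of the chart; its value off the image is immaterial. *)
pose K := inv @` B.
have cK : compact K.
  apply: continuous_compact => //; apply: continuous_in_subspaceT => x.
  rewrite inE => xB; have [q W'q qx] := He _ (le_lt_trans xB r2e).
  have dq : dom c q by case: W'q.
  move=> V; rewrite -qx invK// => Vq.
  have Vo : open (cmap c @` (V^° `&` dom c)).
    exact: imc (openI (@open_interior _ _) oc) (@subIsetr _ _ _).
  have : nbhs (cmap c q) (cmap c @` (V^° `&` dom c)).
    by apply: open_nbhs_nbhs; split=> //; exists q => //; split.
  apply: filterS => _ [q' [Vq' dq'] <-]; rewrite /= invK//.
  exact: interior_subset Vq'.
have clK : closed K by exact: compact_closed.
have KW q : K q -> W' q.
  move=> [x xB <-]; have [q' W'q' <-] := He _ (le_lt_trans xB r2e).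
  by rewrite invK//; case: W'q'.
have chi0 q : ~ K q -> chi q = 0.
  move=> nK; rewrite /chi; case: asboolP => // dq; apply: rho0.
  rewrite leNgt; apply/negP => lt2; apply: nK; exists (cmap c q); last exact: invK.
  exact: ltW.
have out (q : M) : ~ K q -> near_pt q (fun q' => chi q' = 0).
  move=> nK; apply: (@near_pt_sub R M q (~` K) _ chi0).
  exact: manifold_near_pt (closed_openC clK) nK.
exists c, U, chi; split.
- by split=> //; split=> //; rewrite subrr normr0.
- rewrite imU; split; last exact: ball_convex.
  by rewrite -imU; apply: imc => // q [].
- apply/(smoothP gM) => q; have [dq|ndq] := pselect (dom c q).
    pose z (i : 'I_n) (q : M) : R := cmap c q 0 i.
    apply: (@smooth_at_near R M chi (fun q => rho (tuple_fun z q)) q).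
      apply: (@near_pt_sub R M q (dom c)); last exact: manifold_near_pt.
      move=> q' dq'; rewrite /chi asboolT//; congr rho.
      by apply/rowP => i; rewrite mxE.
    apply: (@smooth_at_comp R M _ z _ _ _ _ openT srho) => // i.
    exact: manifold_smooth_at_chart.
  apply: (@smooth_at_near R M chi (fun=> 0) q); last exact: smooth_at_cst.
  by apply: out => /KW[].
- by move=> q [dq qr]; rewrite /chi asboolT// rho1// ltW.
- by move=> q nW; apply: out => /KW.
Unshelve. all: by end_near. Qed.

(** The coordinates and the coordinate fields of a chart, multiplied by a cutoff
  function that is 1 on U. *)
Lemma manifold_frame (p0 : M) : frame_at p0.
Proof.
have [_ _ cov cA tA] := HM.
have [c [U [chi [[Ac Uc oU Up0] [oim cim] schi chi1 chi0]]]] :=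
  @manifold_cutoff setT p0 openT I.
have {}Uc : U `<=` dom c by move=> q /Uc[].
have {}chi0 (q : M) : ~ dom c q -> near_pt q (fun q' => chi q' = 0).
  by move=> nd; apply: chi0 => -[].
have chi0p (q : M) : ~ dom c q -> chi q = 0 by move=> /chi0 /(near_pt_pt gM).
have [oc ic cc imc] := cA c Ac.
pose z (i : 'I_n) (q : M) : R := chi q * cmap c q 0 i.
have sz i : smooth (z i).
  apply/(smoothP gM) => q; have [dq|nd] := pselect (dom c q).
    apply: smooth_at_mul; first exact: (smooth_smooth_at gM).
    exact: manifold_smooth_at_chart.
  apply: (@smooth_at_near R M _ (fun=> 0)); last exact: smooth_at_cst.
  by apply: near_pt_sub (chi0 q nd) => q' q0; rewrite /z q0 mul0r.
have zE q : U q -> tuple_fun z q = cmap c q.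
  by move=> Uq; apply/rowP => i; rewrite mxE /z chi1// mul1r.
pose inv x : T := xget p0 [set q | dom c q /\ cmap c q = x].
have invK q : dom c q -> inv (cmap c q) = q.
  move=> dq; have [dq' qq'] : dom c (inv (cmap c q)) /\ cmap c (inv (cmap c q)) = cmap c q.
    by apply: (@xgetPex _ p0 [set q' | dom c q' /\ cmap c q' = cmap c q]); exists q.
  by apply: ic; rewrite ?inE.
have oI : open (cmap c @` dom c) by exact: imc.
have sinv (f : M -> R) : smooth f -> smooth_on (cmap c @` dom c) (f \o inv : _ -> R^o).
  move=> sf k; have [g [sg gE]] := sf c Ac.
  apply: Ck_ext (sg k) => // _ [q dq <-].
  by rewrite /= invK// gE.
have dinv (f : M -> R) j q : smooth f -> dom c q ->
    derivable (f \o inv : _ -> R^o) (cmap c q) (bvec j).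
  move=> sf dq; apply: diff_derivable.
  by have [+ _] := sinv f sf 1%N; apply; exists q.
pose D j (q : M) (f : M -> R) : R := chi q * 'D_(bvec j) (f \o inv : _ -> R^o) (cmap c q).
pose X j : section (TB M) := fun q => tvec_of q (D j q).
have XE j q f : smooth f -> X j q f = D j q f.
  apply: (tvec_ofE gM) => [a {}f g sf sg|{}f g sf sg].
    have [dq|/chi0p q0] := pselect (dom c q); last first.
      by rewrite /D q0 !mul0r mulr0 addr0.
    have df := dinv f j q sf dq; have dg := dinv g j q sg dq.
    have E : 'D_(bvec j) ((fun q => a * f q + g q) \o inv : _ -> R^o) (cmap c q) =
        a * 'D_(bvec j) (f \o inv : _ -> R^o) (cmap c q) +
        'D_(bvec j) (g \o inv : _ -> R^o) (cmap c q).
      have := deriveD (@derivableZ _ _ _ _ a _ _ df) dg; rewrite (@deriveZ _ _ _ _ a _ _ df); exact.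
    by rewrite /D E mulrDr mulrCA.
  have [dq|/chi0p q0] := pselect (dom c q); last first.
    by rewrite /D q0 !mul0r mulr0 addr0.
  have E : 'D_(bvec j) ((fun q => f q * g q) \o inv : _ -> R^o) (cmap c q) =
      f (inv (cmap c q)) * 'D_(bvec j) (g \o inv : _ -> R^o) (cmap c q) +
      g (inv (cmap c q)) * 'D_(bvec j) (f \o inv : _ -> R^o) (cmap c q).
    exact: (deriveM (dinv f j q sf dq) (dinv g j q sg dq)).
  by rewrite /D E invK// mulrDr addrC; congr (_ + _); [rewrite mulrCA mulrC|exact: mulrCA].
exists c, U, z, X; split=> //.
- by move=> q Uq; exact: manifold_near_pt.
- split=> // [q Uq|q Uq|f sf].
  + have [c' [U' [chi' [[_ _ _ U'q] _ schi' chi1' chi0']]]] := manifold_cutoff oU Uq.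
    by exists chi'; split=> // [|q' nU]; [exact: chi1'|apply: chi0' => -[]].
  + by rewrite zE//; exists q.
  + exists (f \o inv); split=> [k|q Uq].
      apply: Ck_subset (sinv f sf k) => _ [q Uq <-].
      by exists q => //; exact: Uc.
    by rewrite zE//= invK//; exact: Uc.
- split=> [j f sf|q Uq i j].
    rewrite (_ : (fun p => X j p f) = fun q => D j q f); last first.
      by apply/funext => q; exact: XE.
    apply/(smoothP gM) => q; have [dq|nd] := pselect (dom c q); last first.
      apply: (@smooth_at_near R M _ (fun=> 0)); last exact: smooth_at_cst.
      by apply: near_pt_sub (chi0 q nd) => q' q0; rewrite /D q0 mul0r.
    apply: smooth_at_mul; first exact: (smooth_smooth_at gM).
    pose w (i : 'I_n) (q : M) : R := cmap c q 0 i.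
    have wE q' : tuple_fun w q' = cmap c q' by apply/rowP => i; rewrite mxE.
    apply: (@smooth_at_near R M _
      (fun q => 'D_(bvec j) (f \o inv : _ -> R^o) (tuple_fun w q))).
      apply: (@near_pt_sub R M q (dom c)); last exact: manifold_near_pt.
      by move=> q' dq'; rewrite wE.
    apply: (@smooth_at_comp R M _ w (cmap c @` dom c)
      ('D_(bvec j) (f \o inv : _ -> R^o))) => //.
    + by move=> i; exact: manifold_smooth_at_chart.
    + by move=> k; have [_] := sinv f sf k.+1; exact.
    + by rewrite wE; exists q.
  rewrite XE// /D chi1// mul1r.
  have -> : 'D_(bvec j) (z i \o inv : _ -> R^o) (cmap c q) =
      'D_(bvec j) (fun x : 'rV[R]_n => x 0 i : R^o) (cmap c q).
    apply: near_eq_derive.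
    have : nbhs (cmap c q) (cmap c @` U).
      by apply: open_nbhs_nbhs; split=> //; exists q.
    apply: filterS => _ [q' Uq' <-] /=; rewrite invK; last exact: Uc.
    by rewrite /z chi1// mul1r.
  by rewrite derive_coord mxE.
Qed.

Lemma manifold_framed : framed M.
Proof. by split; [exact: gM|exact: manifold_frame]. Qed.

End Manifold.

(** * Dual vector spaces *)

Section DualTheory.
Context (R : realType) (V : lmodType R).
Implicit Types (l k : dual V) (u v : V).

Lemma dual_linear l : linear l.
Proof. by case: l => l /= /asboolP. Qed.

Lemma dualD l u v : l (u + v) = l u + l v.
Proof. by have := dual_linear l 1 u v; rewrite !scale1r. Qed.

Lemma dual0 l : l 0 = 0.
Proof. by have /eqP := dualD l 0 0; rewrite addr0 -subr_eq0 opprD addrA subrr sub0r oppr_eq0 => /eqP. Qed.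

Lemma dualZ l (a : R) v : l (a *: v) = a * l v.
Proof. by have := dual_linear l a v 0; rewrite !addr0 dual0 addr0. Qed.

Lemma dualN l v : l (- v) = - l v.
Proof. by rewrite -scaleN1r dualZ mulN1r. Qed.

Lemma dualB l u v : l (u - v) = l u - l v.
Proof. by rewrite dualD dualN. Qed.

Lemma dual_sum l n (F : 'I_n -> V) : l (\sum_i F i) = \sum_i l (F i).
Proof.
elim: n F => [|n IH] F; first by rewrite !big_ord0 dual0.
by rewrite !big_ord_recl dualD IH.
Qed.

Lemma dual_addE l k v : (l + k) v = l v + k v. Proof. by []. Qed.
Lemma dual_subE l k v : (l - k) v = l v - k v. Proof. by []. Qed.
Lemma dual_scaleE (a : R) l v : (a *: l) v = a * l v. Proof. by []. Qed.
Lemma dual_sumE n (F : 'I_n -> dual V) v : (\sum_i F i) v = \sum_i F i v.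
Proof. by elim/big_ind2 : _ => // x1 x2 y1 y2 <- <-. Qed.

Lemma dual_eq l k : (forall v, l v = k v) -> l = k.
Proof. by move=> H; apply: val_inj; apply/funext. Qed.

Lemma dual_ex (h : V -> R^o) : linear h -> exists l : dual V, forall v, l v = h v.
Proof.
move=> hl; have hP : h \in @dual_pred R V by apply/asboolP.
by exists (Dual hP).
Qed.

End DualTheory.

(** * Calculus of vector fields and one-forms *)

(* From here on smooth functions are used through their closure properties
   only. *)
#[local] Opaque smooth.
#[local] Arguments tvec_fun : simpl never.
#[local] Arguments dual_fun : simpl never.

Section Calculus.
Context (R : realType) (N : smoothType R).
Hypothesis gN : good_atlas N.
Implicit Types (X Y Z : section (TB N)) (f g : N -> R) (p q : N).

Local Notation vf := (@smooth_sec R N (TB N)).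

Lemma eq_smooth f g : (forall p, f p = g p) -> smooth g -> smooth f.
Proof. by move=> /funext ->. Qed.

Lemma vf_add X Y : vf X -> vf Y -> vf (fun q => X q + Y q).
Proof.
move=> sX sY f sf; apply: (eq_smooth _ (smooth_add gN (sX f sf) (sY f sf))) => p.
by rewrite tvecD.
Qed.

Lemma vf_scale f X : smooth f -> vf X -> vf (fun q => f q *: X q).
Proof.
move=> sf sX g sg; apply: (eq_smooth _ (smooth_mul gN sf (sX g sg))) => p.
by rewrite tvecZ.
Qed.

Lemma vf_zero : vf (fun q => 0).
Proof. by move=> f sf; exact: (smooth_cst gN 0). Qed.

Lemma vf_sum n (F : 'I_n -> section (TB N)) : (forall i, vf (F i)) ->
  vf (fun q => \sum_i F i q).
Proof.
move=> H f sf; rewrite (_ : (fun p => _) = fun p => \sum_i F i p f).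
  by apply: (smooth_sum gN) => i; exact: H.
by apply/funext => p; rewrite tvec_sum.
Qed.

(** * The Lie bracket *)

(** The commutator satisfies the Leibniz rule since the mixed terms cancel. *)
Lemma lieE X Y p f : vf X -> vf Y -> smooth f ->
  lie X Y p f = X p (fun q => Y q f) - Y p (fun q => X q f).
Proof.
move=> sX sY; apply: (tvec_ofE gN) => [a {}f g sf sg|{}f g sf sg].
  rewrite (_ : (fun q => Y q _) = fun q => a * Y q f + Y q g); last first.
    by apply/funext => q; rewrite tv_lin.
  rewrite (_ : (fun q => X q _) = fun q => a * X q f + X q g); last first.
    by apply/funext => q; rewrite tv_lin.
  by rewrite !tv_lin//; [ring|exact: sX..|exact: sY|exact: sY].
rewrite (_ : (fun q => Y q _) = fun q => Y q f * g q + f q * Y q g); last first.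
  by apply/funext => q; rewrite tv_mul.
rewrite (_ : (fun q => X q _) = fun q => X q f * g q + f q * X q g); last first.
  by apply/funext => q; rewrite tv_mul.
have sXf := sX f sf; have sXg := sX g sg; have sYf := sY f sf; have sYg := sY g sg.
by rewrite !tv_add ?tv_mul//; do ?[exact: smooth_mul]; ring.
Qed.

Lemma vf_lie X Y : vf X -> vf Y -> vf (lie X Y).
Proof.
move=> sX sY f sf; rewrite (_ : (fun p => _) =
    fun p => X p (fun q => Y q f) - Y p (fun q => X q f)).
  apply: (smooth_sub gN); first exact: sX (sY f sf).
  exact: sY (sX f sf).
by apply/funext => p; exact: lieE.
Qed.

Lemma lieC X Y p : vf X -> vf Y -> lie X Y p = - lie Y X p.
Proof.
move=> sX sY; apply: tvec_eq => f sf.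
by rewrite tvecN !lieE// opprB.
Qed.

Lemma lie_addr X Y Z p : vf X -> vf Y -> vf Z ->
  lie X (fun q => Y q + Z q) p = lie X Y p + lie X Z p.
Proof.
move=> sX sY sZ; apply: tvec_eq => f sf; have sYZ := vf_add sY sZ.
rewrite tvecD !lieE// tvecD.
have -> : (fun q => (Y q + Z q) f) = fun q => Y q f + Z q f by apply/funext => q; rewrite tvecD.
rewrite (tv_add _ (sY f sf) (sZ f sf)); ring.
Qed.

Lemma lie_scaler X f Y p : smooth f -> vf X -> vf Y ->
  lie X (fun q => f q *: Y q) p = X p f *: Y p + f p *: lie X Y p.
Proof.
move=> sf sX sY; apply: tvec_eq => g sg; have sfY := vf_scale sf sY.
rewrite tvecD !tvecZ !lieE// tvecZ.
have -> : (fun q => (f q *: Y q) g) = fun q => f q * Y q g by apply/funext => q; rewrite tvecZ.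
by rewrite tv_mul//; [ring|exact: sY].
Qed.

Lemma lie_jacobi X Y Z p : vf X -> vf Y -> vf Z ->
  lie X (lie Y Z) p = lie (lie X Y) Z p + lie Y (lie X Z) p.
Proof.
move=> sX sY sZ; apply: tvec_eq => f sf.
have sYZ := vf_lie sY sZ; have sXZ := vf_lie sX sZ; have sXY := vf_lie sX sY.
have sXf := sX f sf; have sYf := sY f sf; have sZf := sZ f sf.
have E V W : vf V -> vf W -> (fun q => lie V W q f) =
   fun q => V q (fun r => W r f) - W q (fun r => V r f).
  by move=> sV sW; apply/funext => q; exact: lieE.
rewrite tvecD !lieE// !E//.
by rewrite !(tv_sub gN) ?lieE//; [ring|do ?[exact: sX|exact: sY|exact: sZ]..].
Qed.

(** * Tensoriality *)

(** The expansion of chi v holds at every point q, not only at p.  So it can be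
  inserted into operators that are defined on global sections only, without
  first proving that they are local. *)
Definition has_dual_frame p := exists m (z : 'I_m -> N -> R)
    (B : 'I_m -> section (TB N)) (chi : N -> R),
  [/\ forall i, smooth (z i), forall i, vf (B i), smooth chi, chi p = 1 &
      forall q (v : tvec q), chi q *: v = \sum_i (chi q * v (z i)) *: B i q].

(** Linearity over the functions, for an operator whose value is read at p. *)
Definition tensor_at (W : lmodType R) p (Phi : section (TB N) -> W) :=
  (forall X Y, vf X -> vf Y -> Phi (fun q => X q + Y q) = Phi X + Phi Y) /\
  (forall f X, smooth f -> vf X -> Phi (fun q => f q *: X q) = f p *: Phi X).

Lemma tensor_zero (W : lmodType R) p (Phi : section (TB N) -> W) :
  tensor_at p Phi -> Phi (fun=> 0) = 0.
Proof.
move=> [_ H]; have := H (fun=> 0) (fun=> 0) (smooth_cst gN 0) vf_zero.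
rewrite scale0r => <-; congr Phi.
by apply: functional_extensionality_dep => q; rewrite scale0r.
Qed.

Lemma tensor_sum (W : lmodType R) p (Phi : section (TB N) -> W) m
    (F : 'I_m -> N -> R) (B : 'I_m -> section (TB N)) :
  tensor_at p Phi -> (forall i, smooth (F i)) -> (forall i, vf (B i)) ->
  Phi (fun q => \sum_i F i q *: B i q) = \sum_i F i p *: Phi (B i).
Proof.
move=> tPhi; have [PhiD PhiZ] := tPhi; elim: m F B => [|m IH] F B sF sB.
  rewrite big_ord0 -(tensor_zero tPhi); congr Phi.
  by apply: functional_extensionality_dep => q; rewrite big_ord0.
rewrite (_ : (fun q => _) = fun q => F ord0 q *: B ord0 q +
   \sum_i F (lift ord0 i) q *: B (lift ord0 i) q); last first.
  by apply: functional_extensionality_dep => q; rewrite big_ord_recl.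
rewrite PhiD; first by rewrite IH// PhiZ// big_ord_recl.
  exact: vf_scale.
by apply: vf_sum => i; exact: vf_scale.
Qed.

(** Since chi p = 1, Phi X = Phi (chi X), and chi X is a combination of the frame
  with global smooth coefficients. *)
Lemma tensor_frame (W : lmodType R) p (Phi : section (TB N) -> W) m
    (z : 'I_m -> N -> R) (B : 'I_m -> section (TB N)) (chi : N -> R) X :
  (forall i, smooth (z i)) -> (forall i, vf (B i)) -> smooth chi -> chi p = 1 ->
  (forall q (v : tvec q), chi q *: v = \sum_i (chi q * v (z i)) *: B i q) ->
  tensor_at p Phi -> vf X ->
  Phi X = \sum_i X p (z i) *: Phi (B i).
Proof.
move=> sz sB schi chi1 E tPhi sX; have [PhiD PhiZ] := tPhi.
rewrite -[LHS]scale1r -chi1 -PhiZ//.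
rewrite (_ : (fun q => _) = fun q => \sum_i (chi q * X q (z i)) *: B i q); last first.
  by apply: functional_extensionality_dep => q; exact: E.
have sF i : smooth (fun q => chi q * X q (z i)).
  exact: (smooth_mul gN schi (sX _ (sz i))).
rewrite (tensor_sum tPhi sF sB).
by apply: eq_bigr => i _; rewrite chi1 mul1r.
Qed.

Hypothesis fN : forall p, has_dual_frame p.

(** The combination of the frame with the constant coefficients v(z_i). *)
Lemma vf_extend p (v : tvec p) : exists2 Z, vf Z & Z p = v.
Proof.
have [m [z [B [chi [sz sB schi chi1 E]]]]] := fN p.
exists (fun q => \sum_i v (z i) *: B i q).
  by apply: vf_sum => i; apply: vf_scale => //; exact: smooth_cst.
rewrite -[RHS]scale1r -chi1 E.
by apply: eq_bigr => i _; rewrite chi1 mul1r.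
Qed.

(** Tensoriality at p makes the values Phi Z p depend on Z p only, so that they
  define a covector; vector fields extending a given vector make it unique. *)
Lemma covec_ofE (Phi : section (TB N) -> N -> R) p :
  tensor_at p (fun Z => Phi Z p : R^o) ->
  forall Z, vf Z -> covec_of Phi p (Z p) = Phi Z p.
Proof.
move=> tPhi; have [m [z [B [chi [sz sB schi chi1 E]]]]] := fN p.
have ex : exists l : dual (tvec p), forall Z, vf Z -> l (Z p) = Phi Z p.
  have hl : linear (fun v : tvec p => \sum_i v (z i) * Phi (B i) p : R^o).
    move=> a u v; transitivity (a * (\sum_i u (z i) * Phi (B i) p) +
        (\sum_i v (z i) * Phi (B i) p)) => //.
    rewrite mulr_sumr -big_split/=; apply: eq_bigr => i _.
    by rewrite tvecD tvecZ mulrDl mulrA.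
  have [l lE] := dual_ex hl; exists l => Z sZ.
  by rewrite lE (tensor_frame sz sB schi chi1 E tPhi sZ).
exact: (@xgetPex _ (0 : dual (tvec p)) [set l : dual (tvec p) |
  forall Z, vf Z -> l (Z p) = Phi Z p] ex).
Qed.

Lemma covec_of_smooth (Phi : section (TB N) -> N -> R) :
  (forall p, tensor_at p (fun Z => Phi Z p : R^o)) ->
  (forall Z, vf Z -> smooth (Phi Z)) ->
  @smooth_sec _ _ (cotangent N) (covec_of Phi).
Proof.
move=> tPhi sPhi Z sZ; rewrite (_ : (fun p => _) = Phi Z); first exact: sPhi.
by apply/funext => p; exact: covec_ofE.
Qed.

Lemma differentialE f p (v : tvec p) : smooth f -> differential f p v = v f.
Proof.
move=> sf; have [Z sZ <-] := vf_extend v.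
by rewrite (covec_ofE (Phi := fun Z p => Z p f)).
Qed.

Lemma differential_smooth f : smooth f ->
  @smooth_sec _ _ (cotangent N) (differential f).
Proof. by move=> sf; apply: covec_of_smooth => // Z sZ; exact: sZ. Qed.

Lemma dual_tvec_eq p (l k : dual (tvec p)) :
  (forall Z, vf Z -> l (Z p) = k (Z p)) -> l = k.
Proof. by move=> H; apply: dual_eq => v; have [Z sZ <-] := vf_extend v; exact: H. Qed.

(** * Lie derivative, exterior derivative and dual connection of one-forms *)

Implicit Types (al be : section (cotangent N)).
Local Notation fm := (@smooth_sec R N (cotangent N)).

Lemma lie_form_tensor X be p : vf X -> fm be ->
  tensor_at p (fun Z => X p (fun q => be q (Z q)) - be p (lie X Z p) : R^o).
Proof.
move=> sX sbe; split=> [Y Z sY sZ|f Z sf sZ].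
  rewrite lie_addr// dualD (_ : (fun q => be q (Y q + Z q)) =
    fun q => be q (Y q) + be q (Z q)); last by apply/funext => q; rewrite dualD.
  by rewrite (tv_add _ (sbe _ sY) (sbe _ sZ)); ring.
rewrite lie_scaler// dualD !dualZ.
rewrite (_ : (fun q => be q (f q *: Z q)) = fun q => f q * be q (Z q)); last first.
  by apply/funext => q; rewrite dualZ.
rewrite (tv_mul _ sf (sbe _ sZ)).
by rewrite /GRing.scale/=; ring.
Qed.

Lemma lie_formE X be Z p : vf X -> fm be -> vf Z ->
  lie_form X be p (Z p) = X p (fun q => be q (Z q)) - be p (lie X Z p).
Proof.
move=> sX sbe sZ; apply: (covec_ofE (Phi := fun Z p => _)) => //.
exact: lie_form_tensor.
Qed.

Lemma lie_form_smooth X be : vf X -> fm be -> fm (lie_form X be).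
Proof.
move=> sX sbe; apply: covec_of_smooth => [p|Z sZ]; first exact: lie_form_tensor.
exact: (smooth_sub gN (sX _ (sbe _ sZ)) (sbe _ (vf_lie sX sZ))).
Qed.

Lemma d_form_tensor al Y p : fm al -> vf Y ->
  tensor_at p (fun Z => d_form al Y Z p : R^o).
Proof.
move=> sal sY; rewrite /d_form; split=> [V Z sV sZ|f Z sf sZ].
  rewrite lie_addr// !dualD (_ : (fun q => al q (V q + Z q)) =
    fun q => al q (V q) + al q (Z q)); last by apply/funext => q; rewrite dualD.
  by rewrite (tv_add _ (sal _ sV) (sal _ sZ)) tvecD; ring.
rewrite lie_scaler// dualD !dualZ.
rewrite (_ : (fun q => al q (f q *: Z q)) = fun q => f q * al q (Z q)); last first.
  by apply/funext => q; rewrite dualZ.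
rewrite (tv_mul _ sf (sal _ sZ)).
by rewrite tvecZ /GRing.scale/=; ring.
Qed.

Lemma d_formE al Y Z p : fm al -> vf Y -> vf Z ->
  covec_of (d_form al Y) p (Z p) =
  Y p (fun q => al q (Z q)) - Z p (fun q => al q (Y q)) - al p (lie Y Z p).
Proof. by move=> sal sY sZ; apply: covec_ofE => //; exact: d_form_tensor. Qed.

Lemma d_form_smooth al Y : fm al -> vf Y -> fm (covec_of (d_form al Y)).
Proof.
move=> sal sY; apply: covec_of_smooth => [p|Z sZ]; first exact: d_form_tensor.
exact: (smooth_sub gN (smooth_sub gN (sY _ (sal _ sZ)) (sZ _ (sal _ sY)))
  (sal _ (vf_lie sY sZ))).
Qed.

Section Connection.
Variable nabla : connection_op (TB N).
Hypothesis Hn : is_connection nabla.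

Lemma dual_connection_tensor X al p : vf X -> fm al ->
  tensor_at p (fun Z => X p (fun q => al q (Z q)) - al p (nabla X Z p) : R^o).
Proof.
have [_ _ _ nD nZ] := Hn.
move=> sX sal; split=> [Y Z sY sZ|f Z sf sZ].
  rewrite nD// dualD (_ : (fun q => al q (Y q + Z q)) =
    fun q => al q (Y q) + al q (Z q)); last by apply/funext => q; rewrite dualD.
  by rewrite (tv_add _ (sal _ sY) (sal _ sZ)); ring.
rewrite nZ// dualD !dualZ.
rewrite (_ : (fun q => al q (f q *: Z q)) = fun q => f q * al q (Z q)); last first.
  by apply/funext => q; rewrite dualZ.
rewrite (tv_mul _ sf (sal _ sZ)).
by rewrite /GRing.scale/=; ring.
Qed.

Lemma dual_connectionE X al Z p : vf X -> fm al -> vf Z ->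
  dual_connection nabla X al p (Z p) =
  X p (fun q => al q (Z q)) - al p (nabla X Z p).
Proof.
move=> sX sal sZ; apply: (covec_ofE (Phi := fun Z p => _)) => //.
exact: dual_connection_tensor.
Qed.

End Connection.

End Calculus.

Section Framed.
Context (R : realType) (M : smoothType R).

Lemma framed_dual_frame : framed M -> forall p : M, has_dual_frame p.
Proof.
move=> [gM fM] p; have [c [U [z [X [[ac Uc Up] nU zE cz [sX Xz]]]]]] := fM p.
have [sz cut _ _ _] := cz; have [chi cchi] := cut p Up; have [schi chi1 chi0] := cchi.
exists (mdim M), z, X, chi; split=> // q v.
have [Uq|nUq] := pselect (U q); last first.
  rewrite (cutoff_out gM cchi nUq) scale0r big1// => i _.
  by rewrite mul0r scale0r.
under eq_bigr do rewrite -scalerA.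
rewrite -scaler_sumr; congr (_ *: _).
apply: (coords_eq gM cz Uq) => i; rewrite tvec_sum (bigD1 i)//= big1 ?addr0.
  by rewrite tvecZ Xz// eqxx mulr1.
by move=> j ji; rewrite tvecZ Xz// eq_sym (negbTE ji) mulr0.
Qed.

End Framed.

(** * The total space of T*M + R and its generating functions *)

Section TotalSpace.
Context (R : realType) (M : smoothType R).
Hypothesis fM : framed M.
Let gM : good_atlas M := proj1 fM.
Let tM := framed_dual_frame fM.
Local Notation n := (mdim M).
Local Notation E := (total_space (bnE M)).
Local Notation vf := (@smooth_sec R M (TB M)).
Local Notation fm := (@smooth_sec R M (cotangent M)).
Local Notation bs := (@smooth_sec R M (bnE M)).
Implicit Types (p : M) (q : E) (X Y Z : section (TB M)) (f : M -> R) (F : E -> R).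

Definition base q : M := projT1 q.
Definition covec q : dual (tvec (base q)) := (projT2 q).1.
Definition height q : R := (projT2 q).2.

Definition pull f : E -> R := fun q => f (base q).
(** The momentum of Y: the fibrewise linear function on T*M defined by Y. *)
Definition mom Y : E -> R := fun q => covec q (Y (base q)).

Lemma total_chartP (C : chart R E (mdim E)) : atlas C ->
  exists (c : chart R M n) (U : set M) (e : 'I_(n + 1) -> section (bnE M)),
   [/\ atlas c /\ (U `<=` dom c /\ open (cmap c @` U)),
     forall i, bs (e i),
     forall p, U p -> forall u : bnE M p,
       exists! y : 'rV[R]_(n + 1), u = \sum_i y 0 i *: e i p,
     dom C = [set q | U (base q)] &
     forall q, dom C q -> lsubmx (cmap C q : 'rV[R]_(n + (n + 1))) = cmap c (base q) /\
       projT2 q = \sum_i (rsubmx (cmap C q : 'rV[R]_(n + (n + 1)))) 0 i *: e i (base q)].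
Proof. by []. Qed.

Lemma open_lsubmx (O : set 'rV[R]_n) : open O ->
  open [set x : 'rV[R]_(n + (n + 1)) | O (lsubmx x)].
Proof.
move=> oO; apply: (@open_comp _ _ (lsubmx : 'rV[R]_(n + (n + 1)) -> 'rV[R]_n)) => // x _.
exact: continuous_lsubmx.
Qed.

Lemma smooth_lsubmx (O : set 'rV[R]_n) (g : 'rV[R]_n -> R^o) : open O -> smooth_on O g ->
  smooth_on [set x : 'rV[R]_(n + (n + 1)) | O (lsubmx x)] (fun x => g (lsubmx x)).
Proof.
move=> oO sg k; apply: (@Ck_comp _ _ _ _ _ O) => //; first exact: open_lsubmx.
move=> i; rewrite (_ : (fun x => _) =
  (fun x : 'rV[R]_(n + (n + 1)) => x 0 (lshift (n + 1) i) : R^o)).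
  exact: Ck_coord.
by apply/funext => x; rewrite /lsubmx mxE.
Qed.

(** The first coordinates of a chart of the total space are those of a chart of M. *)
Lemma near_pt_base q (P : set M) : near_pt (base q) P ->
  near_pt q (fun q' => P (base q')).
Proof.
move=> H C /total_chartP[c [U [e [[ac [Uc oU]] se eE dC cE]]]] dq.
have Uq : U (base q) by move: dq; rewrite dC.
have [W [oW Wq HW]] := H c ac (Uc _ Uq).
exists [set x : 'rV[R]_(n + (n + 1)) | W (lsubmx x)]; split.
- exact: open_lsubmx.
- by have [/= -> _] := cE q dq.
- move=> q' dq' /=; have [-> _] := cE q' dq' => Wq'; apply: HW => //.
  by apply: Uc; move: dq'; rewrite dC.
Qed.

Lemma smooth_via_base (C : chart R E (mdim E)) (c : chart R M n) (U : set M) f q :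
  U `<=` dom c -> dom C = [set q | U (base q)] ->
  (forall q, dom C q -> lsubmx (cmap C q : 'rV[R]_(n + (n + 1))) = cmap c (base q)) ->
  dom C q -> smooth_via c f (base q) -> smooth_via C (pull f) q.
Proof.
move=> Uc dC cE dq [W [g [oW Wq sg HW]]].
exists [set x : 'rV[R]_(n + (n + 1)) | W (lsubmx x)], (fun x : 'rV[R]_(n + (n + 1)) => g (lsubmx x)).
split.
- exact: open_lsubmx.
- by rewrite /= cE.
- exact: smooth_lsubmx.
- move=> q' dq' /=; rewrite cE// => Wq'; rewrite /pull HW//.
  by apply: Uc; move: dq'; rewrite dC.
Qed.

Lemma smooth_at_pull f q : smooth_at f (base q) -> smooth_at (pull f) q.
Proof.
move=> sf C aC dq.
have [c [U [e [[ac [Uc oU]] se eE dC cE]]]] := total_chartP aC.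
apply: (smooth_via_base Uc dC _ dq); first by move=> q' /cE[].
by apply: sf => //; apply: Uc; move: dq; rewrite dC.
Qed.

(** In a chart such a function is sum_i y_i L(e_i), with y_i fibre coordinates
  and L(e_i) smooth on the base. *)
Lemma smooth_at_fibre_linear (L : forall p, bnE M p -> R) q :
  (forall p (a : R) u v, L p (a *: u + v) = a * L p u + L p v) ->
  (forall s, bs s -> smooth (fun p => L p (s p))) ->
  smooth_at (fun q => L (base q) (projT2 q)) q.
Proof.
move=> Llin Ls C aC dq.
have [c [U [e [[ac [Uc oU]] se eE dC cE]]]] := total_chartP aC.
have L0 p : L p 0 = 0.
  have /eqP := Llin p (-1) 0 0; rewrite scaler0 addr0 mulN1r addNr => /eqP //.
have LD p u v : L p (u + v) = L p u + L p v by rewrite -[u]scale1r Llin mul1r scale1r.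
have LZ p a u : L p (a *: u) = a * L p u by rewrite -[a *: u]addr0 Llin L0 addr0.
have Lsum p m (G : 'I_m -> bnE M p) : L p (\sum_i G i) = \sum_i L p (G i).
  by elim: m G => [|m IH] G; rewrite ?big_ord0// !big_ord_recl LD IH.
apply: (@smooth_via_ext _ _ _ _ (fun q => \sum_i
    cmap C q 0 (rshift n i : 'I_(n + (n + 1))) * pull (fun p => L p (e i p)) q)).
  move=> q' dq'; have [_ {1}->] := cE q' dq'; rewrite Lsum.
  by apply: eq_bigr => i _; rewrite LZ mxE.
apply: smooth_via_sum => i; apply: smooth_via_mul; first exact: smooth_via_coord.
apply: (smooth_via_base Uc dC _ dq); first by move=> q' /cE[].
apply: (smooth_smooth_at gM); [exact: Ls|by []|].
by apply: Uc; move: dq; rewrite dC.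
Qed.

Lemma smooth_at_mom Y q : vf Y -> smooth_at (mom Y) q.
Proof.
move=> sY; apply: (@smooth_at_fibre_linear (fun p u => (u.1 : dual (tvec p)) (Y p))).
  by move=> p a [u u'] [v v'] /=; rewrite dual_addE dual_scaleE.
by move=> s [s1 _]; exact: s1.
Qed.

Lemma smooth_at_height q : smooth_at height q.
Proof.
apply: (@smooth_at_fibre_linear (fun p u => u.2)).
  by move=> p a [u u'] [v v'].
by move=> s [].
Qed.

(** * The standard charts of the total space *)

Section StandardChart.
Context (c : chart R M n) (U : set M) (z : 'I_n -> M -> R) (X : 'I_n -> section (TB M)).
Hypotheses (ac : atlas c) (Uc : U `<=` dom c) (oU : open (cmap c @` U)).
Hypothesis zE : forall p, U p -> tuple_fun z p = cmap c p.
Hypothesis cz : coords_on z U (cmap c @` U).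
Hypothesis sX : forall j, vf (X j).
Hypothesis Xz : forall p, U p -> forall i j, X j p (z i) = (i == j)%:R.

Let sz i : smooth (z i). Proof. by have [+ _ _ _ _] := cz. Qed.

Lemma frame_expand p (v : tvec p) : U p -> v = \sum_i v (z i) *: X i p.
Proof.
move=> Up; apply: (coords_eq gM cz Up) => i; rewrite tvec_sum (bigD1 i)//= big1 ?addr0.
  by rewrite tvecZ Xz// eqxx mulr1.
by move=> j ji; rewrite tvecZ Xz// eq_sym (negbTE ji) mulr0.
Qed.

Lemma coframe_expand p (al : dual (tvec p)) : U p ->
  al = \sum_i al (X i p) *: differential (z i) p.
Proof.
move=> Up; apply: dual_eq => v; rewrite [v in al v](frame_expand v Up) dual_sum dual_sumE.
apply: eq_bigr => i _; rewrite dualZ dual_scaleE mulrC.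
by rewrite (differentialE gM tM).
Qed.

Lemma coframe_frame p i j : U p -> differential (z i) p (X j p) = (i == j)%:R.
Proof. by move=> Up; rewrite (differentialE gM tM)// Xz. Qed.

(** With these coordinates, z on the base, the momenta of the frame X and the
  height, all coordinates are restrictions of global smooth functions. *)
Definition std_coord q : 'rV[R]_(n + (n + 1)) :=
  row_mx (tuple_fun z (base q))
    (row_mx (\row_i mom (X i) q) (\row_(i < 1) height q)).

(** The dual frame dz_i of T*M and the section 1 of the line bundle: the frame
  whose fibre coordinates are those of [std_coord]. *)
Definition std_frame (k : 'I_(n + 1)) : section (bnE M) := fun p =>
  match fintype.split k with
  | inl i => (differential (z i) p, 0 : R^o) : (dual (tvec p) * R^o)%type
  | inr _ => (0 : dual (tvec p), 1 : R^o) : (dual (tvec p) * R^o)%type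
  end.

Definition std_chart : chart R E (mdim E) :=
  Chart [set q | U (base q)] (std_coord : E -> 'rV[R]_(mdim E)).

Lemma std_frame_smooth k : bs (std_frame k).
Proof.
rewrite /std_frame; case: splitP => j _; split => /=.
- exact: differential_smooth.
- exact: (smooth_cst gM 0).
- by move=> Y sY; exact: (smooth_cst gM 0).
- exact: (smooth_cst gM 1).
Qed.

Lemma std_frame_sum p (y : 'rV[R]_(n + 1)) :
  \sum_k y 0 k *: std_frame k p =
  (\sum_i y 0 (lshift 1 i) *: differential (z i) p, y 0 (rshift n 0) : R^o).
Proof.
rewrite big_split_ord/= big_ord1 /std_frame.
under eq_bigr do rewrite (unsplitK (inl _)).
rewrite (unsplitK (inr _)).
have fst_sum m (G : 'I_m -> bnE M p) : (\sum_i G i).1 = \sum_i (G i).1.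
  by elim/big_ind2 : _ => // x1 x2 y1 y2 <- <-.
have snd_sum m (G : 'I_m -> bnE M p) : (\sum_i G i).2 = \sum_i (G i).2.
  by elim/big_ind2 : _ => // x1 x2 y1 y2 <- <-.
congr pair.
  by rewrite fst_sum/= scaler0 addr0.
rewrite snd_sum/= big1 ?add0r; first by rewrite [LHS]mulr1.
by move=> i _; exact: mulr0.
Qed.

Lemma std_chart_atlas : atlas std_chart.
Proof.
exists c, U, std_frame; split=> //; first exact: std_frame_smooth.
  move=> p Up [al f]; exists (row_mx (\row_i al (X i p)) (\row_(i < 1) f)); split.
    rewrite std_frame_sum; congr pair; last by rewrite row_mxEr mxE.
    rewrite [LHS](coframe_expand al Up); apply: eq_bigr => i _.
    by rewrite row_mxEl mxE.
  move=> y; rewrite std_frame_sum => -[-> ->].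
  apply/rowP => k; rewrite -(splitK k); case: fintype.split => j /=.
    rewrite row_mxEl mxE dual_sumE (bigD1 j)//= dual_scaleE coframe_frame// eqxx mulr1.
    rewrite big1 ?addr0// => i ij.
    by rewrite dual_scaleE coframe_frame// (negbTE ij) mulr0.
  by rewrite row_mxEr mxE ord1.
move=> q Uq; split; first by rewrite /= /std_coord row_mxKl zE.
rewrite /= /std_coord row_mxKr [RHS]std_frame_sum row_mxEr mxE.
rewrite [LHS]surjective_pairing; congr pair.
rewrite [LHS](coframe_expand _ Uq); apply: eq_bigr => i _.
by rewrite row_mxEl mxE.
Qed.

Definition zeta (k : 'I_(n + (n + 1))) : E -> R := fun q => std_coord q 0 k.

Lemma tuple_zeta q : tuple_fun zeta q = std_coord q.
Proof. by apply/rowP => k; rewrite mxE. Qed.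

Lemma zeta_pull i : zeta (lshift (n + 1) i) = pull (z i).
Proof. by apply/funext => q; rewrite /zeta /std_coord row_mxEl mxE. Qed.

Lemma zeta_mom i : zeta (rshift n (lshift 1 i)) = mom (X i).
Proof. by apply/funext => q; rewrite /zeta /std_coord row_mxEr row_mxEl mxE. Qed.

Lemma zeta_height i : zeta (rshift n (rshift n i)) = height.
Proof. by apply/funext => q; rewrite /zeta /std_coord row_mxEr row_mxEr mxE. Qed.

Lemma zeta_ind (P : (E -> R) -> Prop) : (forall i, P (pull (z i))) ->
  (forall i, P (mom (X i))) -> P height -> forall k, P (zeta k).
Proof.
move=> P1 P2 P3 k; rewrite -(splitK k); case: fintype.split => j /=.
  by rewrite zeta_pull.
rewrite -(splitK j); case: fintype.split => i /=; first by rewrite zeta_mom.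
by rewrite zeta_height.
Qed.

Lemma coord_image : cmap std_chart @` dom std_chart =
  [set x : 'rV[R]_(n + (n + 1)) | (cmap c @` U) (lsubmx x)].
Proof.
apply/seteqP; split=> [_ [q Uq <-]|x [p Up px]].
  by exists (base q) => //=; rewrite /std_coord row_mxKl zE.
pose y := rsubmx x.
exists (existT _ p (\sum_k y 0 k *: std_frame k p) : E) => //=.
rewrite std_frame_sum /std_coord /mom /height /covec /base/= zE// px.
rewrite -[RHS]hsubmxK; congr row_mx; rewrite -/y -[RHS]hsubmxK.
congr row_mx; apply/rowP => i; rewrite !mxE; last first.
  by rewrite (ord1 i).
rewrite dual_sumE (bigD1 i)//= dual_scaleE coframe_frame// eqxx mulr1.
rewrite big1; first by rewrite addr0 /y /rsubmx mxE.
move=> j ij.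
by rewrite dual_scaleE coframe_frame// (negbTE ij) mulr0.
Qed.

End StandardChart.

(** A point is recovered from its base coordinates and its components in the frame.
  Since these components are unique, every vector of components is attained: the
  image of a chart is its image on the base times the whole fibre. *)
Lemma total_good_atlas : good_atlas E.
Proof.
split=> [q|C /total_chartP[c [U [e [[ac [Uc oU]] se eE dC cE]]]]].
  have [c [U [z [X [[ac Uc Up] nU zE cz [sX Xz]]]]]] := proj2 fM (base q).
  have [_ _ [oU _] _ _] := cz.
  exists (std_chart U z X); last exact: Up.
  by apply: (std_chart_atlas (c := c)).
split.
  move=> q q'; rewrite !inE => dq dq' qq'.
  have [l r] := cE q dq; have [l' r'] := cE q' dq'.
  have Uq : U (base q) by move: dq; rewrite dC.
  have Uq' : U (base q') by move: dq'; rewrite dC.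
  have bb' : base q = base q'.
    have [_ /(_ c ac)] := gM; move=> [ic _]; apply: ic; rewrite ?inE; try exact: Uc.
    by rewrite -l -l' qq'.
  move: r r'; rewrite qq'; move: (rsubmx _) => y.
  move: q q' bb' {dq dq' qq' l l' Uq Uq'} => [p u] [p' u']; rewrite /base/= => pp'.
  by subst p' => -> ->.
rewrite (_ : _ @` _ = [set x : 'rV[R]_(n + (n + 1)) | (cmap c @` U) (lsubmx x)]).
  exact: open_lsubmx.
apply/seteqP; split=> [_ [q dq <-]|x [p Up px]].
  have [l _] := cE q dq; exists (base q); last by rewrite -l.
  by move: dq; rewrite dC.
pose y := rsubmx (x : 'rV[R]_(n + (n + 1))).
pose q : E := existT _ p (\sum_k y 0 k *: e k p).
have dq : dom C q by rewrite dC.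
exists q => //; have [l r] := cE q dq.
rewrite -[LHS](hsubmxK (cmap C q : 'rV[R]_(n + (n + 1)))) -[RHS](hsubmxK (x : 'rV[R]_(n + (n + 1)))).
congr row_mx; first by rewrite l.
have [y0 [_ uy]] := eE p Up (projT2 q).
exact: (etrans (esym (uy _ r)) (uy y erefl)).
Qed.

End TotalSpace.

Section TotalCalculus.
Context (R : realType) (M : smoothType R).
Hypothesis fM : framed M.
Let gM : good_atlas M := proj1 fM.
Let tM := framed_dual_frame fM.
Local Notation n := (mdim M).
Local Notation E := (total_space (bnE M)).
Let gE : good_atlas E := total_good_atlas fM.
Local Notation vf := (@smooth_sec R M (TB M)).
Local Notation vfE := (@smooth_sec R E (TB E)).
Local Notation fm := (@smooth_sec R M (cotangent M)).
Local Notation bs := (@smooth_sec R M (bnE M)).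
Implicit Types (p : M) (q : E) (X Y Z : section (TB M)) (f : M -> R) (F : E -> R).

Lemma smooth_pull f : smooth f -> smooth (pull f).
Proof.
by move=> sf; apply/(smoothP gE) => q; apply: (smooth_at_pull); exact: (smooth_smooth_at gM).
Qed.

Lemma smooth_mom Y : vf Y -> smooth (mom Y).
Proof. by move=> sY; apply/(smoothP gE) => q; exact: smooth_at_mom. Qed.

Lemma smooth_height : smooth (@height R M).
Proof. by apply/(smoothP gE) => q; exact: smooth_at_height. Qed.

Section StandardCoordinates.
Context (c : chart R M n) (U : set M) (z : 'I_n -> M -> R) (X : 'I_n -> section (TB M)).
Hypotheses (ac : atlas c) (Uc : U `<=` dom c).
Hypothesis zE : forall p, U p -> tuple_fun z p = cmap c p.
Hypothesis cz : coords_on z U (cmap c @` U).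
Hypothesis sX : forall j, vf (X j).
Hypothesis Xz : forall p, U p -> forall i j, X j p (z i) = (i == j)%:R.

Definition std_image := [set x : 'rV[R]_(n + (n + 1)) | (cmap c @` U) (lsubmx x)].

Lemma coord_in q : U (base q) -> std_image (std_coord z X q).
Proof. by move=> Uq; exists (base q) => //; rewrite /std_coord row_mxKl zE. Qed.

Lemma smooth_zeta k : smooth (zeta z X k).
Proof.
have [sz _ _ _ _] := cz.
apply: (zeta_ind (P := fun F => smooth F)) => [i|i|].
- exact: smooth_pull.
- exact: smooth_mom.
- exact: smooth_height.
Qed.

Lemma open_std_image : open std_image.
Proof. by apply: open_lsubmx; have [_ _ [+ _] _ _] := cz. Qed.

Lemma cutoff_pull q chi : is_cutoff (base q) U chi ->
  is_cutoff q [set q | U (base q)] (pull chi).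
Proof.
move=> [schi chi1 chi0]; split=> //; first exact: smooth_pull.
by move=> q' nU'; exact: near_pt_base (chi0 _ nU').
Qed.

(** Cutoff functions are needed in the base directions only, because the
  coordinate domain contains whole fibres. *)
Lemma total_coords : coords_on (zeta z X) [set q | U (base q)] std_image.
Proof.
have [sz cut [oO cO] _ _] := cz; split.
- exact: smooth_zeta.
- by move=> q /cut[chi cchi]; exists (pull chi); exact: cutoff_pull.
- split; first exact: open_std_image.
  move=> x y t Ox Oy t01; rewrite /std_image /=.
  have -> : lsubmx (seg x y t) = seg (lsubmx x) (lsubmx y) t.
    by apply/rowP => i; rewrite /seg /lsubmx !mxE.
  exact: cO.
- by move=> q Uq; rewrite tuple_zeta; exact: coord_in.
- move=> F sF.
  have aC : atlas (std_chart U z X) by apply: (std_chart_atlas fM (c := c)).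
  have [g [sg gE']] := smooth_chart sF aC.
  exists g; split=> [|q Uq]; last by rewrite tuple_zeta; exact: gE'.
  by move: sg; rewrite (coord_image fM zE).
Qed.

Lemma coord_line p (u w : bnE M p) (h : R) :
  std_coord z X (existT _ p (u + h *: w)) = std_coord z X (existT _ p u) +
  h *: row_mx 0 (row_mx (\row_i (w.1 : dual (tvec p)) (X i p)) (\row_(i < 1) (w.2 : R))).
Proof.
rewrite scale_row_mx scaler0 /std_coord add_row_mx addr0 scale_row_mx add_row_mx.
congr (row_mx _ (row_mx _ _)); apply/rowP => i; rewrite !mxE/=.
  by rewrite /mom /covec/= dual_addE dual_scaleE.
by [].
Qed.

End StandardCoordinates.

(** * Functions on the total space along sections and fibres *)

(** Near a point of the base, F is a smooth function of the coordinates [zeta],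
  and these are smooth along any smooth section. *)
Lemma smooth_along F (s : section (bnE M)) : smooth F -> bs s ->
  smooth (fun p => F (existT _ p (s p))).
Proof.
move=> sF [s1 s2]; apply/(smoothP gM) => p0.
have [c [U [z [X [[ac Uc Up] nU zE cz [sX Xz]]]]]] := proj2 fM p0.
have [_ _ _ _ /(_ F sF)[g [sg gF]]] := total_coords ac Uc zE cz sX Xz.
pose sig p : E := existT _ p (s p).
have szs k : smooth (fun p => zeta z X k (sig p)).
  apply: (zeta_ind (P := fun F => smooth (fun p => F (sig p)))) => [i|i|].
  - by have [sz _ _ _ _] := cz; exact: sz.
  - exact: s1.
  - exact: s2.
apply: (@smooth_at_near _ _ _ (fun p => g (tuple_fun (fun k p => zeta z X k (sig p)) p))).
  by apply: near_pt_sub (nU p0 Up) => p Up'; rewrite (gF (sig p)).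
apply: (smooth_at_comp (O := std_image c U)) => //.
- by move=> k; exact: (smooth_smooth_at gM).
- exact: open_std_image cz.
- have -> : tuple_fun (fun k p => zeta z X k (sig p)) p0 = std_coord z X (sig p0).
    by apply/rowP => k; rewrite mxE.
  exact: coord_in.
Qed.

(** In the coordinates [zeta] a line in a fibre is a line. *)
Lemma derivable_fibre F p (u w : bnE M p) : smooth F ->
  derivable (fun h : R => F (existT _ p (u + h *: w)) : R^o) 0 1.
Proof.
move=> sF.
have [c [U [z [X [[ac Uc Up] nU zE cz [sX Xz]]]]]] := proj2 fM p.
have [_ _ [oO _] _ /(_ F sF)[g [sg gF]]] := total_coords ac Uc zE cz sX Xz.
set k := row_mx 0 (row_mx (\row_i (w.1 : dual (tvec p)) (X i p)) (\row_(i < 1) (w.2 : R))) : 'rV[R]_(n + (n + 1)).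
have -> : (fun h : R => F (existT _ p (u + h *: w)) : R^o) =
    fun h : R => g (std_coord z X (existT _ p u) + h *: k).
  by apply/funext => h; rewrite gF// tuple_zeta coord_line.
have dg : differentiable g (std_coord z X (existT _ p u) + 0 *: k).
  have [+ _] := sg 1%N; apply; rewrite scale0r addr0.
  exact: (@coord_in c U z X zE (existT _ p u) Up).
by have [] := is_derive_line dg.
Qed.

Lemma derive1_affine (a b : R) : derive1 (fun h : R => a + h * b : R^o) 0 = b.
Proof.
have H := is_deriveD (@is_derive_cst R R R a 0 1)
  (@is_deriveM R R id (cst b) 0 1 1 0 (is_derive_id _ _) (is_derive_cst _ _ _)).
rewrite derive1E; have [_] := H.
by rewrite scaler0 !add0r => E; rewrite [LHS]E; exact: mulr1.
Qed.

Lemma vliftE (phi : section (bnE M)) q F : smooth F ->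
  vlift phi q F = derive1 (fun h : R =>
    F (existT _ (projT1 q) (projT2 q + h *: phi (projT1 q))) : R^o) 0.
Proof.
rewrite /vlift; move: q => [p u]; rewrite [projT1 _]/=.
rewrite [projT2 _]/=; apply: (tvec_ofE gE) => [a {}F G sF sG|{}F G sF sG].
  have dF := @derivable_fibre F p u (phi p) sF; have dG := @derivable_fibre G p u (phi p) sG.
  rewrite !derive1E; have := deriveD (@derivableZ _ _ _ _ a _ _ dF) dG.
  by rewrite (@deriveZ _ _ _ _ a _ _ dF); exact.
have dF := @derivable_fibre F p u (phi p) sF; have dG := @derivable_fibre G p u (phi p) sG.
rewrite !derive1E; have := deriveM dF dG => H.
have E0 : u + 0 *: phi p = u by rewrite scale0r addr0.
rewrite E0 in H; rewrite [LHS]H addrC /GRing.scale/=; congr (_ + _).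
exact: mulrC.
Qed.

Lemma vlift_pull phi q f : smooth f -> vlift phi q (pull f) = 0.
Proof.
move=> sf; rewrite vliftE; last exact: smooth_pull.
rewrite (_ : (fun h => _) = fun h : R => f (base q) + h * 0); last first.
  by apply/funext => h; rewrite mulr0 addr0.
exact: derive1_affine.
Qed.

Lemma vlift_mom phi q Y : vf Y ->
  vlift phi q (mom Y) = ((phi (base q)).1 : dual (tvec (base q))) (Y (base q)).
Proof.
move=> sY; rewrite vliftE; last exact: smooth_mom.
rewrite (_ : (fun h => _) = fun h : R => covec q (Y (base q)) +
  h * ((phi (base q)).1 : dual (tvec (base q))) (Y (base q))); last first.
  by apply/funext => h; rewrite /mom /covec /base/= dual_addE dual_scaleE.
exact: derive1_affine.
Qed.

Lemma vlift_height phi q : vlift phi q (@height R M) = (phi (base q)).2.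
Proof.
rewrite vliftE; last exact: smooth_height.
rewrite (_ : (fun h => _) = fun h : R => height q + h * (phi (base q)).2); last first.
  by apply/funext => h; rewrite /height /base/=.
exact: derive1_affine.
Qed.

(** The coordinates of the standard charts are of these three kinds. *)
Lemma total_eq q (v w : tvec q) : (forall f, smooth f -> v (pull f) = w (pull f)) ->
  (forall Y, vf Y -> v (mom Y) = w (mom Y)) ->
  v (@height R M) = w (@height R M) -> v = w.
Proof.
move=> H1 H2 H3.
have [c [U [z [X [[ac Uc Up] nU zE cz [sX Xz]]]]]] := proj2 fM (base q).
have tc := total_coords ac Uc zE cz sX Xz.
apply: (coords_eq gE tc) => //.
apply: (zeta_ind (P := fun F => v F = w F)) => // i; last exact: H2.
by apply: H1; have [sz _ _ _ _] := cz.
Qed.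

(** By [coords_derivation], S F is a combination of the functions S (zeta k) with
  smooth coefficients. *)
Lemma vf_total (S : section (TB E)) : (forall f, smooth f -> smooth (fun q => S q (pull f))) ->
  (forall Y, vf Y -> smooth (fun q => S q (mom Y))) ->
  smooth (fun q => S q (@height R M)) -> vfE S.
Proof.
move=> H1 H2 H3 F sF; apply/(smoothP gE) => q0.
have [c [U [z [X [[ac Uc Up] nU zE cz [sX Xz]]]]]] := proj2 fM (base q0).
have tc := total_coords ac Uc zE cz sX Xz.
have [sz _ [oO _] zO /(_ F sF)[g [sg gF]]] := tc.
apply: (@smooth_at_near _ _ _ (fun q => \sum_k S q (zeta z X k) *
    'D_(bvec k) g (tuple_fun (zeta z X) q))).
  apply: near_pt_sub (near_pt_base (nU _ Up)) => q Uq.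
  exact: (coords_derivation gE (S q) tc Uq sF sg gF).
apply: smooth_at_sum => k; apply: smooth_at_mul.
  apply: (smooth_smooth_at gE).
  apply: (zeta_ind (P := fun F => smooth (fun q => S q F))) => // i; last exact: H2.
  by apply: H1; have [sz' _ _ _ _] := cz.
apply: (@smooth_at_comp _ _ _ (zeta z X) (std_image c U) ('D_(bvec k) g)) => //.
- by move=> i; exact: (smooth_smooth_at gE).
- exact: smooth_derive.
- exact: zO.
Qed.

Lemma vf_vlift phi : bs phi -> vfE (vlift phi).
Proof.
move=> [s1 s2]; apply: vf_total.
- move=> f sf; apply: eq_smooth (smooth_cst gE 0) => q; exact: vlift_pull.
- move=> Y sY; apply: eq_smooth (smooth_pull (s1 Y sY)) => q; exact: vlift_mom.
- apply: eq_smooth (smooth_pull s2) => q; exact: vlift_height.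
Qed.

(** The combination of the frame dz_i, 1 with constant coefficients. *)
Lemma section_through q : exists2 s, bs s & s (base q) = projT2 q.
Proof.
have [c [U [z [X [[ac Uc Up] nU zE cz [sX Xz]]]]]] := proj2 fM (base q).
exists (fun p => (\sum_i covec q (X i (base q)) *: differential (z i) p, height q : R^o)).
  split=> /=; last exact: smooth_cst.
  move=> Y sY; have sz : forall i, smooth (z i) by have [+ _ _ _ _] := cz.
  have sF i : smooth (fun p => covec q (X i (base q)) * Y p (z i)).
    exact: (smooth_mul gM (smooth_cst gM _) (sY _ (sz i))).
  apply: eq_smooth (smooth_sum gM sF) => p; rewrite dual_sumE.
  by apply: eq_bigr => i _; rewrite dual_scaleE (differentialE gM tM).
rewrite [RHS]surjective_pairing; congr pair.
by rewrite -(coframe_expand fM cz Xz (covec q) Up).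
Qed.

End TotalCalculus.

#[local] Opaque tvec_of covec_of lie vlift.

(** * Horizontal lift by the connection nabla^J *)

Section HorizontalLift.
Context (R : realType) (M : smoothType R).
Hypothesis fM : framed M.
Let gM : good_atlas M := proj1 fM.
Let tM := framed_dual_frame fM.
Local Notation n := (mdim M).
Local Notation E := (total_space (bnE M)).
Let gE : good_atlas E := total_good_atlas fM.
Local Notation vf := (@smooth_sec R M (TB M)).
Local Notation vfE := (@smooth_sec R E (TB E)).
Local Notation fm := (@smooth_sec R M (cotangent M)).
Local Notation bs := (@smooth_sec R M (bnE M)).
Implicit Types (p : M) (q : E) (X Y Z : section (TB M)) (f : M -> R) (F : E -> R).

Variables (J : endo M) (nabla : connection_op (TB M)).
Hypothesis sJ : forall X, vf X -> vf (fun p => J p (X p)).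
Hypothesis Hn : is_connection nabla.
Let D := nablaJ J nabla.

(** The vector that the characterisation of the horizontal lift prescribes at q
  when it is tested on a single section s through q. *)
Definition hlift_along X (s : section (bnE M)) q : tvec q := tvec_of q (fun F =>
  X (base q) (fun p => F (existT _ p (s p))) - vlift (D X s) q F).

Lemma hlift_alongE X s q F : bs s -> s (base q) = projT2 q -> smooth F ->
  hlift_along X s q F = X (base q) (fun p => F (existT _ p (s p))) - vlift (D X s) q F.
Proof.
move=> ss sq; apply: (tvec_ofE gE) => [a {}F G sF sG|{}F G sF sG].
  rewrite (tv_lin _ _ sF sG) (tv_lin _ _ (smooth_along fM sF ss) (smooth_along fM sG ss)).
  ring.
have e H : H (existT _ (base q) (s (base q)) : E) = H q :> R.
  by rewrite sq /base; case: (q).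
rewrite (tv_mul _ sF sG) (tv_mul _ (smooth_along fM sF ss) (smooth_along fM sG ss)).
rewrite !e; ring.
Qed.

Lemma hlift_along_pull X s q f : bs s -> s (base q) = projT2 q -> smooth f ->
  hlift_along X s q (pull f) = X (base q) f.
Proof.
move=> ss sq sf; rewrite hlift_alongE//; last exact: smooth_pull.
by rewrite vlift_pull// subr0.
Qed.

Lemma hlift_along_mom X s q Y : vf X -> bs s -> s (base q) = projT2 q -> vf Y ->
  hlift_along X s q (mom Y) = mom (nabla X Y) q.
Proof.
move=> sX ss sq sY; rewrite hlift_alongE//; last exact: smooth_mom.
rewrite vlift_mom// /D /nablaJ/= (dual_connectionE gM tM Hn)//; last by case: ss.
rewrite opprB addrCA subrr addr0 /mom /covec.
by rewrite -sq.
Qed.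

Lemma hlift_along_height X s q : vf X -> bs s -> s (base q) = projT2 q ->
  hlift_along X s q (@height R M) = - mom (fun p => J p (X p)) q.
Proof.
move=> sX ss sq; rewrite hlift_alongE//; last exact: smooth_height.
rewrite vlift_height// /D /nablaJ/= opprD addrA subrr sub0r /mom /covec.
by rewrite -sq.
Qed.

(** On each of the three kinds of generating functions the value involves s only
  through the point q = s(p): the derivative of s in the direction X occurs in
  both terms of the difference and cancels. *)
Lemma hlift_along_indep X s s' q : vf X -> bs s -> s (base q) = projT2 q ->
  bs s' -> s' (base q) = projT2 q -> hlift_along X s q = hlift_along X s' q.
Proof.
move=> sX ss sq ss' sq'; apply: (total_eq fM) => [f sf|Y sY|].
- exact: (etrans (hlift_along_pull X ss sq sf) (esym (hlift_along_pull X ss' sq' sf))).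
- exact: (etrans (hlift_along_mom sX ss sq sY) (esym (hlift_along_mom sX ss' sq' sY))).
- exact: (etrans (hlift_along_height sX ss sq) (esym (hlift_along_height sX ss' sq'))).
Qed.

Lemma hlift_alongP X s q : vf X -> bs s -> s (base q) = projT2 q ->
  hlift D X q = hlift_along X s q.
Proof.
move=> sX ss sq.
have : [set v : tvec q | forall s : section (bnE M), bs s ->
   s (projT1 q) = projT2 q -> forall F, smooth F ->
   v F = X (projT1 q) (fun p => F (existT _ p (s p))) - vlift (D X s) q F] (hlift D X q).
  apply: (@xgetPex _ (0 : tvec q)); exists (hlift_along X s q) => s' ss' sq' F sF.
  by rewrite (hlift_along_indep sX ss sq ss' sq') (hlift_alongE X ss' sq' sF).
move=> H; apply: tvec_eq => F sF; rewrite (hlift_alongE X ss sq sF).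
exact: H.
Qed.

(** The lifts are used from here on only through their action on the generating
  functions.  Both are choice terms over large types; the opaque proof of the
  equality with them prevents unification from ever unfolding these. *)
Fact hor_lift_key : {h : section (TB M) -> section (TB E) | h = hlift D}.
Proof. by exists (hlift D). Qed.
Definition hor_lift := sval hor_lift_key.
Lemma hor_liftE : hor_lift = hlift D.
Proof. exact: (svalP hor_lift_key). Qed.

Fact vert_lift_key : {h : section (bnE M) -> section (TB E) | h = @vlift R M (bnE M)}.
Proof. by exists (@vlift R M (bnE M)). Qed.
Definition vert_lift := sval vert_lift_key.
Lemma vert_liftE : vert_lift = @vlift R M (bnE M).
Proof. exact: (svalP vert_lift_key). Qed.

Lemma vert_lift_pull phi q f : smooth f -> vert_lift phi q (pull f) = 0.
Proof. by rewrite vert_liftE; exact: vlift_pull. Qed.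

Lemma vert_lift_mom phi q Y : vf Y ->
  vert_lift phi q (mom Y) = ((phi (base q)).1 : dual (tvec (base q))) (Y (base q)).
Proof. by rewrite vert_liftE; exact: vlift_mom. Qed.

Lemma vert_lift_height phi q : vert_lift phi q (@height R M) = (phi (base q)).2.
Proof. by rewrite vert_liftE; exact: vlift_height. Qed.

Lemma vf_vert_lift phi : bs phi -> vfE (vert_lift phi).
Proof. by rewrite vert_liftE; exact: vf_vlift. Qed.

Lemma hor_lift_pull X q f : vf X -> smooth f -> hor_lift X q (pull f) = X (base q) f.
Proof.
move=> sX sf; have [s ss sq] := section_through fM q.
by rewrite hor_liftE (hlift_alongP sX ss sq) (hlift_along_pull X ss sq sf).
Qed.

Lemma hor_lift_mom X q Y : vf X -> vf Y -> hor_lift X q (mom Y) = mom (nabla X Y) q.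
Proof.
move=> sX sY; have [s ss sq] := section_through fM q.
by rewrite hor_liftE (hlift_alongP sX ss sq) (hlift_along_mom sX ss sq sY).
Qed.

Lemma hor_lift_height X q : vf X ->
  hor_lift X q (@height R M) = - mom (fun p => J p (X p)) q.
Proof.
move=> sX; have [s ss sq] := section_through fM q.
by rewrite hor_liftE (hlift_alongP sX ss sq) (hlift_along_height sX ss sq).
Qed.

Lemma vf_nabla X Y : vf X -> vf Y -> vf (nabla X Y).
Proof. by case: Hn => + _ _ _ _; exact. Qed.

Lemma vf_hor_lift X : vf X -> vfE (hor_lift X).
Proof.
move=> sX; apply: (vf_total fM).
- move=> f sf; apply: eq_smooth (smooth_pull fM (sX f sf)) => q; exact: hor_lift_pull.
- move=> Y sY; apply: eq_smooth (smooth_mom fM (vf_nabla sX sY)) => q; exact: hor_lift_mom.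
- apply: eq_smooth (smooth_opp gE (smooth_mom fM (sJ sX))) => q; exact: hor_lift_height.
Qed.

Lemma phi_liftE a : phi_lift D a =
  fun q => hor_lift (fun p => (a p).1) q + vert_lift (fun p => (a p).2) q.
Proof. by rewrite hor_liftE vert_liftE. Qed.

Lemma vf_phi_lift a : @smooth_sec R M (bn_bundle M) a -> vfE (phi_lift D a).
Proof.
move=> [a1 a2]; rewrite phi_liftE.
exact: (vf_add gE (vf_hor_lift a1) (vf_vert_lift a2)).
Qed.

Lemma hor_lift0 q : hor_lift (fun=> 0) q = 0.
Proof.
have s0 := vf_zero gM.
have n0 Y p : vf Y -> nabla (fun=> 0) Y p = 0.
  have [_ _ nZ _ _] := Hn => sY; have := nZ (fun=> 0) (fun=> 0) Y (smooth_cst gM 0) s0 sY p.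
  rewrite scale0r => <-; congr (nabla _ Y p).
  by apply: functional_extensionality_dep => p'; rewrite scaler0.
apply: (total_eq fM) => [f sf|Y sY|].
- by rewrite hor_lift_pull.
- by rewrite hor_lift_mom// /mom n0// dual0.
- by rewrite hor_lift_height// /mom linear0 dual0 oppr0.
Qed.

Lemma vert_lift0 q : vert_lift (fun=> 0 : bnE M _) q = 0.
Proof.
apply: (total_eq fM) => [f sf|Y sY|].
- by rewrite vert_lift_pull.
- by rewrite vert_lift_mom.
- by rewrite vert_lift_height.
Qed.

(** * Curvature of the connection, seen on the generating functions *)

Lemma hor_lift_comm_pull X Y q f : vf X -> vf Y -> smooth f ->
  hor_lift X q (fun q => hor_lift Y q (pull f)) - hor_lift Y q (fun q => hor_lift X q (pull f))
  = hor_lift (lie X Y) q (pull f).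
Proof.
move=> sX sY sf.
have H V : vf V -> (fun q => hor_lift V q (pull f)) = pull (fun p => V p f).
  move=> sV; apply/funext => q'; rewrite (hor_lift_pull q' sV sf); reflexivity.
have HXY : hor_lift X q (fun q => hor_lift Y q (pull f)) = X (base q) (fun p => Y p f).
  exact: (etrans (congr1 (fun G => hor_lift X q G) (H _ sY)) (hor_lift_pull q sX (sY f sf))).
have HYX : hor_lift Y q (fun q => hor_lift X q (pull f)) = Y (base q) (fun p => X p f).
  exact: (etrans (congr1 (fun G => hor_lift Y q G) (H _ sX)) (hor_lift_pull q sY (sX f sf))).
rewrite HXY HYX (hor_lift_pull q (vf_lie gM sX sY) sf) (lieE gM _ sX sY sf); reflexivity.
Qed.

(** The momenta see the curvature of nabla. *)
Lemma hor_lift_comm_mom X Y Z q : vf X -> vf Y -> vf Z ->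
  hor_lift X q (fun q => hor_lift Y q (mom Z)) - hor_lift Y q (fun q => hor_lift X q (mom Z))
  - hor_lift (lie X Y) q (mom Z)
  = covec q (nabla X (nabla Y Z) (base q) - nabla Y (nabla X Z) (base q)
             - nabla (lie X Y) Z (base q)).
Proof.
move=> sX sY sZ.
have H V : vf V -> (fun q => hor_lift V q (mom Z)) = mom (nabla V Z).
  move=> sV; apply/funext => q'; rewrite (hor_lift_mom q' sV sZ); reflexivity.
have HXY : hor_lift X q (fun q => hor_lift Y q (mom Z)) = mom (nabla X (nabla Y Z)) q.
  exact: (etrans (congr1 (fun G => hor_lift X q G) (H _ sY)) (hor_lift_mom q sX (vf_nabla sY sZ))).
have HYX : hor_lift Y q (fun q => hor_lift X q (mom Z)) = mom (nabla Y (nabla X Z)) q.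
  exact: (etrans (congr1 (fun G => hor_lift Y q G) (H _ sX)) (hor_lift_mom q sY (vf_nabla sX sZ))).
rewrite HXY HYX (hor_lift_mom q (vf_lie gM sX sY) sZ) !dualB; reflexivity.
Qed.

(** The height sees d^nabla J: horizontal fields send it to a momentum, and then
  act on this momentum through nabla. *)
Lemma hor_lift_comm_height X Y q : vf X -> vf Y ->
  hor_lift X q (fun q => hor_lift Y q (@height R M))
  - hor_lift Y q (fun q => hor_lift X q (@height R M))
  - hor_lift (lie X Y) q (@height R M)
  = - covec q (d_nabla nabla J X Y (base q)).
Proof.
move=> sX sY.
have H V : vf V -> (fun q => hor_lift V q (@height R M)) =
    fun q => - mom (fun p => J p (V p)) q.
  move=> sV; apply/funext => q'; rewrite (hor_lift_height q' sV); reflexivity.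
have sm V : vf V -> smooth (mom (fun p => J p (V p))).
  by move=> sV; exact: (smooth_mom fM (sJ sV)).
have HXY : hor_lift X q (fun q => hor_lift Y q (@height R M)) =
    - mom (nabla X (fun p => J p (Y p))) q.
  apply: (etrans (congr1 (fun G => hor_lift X q G) (H _ sY))).
  rewrite (tv_opp gE _ (sm _ sY)) (hor_lift_mom q sX (sJ sY)); reflexivity.
have HYX : hor_lift Y q (fun q => hor_lift X q (@height R M)) =
    - mom (nabla Y (fun p => J p (X p))) q.
  apply: (etrans (congr1 (fun G => hor_lift Y q G) (H _ sX))).
  rewrite (tv_opp gE _ (sm _ sX)) (hor_lift_mom q sY (sJ sX)); reflexivity.
rewrite HXY HYX (hor_lift_height q (vf_lie gM sX sY)) /d_nabla !dualB /mom; ring.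
Qed.

(** * The lifts of sections generate the vector fields on the total space *)

Section Frame.
Context (c : chart R M n) (U : set M) (z : 'I_n -> M -> R) (X : 'I_n -> section (TB M)).
Hypotheses (ac : atlas c) (Uc : U `<=` dom c).
Hypothesis zE : forall p, U p -> tuple_fun z p = cmap c p.
Hypothesis cz : coords_on z U (cmap c @` U).
Hypothesis sX : forall j, vf (X j).
Hypothesis Xz : forall p, U p -> forall i j, X j p (z i) = (i == j)%:R.

Let sz i : smooth (z i). Proof. by have [+ _ _ _ _] := cz. Qed.

Definition vert_cov (j : 'I_n) : section (bnE M) := fun p => (differential (z j) p, 0 : R^o).
Definition vert_one : section (bnE M) := fun p => (0 : dual (tvec p), 1 : R^o).

Lemma bs_vert_cov j : bs (vert_cov j).
Proof. by split; [exact: differential_smooth|exact: (smooth_cst gM 0)]. Qed.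

Lemma bs_vert_one : bs vert_one.
Proof. by split=> [Y sY|]; exact: smooth_cst. Qed.

(** The horizontal lift of X i, corrected by vertical fields so that it kills the
  fibre coordinates: these fields and the vertical ones are dual to [zeta]. *)
Definition hor (i : 'I_n) : section (TB E) := fun q =>
  hor_lift (X i) q +
  (\sum_j (- mom (nabla (X i) (X j)) q) *: vert_lift (vert_cov j) q +
   mom (fun p => J p (X i p)) q *: vert_lift vert_one q).

Definition total_frame (k : 'I_(n + (n + 1))) : section (TB E) :=
  match fintype.split k with
  | inl i => hor i
  | inr k' => match fintype.split k' with
              | inl j => vert_lift (vert_cov j)
              | inr _ => vert_lift vert_one
              end
  end.

Lemma vert_cov_mom j q Y : vf Y ->
  vert_lift (vert_cov j) q (mom Y) = Y (base q) (z j).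
Proof. by move=> sY; rewrite vert_lift_mom// /vert_cov/= (differentialE gM tM). Qed.

Lemma vert_cov_height j q : vert_lift (vert_cov j) q (@height R M) = 0.
Proof. by rewrite vert_lift_height. Qed.

Lemma vert_one_mom q Y : vf Y -> vert_lift vert_one q (mom Y) = 0.
Proof. by move=> sY; rewrite vert_lift_mom. Qed.

Lemma vert_one_height q : vert_lift vert_one q (@height R M) = 1.
Proof. by rewrite vert_lift_height. Qed.

Lemma hor_pull i q l : U (base q) -> hor i q (pull (z l)) = (l == i)%:R.
Proof.
move=> Uq; rewrite !tvecD hor_lift_pull// Xz// tvecZ vert_lift_pull// mulr0 addr0.
rewrite tvec_sum big1 ?addr0// => j _.
by rewrite tvecZ vert_lift_pull// mulr0.
Qed.

Lemma hor_mom i q l : U (base q) -> hor i q (mom (X l)) = 0.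
Proof.
move=> Uq; rewrite !tvecD hor_lift_mom// tvecZ vert_one_mom// mulr0 addr0.
rewrite tvec_sum (bigD1 l)//= tvecZ vert_cov_mom// Xz// eqxx.
rewrite mulr1 big1 ?addr0 ?subrr// => j jl.
by rewrite tvecZ vert_cov_mom// Xz// (negbTE jl) mulr0.
Qed.

Lemma hor_height i q : hor i q (@height R M) = 0.
Proof.
rewrite !tvecD hor_lift_height// tvecZ vert_one_height mulr1.
rewrite tvec_sum big1 ?add0r ?addNr// => j _.
by rewrite tvecZ vert_cov_height mulr0.
Qed.

Lemma total_frame_zeta k l q : U (base q) ->
  total_frame k q (zeta z X l) = (l == k)%:R.
Proof.
move=> Uq; rewrite -(splitK k) /total_frame unsplitK -(splitK l).
case: (fintype.split k) => [i|k'] /=; case: (fintype.split l) => [i'|l'] /=.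
- by rewrite eq_lshift zeta_pull hor_pull.
- rewrite eq_rlshift -(splitK l').
  case: (fintype.split l') => j /=.
    by rewrite zeta_mom hor_mom.
  by rewrite zeta_height hor_height.
- rewrite eq_lrshift zeta_pull; case: (fintype.split k') => j.
    by rewrite vert_lift_pull.
  by rewrite vert_lift_pull.
- rewrite eq_rshift -{2}(splitK k') -(splitK l').
  case: (fintype.split k') => j /=; case: (fintype.split l') => j' /=.
  + by rewrite eq_lshift zeta_mom vert_cov_mom// Xz// eq_sym.
  + by rewrite eq_rlshift zeta_height vert_cov_height.
  + by rewrite eq_lrshift zeta_mom vert_one_mom.
  + by rewrite eq_rshift zeta_height vert_one_height !ord1.
Qed.

Lemma smooth_hor_coef i j : smooth (fun q => - mom (nabla (X i) (X j)) q).
Proof. by apply: (smooth_opp gE); apply: (smooth_mom fM); exact: vf_nabla. Qed.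

Lemma vf_hor_vert i : vfE (fun q =>
  \sum_j (- mom (nabla (X i) (X j)) q) *: vert_lift (vert_cov j) q).
Proof.
apply: (vf_sum gE (F := fun j q => (- mom (nabla (X i) (X j)) q) *: vert_lift (vert_cov j) q)) => j.
exact: (vf_scale gE (smooth_hor_coef i j) (vf_vert_lift (bs_vert_cov j))).
Qed.

Lemma vf_hor i : vfE (hor i).
Proof.
apply: (vf_add gE (vf_hor_lift (sX i))); apply: (vf_add gE (vf_hor_vert i)).
exact: (vf_scale gE (smooth_mom fM (sJ (sX i))) (vf_vert_lift bs_vert_one)).
Qed.

Lemma vf_total_frame k : vfE (total_frame k).
Proof.
rewrite /total_frame; case: fintype.split => [i|k']; first exact: vf_hor.
case: fintype.split => j; apply: (vf_vert_lift).
  exact: bs_vert_cov.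
exact: bs_vert_one.
Qed.

Lemma total_frame_expand chi q0 q (v : tvec q) : is_cutoff (base q0) U chi ->
  pull chi q *: v = \sum_k (pull chi q * v (zeta z X k)) *: total_frame k q.
Proof.
move=> cchi; have [Uq|nUq] := pselect (U (base q)); last first.
  rewrite /pull (cutoff_out gM cchi nUq) scale0r big1// => i _.
  by rewrite mul0r scale0r.
under eq_bigr do rewrite -scalerA.
rewrite -scaler_sumr; congr (_ *: _).
apply: (coords_eq gE (total_coords fM ac Uc zE cz sX Xz)) => // l.
rewrite tvec_sum (bigD1 l)//= tvecZ total_frame_zeta// eqxx mulr1.
rewrite big1 ?addr0// => k kl.
by rewrite tvecZ total_frame_zeta// eq_sym (negbTE kl) mulr0.
Qed.

End Frame.

Lemma total_dual_frame q : has_dual_frame q.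
Proof.
have [c [U [z [X [[ac Uc Up] nU zE cz [sX Xz]]]]]] := proj2 fM (base q).
have [_ /(_ _ Up)[chi cchi] _ _ _] := cz; have [schi chi1 _] := cchi.
exists _, (zeta z X), (total_frame z X), (pull chi); split.
- exact: smooth_zeta cz sX.
- exact: vf_total_frame cz sX.
- exact: smooth_pull.
- exact: chi1.
- by move=> q' v; exact: (total_frame_expand ac Uc zE cz sX Xz v cchi).
Qed.

(** The fields of [total_frame] are combinations of lifts with smooth
  coefficients, hence so is a cutoff function times any vector field. *)
Lemma lift_tensor_vanish (W : lmodType R) q (Phi : section (TB E) -> W) :
  tensor_at q Phi ->
  (forall a, @smooth_sec R M (bn_bundle M) a -> Phi (phi_lift D a) = 0) ->
  forall S, vfE S -> Phi S = 0.
Proof.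
move=> tPhi H0 S sS.
have [c [U [z [X [[ac Uc Up] nU zE cz [sX Xz]]]]]] := proj2 fM (base q).
have [_ /(_ _ Up)[chi cchi] _ _ _] := cz; have [schi chi1 _] := cchi.
have [PhiD PhiZ] := tPhi.
rewrite (tensor_frame gE (smooth_zeta fM cz sX) (vf_total_frame cz sX)
  (smooth_pull fM schi) chi1 _ tPhi sS); last first.
  by move=> q' v; exact: (total_frame_expand ac Uc zE cz sX Xz v cchi).
have Hv phi : bs phi -> Phi (vert_lift phi) = 0.
  move=> sphi; rewrite -(H0 (fun p => (0, phi p))); last first.
    by split=> //; exact: (vf_zero gM).
  congr Phi; apply: functional_extensionality_dep => q'.
  by rewrite phi_liftE hor_lift0 add0r.
have Hh Y : vf Y -> Phi (hor_lift Y) = 0.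
  move=> sY; rewrite -(H0 (fun p => (Y p, 0))); last first.
    by split=> //; split=> [Z sZ|]; exact: (smooth_cst gM 0).
  congr Phi; apply: functional_extensionality_dep => q'.
  by rewrite phi_liftE vert_lift0 addr0.
apply: big1 => k _; rewrite [Phi _](_ : _ = 0) ?scaler0// /total_frame.
have H1 := Hv _ bs_vert_one; have H2 j := Hv _ (bs_vert_cov cz j).
case: fintype.split => [i|k']; last by case: fintype.split.
have sE := smooth_mom fM (sJ (sX i)).
have sA := vf_hor_lift (sX i); have sB := vf_hor_vert cz sX i.
have sC := vf_scale gE sE (vf_vert_lift bs_vert_one).
rewrite /hor (PhiD _ _ sA (vf_add gE sB sC)) (PhiD _ _ sB sC).
rewrite (PhiZ _ _ sE (vf_vert_lift bs_vert_one)) H1 scaler0 addr0 (Hh _ (sX i)) add0r.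
rewrite (tensor_sum gE (F := fun j q => - mom (nabla (X i) (X j)) q)
  (B := fun j => vert_lift (vert_cov z j)) tPhi).
- by apply: big1 => j _; rewrite H2 scaler0.
- by move=> j; exact: smooth_hor_coef.
- by move=> j; exact: (vf_vert_lift (bs_vert_cov cz j)).
Qed.

End HorizontalLift.

#[local] Opaque lie_form differential.

(** * The B_n-Courant algebroid is a Courant algebroid *)

Section BnCourant.
Context (R : realType) (M : smoothType R).
Hypothesis fM : framed M.
Let gM : good_atlas M := proj1 fM.
Let tM := framed_dual_frame fM.
Local Notation vf := (@smooth_sec R M (TB M)).
Local Notation fm := (@smooth_sec R M (cotangent M)).
Local Notation bns := (@smooth_sec R M (bn_bundle M)).
Implicit Types (p : M) (X Y Z W V : section (TB M)) (f g h : M -> R).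
Implicit Types (al be ga : section (cotangent M)).

Definition bn_sec X al f : section (bn_bundle M) :=
  fun p => (X p, (al p, f p : R^o)).

Lemma bn_sec_smooth X al f : vf X -> fm al -> smooth f -> bns (bn_sec X al f).
Proof. by move=> sX sal sf; split. Qed.

Lemma bn_secP (a : section (bn_bundle M)) : bns a ->
  exists X al f, [/\ vf X, fm al, smooth f & a = bn_sec X al f].
Proof.
move=> [a1 [a2 a3]]; exists (fun p => (a p).1), (fun p => (a p).2.1), (fun p => (a p).2.2).
split=> //; apply: functional_extensionality_dep => p.
by rewrite /bn_sec; case: (a p) => ? [].
Qed.

Definition bracket_form X al f Y be g : section (cotangent M) := fun p =>
  lie_form X be p - covec_of (d_form al Y) p + g p *: differential f p.

Lemma bn_bracketE X al f Y be g : bn_bracket (bn_sec X al f) (bn_sec Y be g) =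
  bn_sec (lie X Y) (bracket_form X al f Y be g) (fun p => X p g - Y p f).
Proof. by []. Qed.

Lemma bracket_formE X al f Y be g W p : vf X -> vf Y -> vf W -> fm al -> fm be ->
  smooth f -> smooth g ->
  bracket_form X al f Y be g p (W p) =
  X p (fun q => be q (W q)) - be p (lie X W p)
  - (Y p (fun q => al q (W q)) - W p (fun q => al q (Y q)) - al p (lie Y W p))
  + g p * W p f.
Proof.
move=> sX sY sW sal sbe sf sg.
rewrite dual_addE dual_subE dual_scaleE (lie_formE gM tM _ sX sbe sW).
rewrite (d_formE gM tM _ sal sY sW) (differentialE gM tM _ sf); reflexivity.
Qed.

Lemma bracket_form_smooth X al f Y be g : vf X -> vf Y -> fm al -> fm be ->
  smooth f -> smooth g -> fm (bracket_form X al f Y be g).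
Proof.
move=> sX sY sal sbe sf sg W sW.
apply: eq_smooth (smooth_add gM (smooth_sub gM (lie_form_smooth gM tM sX sbe sW)
  (d_form_smooth gM tM sal sY sW)) (smooth_mul gM sg (differential_smooth gM tM sf sW))) => p.
by rewrite dual_addE dual_subE dual_scaleE.
Qed.

Lemma bn_bracket_smooth a b : bns a -> bns b -> bns (bn_bracket a b).
Proof.
move=> /bn_secP[X [al [f [sX sal sf ->]]]] /bn_secP[Y [be [g [sY sbe sg ->]]]].
rewrite bn_bracketE; apply: bn_sec_smooth.
- exact: vf_lie.
- exact: bracket_form_smooth.
- exact: (smooth_sub gM (sX _ sg) (sY _ sf)).
Qed.

Lemma bn_pair_secE X al f Y be g :
  pair_sec (bn_courant M) (bn_sec X al f) (bn_sec Y be g) =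
  fun p => al p (Y p) + be p (X p) + f p * g p.
Proof. by []. Qed.

Lemma bn_pair_smooth a b : bns a -> bns b -> smooth (pair_sec (bn_courant M) a b).
Proof.
move=> /bn_secP[X [al [f [sX sal sf ->]]]] /bn_secP[Y [be [g [sY sbe sg ->]]]].
rewrite bn_pair_secE.
exact: (smooth_add gM (smooth_add gM (sal _ sY) (sbe _ sX)) (smooth_mul gM sf sg)).
Qed.

(** The one-form components are compared on an arbitrary vector field, where they
  are expanded with the formulas of Cartan. *)
Lemma bn_Ca1 a b p : bns a -> bns b ->
  bn_bracket a b p + bn_bracket b a p =
  (0, (differential (pair_sec (bn_courant M) a b) p, 0 : R^o)).
Proof.
move=> sa sb; have spab := bn_pair_smooth sa sb.
move: sa sb spab => /bn_secP[X [al [f [sX sal sf ->]]]] /bn_secP[Y [be [g [sY sbe sg ->]]]] spab.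
rewrite !bn_bracketE /bn_sec; congr (_, (_, _)).
- by rewrite /= (lieC gM _ sX sY) addNr.
- apply: (dual_tvec_eq gM tM) => Z sZ.
  rewrite /= dual_addE (bracket_formE p sX sY sZ)// (bracket_formE p sY sX sZ)//.
  rewrite (differentialE gM tM _ spab) bn_pair_secE.
  rewrite (tv_add _ (smooth_add gM (sal _ sY) (sbe _ sX)) (smooth_mul gM sf sg)).
  rewrite (tv_add _ (sal _ sY) (sbe _ sX)) (tv_mul _ sf sg); ring.
- by rewrite /=; transitivity (X p g - Y p f + (Y p f - X p g)) => //; ring.
Qed.

Lemma bn_Ca2 a b c p : bns a -> bns b -> bns c ->
  (a p).1 (pair_sec (bn_courant M) b c) =
  pair_sec (bn_courant M) (bn_bracket a b) c p + pair_sec (bn_courant M) b (bn_bracket a c) p.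
Proof.
move=> /bn_secP[X [al [f [sX sal sf ->]]]] /bn_secP[Y [be [g [sY sbe sg ->]]]].
move=> /bn_secP[Z [ga [h [sZ sga sh ->]]]].
rewrite !bn_bracketE !bn_pair_secE /bn_sec/=.
rewrite (tv_add _ (smooth_add gM (sbe _ sZ) (sga _ sY)) (smooth_mul gM sg sh)).
rewrite (tv_add _ (sbe _ sZ) (sga _ sY)) (tv_mul _ sg sh).
rewrite (bracket_formE p sX sY sZ)// (bracket_formE p sX sZ sY)// (lieC gM _ sY sZ) dualN.
ring.
Qed.

Lemma derive_bracket_form X al f Y be g W V p : vf X -> vf Y -> vf W -> vf V ->
  fm al -> fm be -> smooth f -> smooth g ->
  V p (fun q => bracket_form X al f Y be g q (W q)) =
  V p (fun r => X r (fun q => be q (W q))) - V p (fun q => be q (lie X W q))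
  - (V p (fun r => Y r (fun q => al q (W q))) - V p (fun r => W r (fun q => al q (Y q)))
     - V p (fun q => al q (lie Y W q)))
  + (V p g * W p f + g p * V p (fun q => W q f)).
Proof.
move=> sX sY sW sV sal sbe sf sg.
have s1 := sX _ (sbe _ sW); have s2 := sbe _ (vf_lie gM sX sW).
have s3 := sY _ (sal _ sW); have s4 := sW _ (sal _ sY).
have s5 := sal _ (vf_lie gM sY sW); have s6 := sW _ sf.
have H : (fun q => bracket_form X al f Y be g q (W q)) = (fun r =>
  X r (fun q => be q (W q)) - be r (lie X W r)
  - (Y r (fun q => al q (W q)) - W r (fun q => al q (Y q)) - al r (lie Y W r))
  + g r * W r f) by apply/funext => q; exact: bracket_formE.
apply: (etrans (congr1 (fun G => V p G) H)).
rewrite (tv_add _ (smooth_sub gM (smooth_sub gM s1 s2) (smooth_sub gM (smooth_sub gM s3 s4) s5))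
  (smooth_mul gM sg s6)).
rewrite (tv_sub gM _ (smooth_sub gM s1 s2) (smooth_sub gM (smooth_sub gM s3 s4) s5)).
rewrite (tv_sub gM _ s1 s2) (tv_sub gM _ (smooth_sub gM s3 s4) s5) (tv_sub gM _ s3 s4).
rewrite (tv_mul _ sg s6); reflexivity.
Qed.

(** After expansion, the terms with two derivatives cancel by the definition of
  the Lie bracket and those with two brackets by the Jacobi identity. *)
Lemma bn_Ca3 a b c p : bns a -> bns b -> bns c ->
  bn_bracket a (bn_bracket b c) p =
  bn_bracket (bn_bracket a b) c p + bn_bracket b (bn_bracket a c) p.
Proof.
move=> /bn_secP[X [al [f [sX sal sf ->]]]] /bn_secP[Y [be [g [sY sbe sg ->]]]].
move=> /bn_secP[Z [ga [h [sZ sga sh ->]]]].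
have sXY := vf_lie gM sX sY; have sXZ := vf_lie gM sX sZ; have sYZ := vf_lie gM sY sZ.
have sXg := sX _ sg; have sYf := sY _ sf; have sXh := sX _ sh; have sZf := sZ _ sf.
have sYh := sY _ sh; have sZg := sZ _ sg.
have k1 := smooth_sub gM sXg sYf; have k2 := smooth_sub gM sXh sZf.
have k3 := smooth_sub gM sYh sZg.
have F1 := bracket_form_smooth sX sY sal sbe sf sg.
have F2 := bracket_form_smooth sX sZ sal sga sf sh.
have F3 := bracket_form_smooth sY sZ sbe sga sg sh.
rewrite !bn_bracketE /bn_sec; congr (_, (_, _)).
- exact: (lie_jacobi gM).
- apply: (dual_tvec_eq gM tM) => W sW.
  have sXW := vf_lie gM sX sW; have sYW := vf_lie gM sY sW; have sZW := vf_lie gM sZ sW.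
  rewrite [RHS]dual_addE.
  rewrite (bracket_formE p sX sYZ sW sal F3 sf k3).
  rewrite (bracket_formE p sXY sZ sW F1 sga k1 sh).
  rewrite (bracket_formE p sY sXZ sW sbe F2 sg k2).
  rewrite (derive_bracket_form p sY sZ sW sX sbe sga sg sh).
  rewrite (derive_bracket_form p sX sY sW sZ sal sbe sf sg).
  rewrite (derive_bracket_form p sX sY sZ sW sal sbe sf sg).
  rewrite (derive_bracket_form p sX sZ sW sY sal sga sf sh).
  rewrite (bracket_formE p sY sZ sXW sbe sga sg sh).
  rewrite (bracket_formE p sX sY sZW sal sbe sf sg).
  rewrite (bracket_formE p sX sZ sYW sal sga sf sh).
  rewrite (tv_sub gM (W p) sXg sYf).
  rewrite (lieE gM p sX sY (sga _ sW)) (lieE gM p sX sZ (sbe _ sW)) (lieE gM p sY sZ (sal _ sW)).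
  rewrite (lieE gM p sX sW (sbe _ sZ)) (lieE gM p sZ sW (sal _ sY)) (lieE gM p sY sW (sal _ sZ)).
  rewrite (lieE gM p sX sW sg) (lieE gM p sY sW sf) (lieE gM p sZ sW sf).
  rewrite (lie_jacobi gM p sX sY sW) (lie_jacobi gM p sX sZ sW) (lie_jacobi gM p sY sZ sW).
  rewrite !dualD; ring.
- rewrite (tv_sub gM (X p) sYh sZg) (tv_sub gM (Z p) sXg sYf) (tv_sub gM (Y p) sXh sZf).
  rewrite (lieE gM p sX sY sh) (lieE gM p sX sZ sg) (lieE gM p sY sZ sf).
  by rewrite /=; ring.
Qed.

End BnCourant.

#[local] Opaque anchor_star.

(** * Courant axioms from a generating family of vector fields *)

Section CourantFromGenerators.
Context (R : realType) (N : smoothType R).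
Hypothesis gN : good_atlas N.
Hypothesis tN : forall p : N, has_dual_frame p.
Variable L : tuple_on (TB N).
Hypothesis HT : is_tuple L.
Hypothesis H4 : Ca4 L.
Hypothesis H5 : Ca5 L.
Local Notation vf := (@smooth_sec R N (TB N)).
Implicit Types (a b c : section (TB N)) (f g F : N -> R) (q : N).
Local Notation B := (bracket L).
Local Notation r := (anchor_sec L).
Local Notation pr := (pair_sec L).

Lemma pairDr q (u v w : tvec q) : pairing L u (v + w : tvec q) = pairing L u v + pairing L u w.
Proof. by have [lin _ _ _ _] := HT; have := lin q u 1 v w; rewrite !scale1r. Qed.

Lemma pairC q (u v : tvec q) : pairing L u v = pairing L v u.
Proof. by have [_ sym _ _ _] := HT; exact: sym. Qed.

Lemma pairZr q (x : R) (u v : tvec q) : pairing L u (x *: v : tvec q) = x * pairing L u v.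
Proof.
have [lin _ _ _ _] := HT.
have p0 : pairing L u (0 : tvec q) = 0.
  have /eqP := pairDr u 0 0; rewrite addr0 -subr_eq0 opprD addrA subrr sub0r oppr_eq0.
  by move=> /eqP.
by have := lin q u x v 0; rewrite !addr0 p0 addr0.
Qed.

Lemma pairDl q (u v w : tvec q) : pairing L (v + w : tvec q) u = pairing L v u + pairing L w u.
Proof. by rewrite pairC pairDr !(pairC u). Qed.

Lemma pairZl q (x : R) (u v : tvec q) : pairing L (x *: v : tvec q) u = x * pairing L v u.
Proof. by rewrite pairC pairZr (pairC u). Qed.

Lemma pairNl q (u v : tvec q) : pairing L (- v : tvec q) u = - pairing L v u.
Proof. by rewrite -scaleN1r pairZl mulN1r. Qed.

Lemma pairNr q (u v : tvec q) : pairing L u (- v : tvec q) = - pairing L u v.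
Proof. by rewrite -scaleN1r pairZr mulN1r. Qed.

Lemma pair_eq q (u v : tvec q) : (forall w, pairing L u w = pairing L v w) -> u = v.
Proof.
have [_ _ nd _ _] := HT => H; apply/eqP; rewrite -subr_eq0; apply/eqP.
by apply: nd => w; rewrite pairDl pairNl H subrr.
Qed.

Lemma smooth_pr a b : vf a -> vf b -> smooth (pr a b).
Proof. by have [_ _ _ [H _] _] := HT; exact: H. Qed.

Lemma vf_r a : vf a -> vf (r a).
Proof. by have [_ _ _ [_ [H _]] _] := HT; exact: H. Qed.

Lemma vf_B a b : vf a -> vf b -> vf (B a b).
Proof. by have [_ _ _ [_ [_ H]] _] := HT; exact: H. Qed.

Lemma B_addl a b c : vf a -> vf b -> vf c ->
  B (fun q => a q + b q) c = fun q => B a c q + B b c q.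
Proof.
have [_ _ _ _ H] := HT => sa sb sc; apply: functional_extensionality_dep => q.
have [+ _] := H 1 a b c sa sb sc q; rewrite scale1r => <-; congr (B _ c q).
by apply: functional_extensionality_dep => x; rewrite scale1r.
Qed.

Lemma B_addr a b c : vf a -> vf b -> vf c ->
  B c (fun q => a q + b q) = fun q => B c a q + B c b q.
Proof.
have [_ _ _ _ H] := HT => sa sb sc; apply: functional_extensionality_dep => q.
have [_ +] := H 1 a b c sa sb sc q; rewrite scale1r => <-; congr (B c _ q).
by apply: functional_extensionality_dep => x; rewrite scale1r.
Qed.

(** The section rho^* df: its pairing with v is the derivative of f along the
  image of v under the anchor. *)
Definition grad f : section (TB N) := anchor_star L (differential f).

Lemma B_scaler f a b : smooth f -> vf a -> vf b ->
  B a (fun q => f q *: b q) = fun q => r a q f *: b q + f q *: B a b q.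
Proof. by move=> sf sa sb; apply: functional_extensionality_dep => q; exact: H4. Qed.

Lemma B_scalel f a b : smooth f -> vf a -> vf b ->
  B (fun q => f q *: a q) b = fun q => - (r b q f *: a q) + f q *: B a b q
    + pr a b q *: grad f q.
Proof. by move=> sf sa sb; apply: functional_extensionality_dep => q; exact: H5. Qed.

Definition anchor_defect F a b q : R^o :=
  r a q (fun x => r b x F) - r b q (fun x => r a x F) - r (B a b) q F.

Definition jac a b c q : tvec q := B a (B b c) q - (B (B a b) c q + B b (B a c) q).

(** Only (Ca4) enters.  The terms with one derivative of f cancel, and those with
  two derivatives make up the defect of the anchor. *)
Lemma jac_scaler f a b c q : smooth f -> vf a -> vf b -> vf c ->
  jac a b (fun q => f q *: c q) q = f q *: jac a b c q + anchor_defect f a b q *: c q.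
Proof.
move=> sf sa sb sc; have sab := vf_B sa sb; rewrite /jac /anchor_defect.
have sraf := vf_r sa sf; have srbf := vf_r sb sf.
rewrite (B_scaler sf sb sc) (B_scaler sf sa sc) (B_scaler sf sab sc).
rewrite (B_addr (vf_scale gN srbf sc) (vf_scale gN sf (vf_B sb sc)) sa).
rewrite (B_addr (vf_scale gN sraf sc) (vf_scale gN sf (vf_B sa sc)) sb).
rewrite (B_scaler srbf sa sc) (B_scaler sf sa (vf_B sb sc)).
rewrite (B_scaler sraf sb sc) (B_scaler sf sb (vf_B sa sc)).
apply: tvec_eq => F sF; rewrite !(tvecD, tvecB, tvecN, tvecZ); ring.
Qed.

Lemma r_add a b q : r (fun x => a x + b x) q = r a q + r b q.
Proof. exact: linearD. Qed.

Lemma r_scale f a q : r (fun x => f x *: a x) q = f q *: r a q.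
Proof. exact: linearZ. Qed.

Lemma pr_addl a b c : pr (fun q => a q + b q) c = fun q => pr a c q + pr b c q.
Proof. by apply/funext => q; exact: pairDl. Qed.

Lemma pr_addr a b c : pr c (fun q => a q + b q) = fun q => pr c a q + pr c b q.
Proof. by apply/funext => q; exact: pairDr. Qed.

Lemma pr_scalel f a b : pr (fun q => f q *: a q) b = fun q => f q * pr a b q.
Proof. by apply/funext => q; exact: pairZl. Qed.

Lemma prC a b : pr a b = pr b a.
Proof. by apply/funext => q; exact: pairC. Qed.

Hypothesis grad_ex : forall f, smooth f -> exists u : section (TB N),
  [/\ vf u, forall q v, pairing L (u q) v = anchor L q v f &
      forall q, anchor L q (u q) = 0].

Lemma gradP f q (v : tvec q) : smooth f -> pairing L (grad f q) v = anchor L q v f.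
Proof.
move=> sf; have [u [su uE _]] := grad_ex sf; rewrite -(differentialE gN tN (anchor L q v) sf).
have ex : exists x : tvec q, forall w : tvec q,
    pairing L x w = differential f q (anchor L q w).
  by exists (u q) => w; rewrite uE (differentialE gN tN _ sf).
exact: (@xgetPex _ (0 : tvec q) [set x : tvec q | forall w : tvec q,
  pairing L x w = differential f q (anchor L q w)] ex).
Qed.

Lemma grad_u f (u : section (TB N)) q : smooth f ->
  (forall q v, pairing L (u q) v = anchor L q v f) -> grad f q = u q.
Proof. by move=> sf uE; apply: pair_eq => w; rewrite gradP// uE. Qed.

Lemma vf_grad f : smooth f -> vf (grad f).
Proof.
move=> sf; have [u [su uE _]] := grad_ex sf.
rewrite (_ : grad f = u)//; apply: functional_extensionality_dep => q.
exact: grad_u.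
Qed.

Lemma r_grad f q : smooth f -> anchor L q (grad f q) = 0.
Proof.
by move=> sf; have [u [su uE u0]] := grad_ex sf; rewrite (grad_u q sf uE).
Qed.

Lemma grad_add f g q : smooth f -> smooth g ->
  grad (fun x => f x + g x) q = grad f q + grad g q.
Proof.
move=> sf sg; apply: pair_eq => w; rewrite pairDl !gradP//; last exact: smooth_add.
exact: tv_add.
Qed.

Lemma grad_mul f g q : smooth f -> smooth g ->
  grad (fun x => f x * g x) q = f q *: grad g q + g q *: grad f q.
Proof.
move=> sf sg; apply: pair_eq => w; rewrite pairDl !pairZl !gradP//; last exact: smooth_mul.
by rewrite tv_mul// addrC [_ * g q]mulrC.
Qed.

Lemma pr_grad f a : smooth f -> pr a (grad f) = fun q => r a q f.
Proof. by move=> sf; apply/funext => q; rewrite /pair_sec pairC gradP. Qed.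

Variable Gen : section (TB N) -> Prop.
Hypothesis vf_Gen : forall s, Gen s -> vf s.
Hypothesis Gen_vanish : forall (W : lmodType R) q (Phi : section (TB N) -> W),
  tensor_at q Phi -> (forall s, Gen s -> Phi s = 0) -> forall S, vf S -> Phi S = 0.
Hypothesis Gen_anchor : forall a b F q, Gen a -> Gen b -> smooth F ->
  r a q (fun x => r b x F) - r b q (fun x => r a x F) = r (B a b) q F.
Hypothesis Gen_Ca1 : forall a b q, Gen a -> Gen b ->
  B a b q + B b a q = grad (pr a b) q.
Hypothesis Gen_Ca2 : forall a b c q, Gen a -> Gen b -> Gen c ->
  r a q (pr b c) = pr (B a b) c q + pr b (B a c) q.
Hypothesis Gen_Ca3 : forall a b c q, Gen a -> Gen b -> Gen c ->
  B a (B b c) q = B (B a b) c q + B b (B a c) q.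

(** * The anchor is a morphism *)

(** (Ca5) contributes a multiple of rho^* df, which the anchor kills. *)
Lemma anchor_defect_l F b q : smooth F -> vf b ->
  tensor_at q (fun a => anchor_defect F a b q).
Proof.
move=> sF sb; have srb := vf_r sb; have srbF := srb _ sF.
split=> [a a' sa sa'|f a sf sa]; rewrite /anchor_defect.
  have sraF := vf_r sa sF; have sraF' := vf_r sa' sF.
  rewrite (B_addl sa sa' sb) !r_add !tvecD.
  have -> : (fun x => r (fun q => a q + a' q) x F) = fun x => r a x F + r a' x F.
    by apply/funext => x; rewrite r_add tvecD.
  rewrite (tv_add _ sraF sraF'); ring.
have sraF := vf_r sa sF.
rewrite (B_scalel sf sa sb).
have -> : (fun x => r (fun q => f q *: a q) x F) = fun x => f x * r a x F.
  by apply/funext => x; rewrite r_scale tvecZ.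
rewrite (tv_mul _ sf sraF) r_scale tvecZ.
have -> : r (fun q => - (r b q f *: a q) + f q *: B a b q + pr a b q *: grad f q) q =
    - (r b q f *: r a q) + f q *: r (B a b) q.
  by rewrite /anchor_sec !linearD linearN !linearZ/= r_grad// scaler0 addr0.
rewrite tvecD tvecN !tvecZ /GRing.scale/=; ring.
Qed.

Lemma anchor_defect_r F a q : smooth F -> vf a ->
  tensor_at q (fun b => anchor_defect F a b q).
Proof.
move=> sF sa; have sra := vf_r sa; have sraF := sra _ sF.
split=> [b b' sb sb'|f b sf sb]; rewrite /anchor_defect.
  have srbF := vf_r sb sF; have srbF' := vf_r sb' sF.
  rewrite (B_addr sb sb' sa) !r_add !tvecD.
  have -> : (fun x => r (fun q => b q + b' q) x F) = fun x => r b x F + r b' x F.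
    by apply/funext => x; rewrite r_add tvecD.
  rewrite (tv_add _ srbF srbF'); ring.
have srbF := vf_r sb sF.
rewrite (B_scaler sf sa sb).
have -> : (fun x => r (fun q => f q *: b q) x F) = fun x => f x * r b x F.
  by apply/funext => x; rewrite r_scale tvecZ.
rewrite (tv_mul _ sf srbF) r_scale tvecZ.
have -> : r (fun q => r a q f *: b q + f q *: B a b q) q =
    r a q f *: r b q + f q *: r (B a b) q.
  by rewrite /anchor_sec !linearD !linearZ.
rewrite tvecD !tvecZ /GRing.scale/=; ring.
Qed.

Lemma anchor_morphism a b F q : vf a -> vf b -> smooth F ->
  r a q (fun x => r b x F) - r b q (fun x => r a x F) = r (B a b) q F.
Proof.
move=> sa sb sF; apply/eqP; rewrite -subr_eq0; apply/eqP.
apply: (Gen_vanish (anchor_defect_l q sF sb)) sa => s Gs.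
apply: (Gen_vanish (anchor_defect_r q sF (vf_Gen Gs))) sb => t Gt.
by rewrite /anchor_defect Gen_anchor// subrr.
Qed.

(** * Symmetric part and invariance *)

Definition sym_defect a b q : tvec q := B a b q + B b a q - grad (pr a b) q.

Lemma sym_defect_l b q : vf b -> tensor_at q (fun a => sym_defect a b q).
Proof.
move=> sb; split=> [a a' sa sa'|f a sf sa]; rewrite /sym_defect.
  rewrite (B_addl sa sa' sb) (B_addr sa sa' sb) pr_addl grad_add; try exact: smooth_pr.
  by apply: tvec_eq => F sF; rewrite !(tvecD, tvecB, tvecN); ring.
rewrite (B_scalel sf sa sb) (B_scaler sf sb sa) pr_scalel (grad_mul _ sf (smooth_pr sa sb)).
apply: tvec_eq => F sF.
by rewrite !(tvecD, tvecB, tvecN, tvecZ); ring.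
Qed.

Lemma sym_defectC a b q : sym_defect a b q = sym_defect b a q.
Proof. by rewrite /sym_defect prC [B a b q + _]addrC. Qed.

Lemma sym_defect_r a q : vf a -> tensor_at q (fun b => sym_defect a b q).
Proof.
move=> sa; have -> : (fun b => sym_defect a b q) = (fun b => sym_defect b a q).
  by apply/funext => b; exact: sym_defectC.
exact: sym_defect_l.
Qed.

Lemma courant_sym a b q : vf a -> vf b -> B a b q + B b a q = grad (pr a b) q.
Proof.
move=> sa sb; apply/eqP; rewrite -subr_eq0; apply/eqP.
apply: (Gen_vanish (sym_defect_l q sb)) sa => s Gs.
apply: (Gen_vanish (sym_defect_r q (vf_Gen Gs))) sb => t Gt.
by rewrite /sym_defect Gen_Ca1// subrr.
Qed.

Definition inv_defect a b c q : R^o :=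
  r a q (pr b c) - (pr (B a b) c q + pr b (B a c) q).

Lemma inv_defectC a b c q : inv_defect a b c q = inv_defect a c b q.
Proof. by rewrite /inv_defect prC [pr (B a b) c]prC [pr b _]prC addrC [X in _ - X]addrC addrC. Qed.

Lemma inv_defect_m a c q : vf a -> vf c -> tensor_at q (fun b => inv_defect a b c q).
Proof.
move=> sa sc; split=> [b b' sb sb'|f b sf sb]; rewrite /inv_defect.
  rewrite (B_addr sb sb' sa) !pr_addl (tv_add _ (smooth_pr sb sc) (smooth_pr sb' sc)).
  ring.
rewrite (B_scaler sf sa sb) pr_addl !pr_scalel (tv_mul _ sf (smooth_pr sb sc)).
rewrite /GRing.scale/=; ring.
Qed.

Lemma inv_defect_r a b q : vf a -> vf b -> tensor_at q (fun c => inv_defect a b c q).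
Proof.
move=> sa sb; have -> : (fun c => inv_defect a b c q) = (fun c => inv_defect a c b q).
  by apply/funext => c; exact: inv_defectC.
exact: inv_defect_m.
Qed.

(** The terms with rho^* df from (Ca5) cancel the derivatives of f. *)
Lemma inv_defect_l b c q : vf b -> vf c -> tensor_at q (fun a => inv_defect a b c q).
Proof.
move=> sb sc; split=> [a a' sa sa'|f a sf sa]; rewrite /inv_defect.
  rewrite (B_addl sa sa' sb) (B_addl sa sa' sc) pr_addl pr_addr r_add tvecD; ring.
rewrite (B_scalel sf sa sb) (B_scalel sf sa sc) r_scale tvecZ.
rewrite /pair_sec !pairDl !pairDr pairNl pairNr !pairZl !pairZr.
have := gradP (b q) sf; have := gradP (c q) sf; rewrite /anchor_sec => -> gb.
rewrite [pairing L (b q) (grad f q)]pairC gb [pairing L (b q) (a q)]pairC.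
rewrite /GRing.scale/=; ring.
Qed.

Lemma courant_inv a b c q : vf a -> vf b -> vf c ->
  r a q (pr b c) = pr (B a b) c q + pr b (B a c) q.
Proof.
move=> sa sb sc; apply/eqP; rewrite -subr_eq0; apply/eqP.
apply: (Gen_vanish (inv_defect_l q sb sc)) sa => s Gs.
apply: (Gen_vanish (inv_defect_m q (vf_Gen Gs) sc)) sb => t Gt.
apply: (Gen_vanish (inv_defect_r q (vf_Gen Gs) (vf_Gen Gt))) sc => u Gu.
by rewrite /inv_defect Gen_Ca2// subrr.
Qed.

(** * The Jacobi identity *)

(** Pair with c and use invariance: the left side becomes
  a (c F) - [a, c] F, where a and c act through the anchor, which is c (a F) as
  the anchor is a morphism. *)
Lemma B_gradr a F q : vf a -> smooth F -> B a (grad F) q = grad (fun x => r a x F) q.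
Proof.
move=> sa sF; have sraF := vf_r sa sF; have sg := vf_grad sF.
apply: pair_eq => w; have [c sc <-] := vf_extend gN tN w.
rewrite (gradP _ sraF).
have := courant_inv q sa sg sc.
rewrite prC pr_grad// [pr (grad F) _]prC pr_grad//.
have := anchor_morphism q sa sc sF.
rewrite /anchor_sec/pair_sec/= => <- E.
by apply/eqP; rewrite -subr_eq0; move/eqP: E; rewrite -subr_eq0 => /eqP E; apply/eqP;
   rewrite -[RHS]oppr0 -E; ring.
Qed.

Lemma B_gradl a F q : vf a -> smooth F -> B (grad F) a q = 0.
Proof.
move=> sa sF; have := courant_sym q sa (vf_grad sF).
rewrite pr_grad// (B_gradr q sa sF) => /eqP; rewrite -subr_eq0.
by rewrite addrAC subrr add0r => /eqP.
Qed.

(** The symmetric part of the bracket of a and b is the gradient of a function, and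
  brackets of gradients with anything vanish. *)
Lemma jac_skew a b c q : vf a -> vf b -> vf c -> jac a b c q = - jac b a c q.
Proof.
move=> sa sb sc; have sab := vf_B sa sb; have sba := vf_B sb sa.
have : B (fun x => B a b x + B b a x) c q = 0.
  rewrite -(B_gradl q sc (smooth_pr sa sb)); congr (B _ c q).
  by apply: functional_extensionality_dep => x; exact: courant_sym.
rewrite (B_addl sab sba sc) => E.
apply: tvec_eq => F sF; have := congr1 (fun v : tvec q => v F) E.
rewrite /jac !(tvecN, tvecB, tvecD) tvec0 => EF.
apply/eqP; rewrite -subr_eq0 -[X in _ == X]oppr0 -EF; apply/eqP; ring.
Qed.

Lemma jac_r a b q : vf a -> vf b -> tensor_at q (fun c => jac a b c q).
Proof.
move=> sa sb; have sab := vf_B sa sb.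
split=> [c c' sc sc'|f c sf sc]; rewrite /jac.
  rewrite (B_addr sc sc' sb) (B_addr sc sc' sa) (B_addr sc sc' sab).
  rewrite (B_addr (vf_B sb sc) (vf_B sb sc') sa) (B_addr (vf_B sa sc) (vf_B sa sc') sb).
  by apply: tvec_eq => F sF; rewrite !(tvecD, tvecB, tvecN); ring.
rewrite -/(jac a b _ q) jac_scaler// /anchor_defect (anchor_morphism q sa sb sf).
by rewrite subrr scale0r addr0.
Qed.

(** Expanding, (Ca5) brings in the gradient of f: its bracket with a is known by
  [B_gradr], and what is left cancels by invariance and by the morphism property
  of the anchor. *)
Lemma jac_m a c q : vf a -> vf c -> tensor_at q (fun b => jac a b c q).
Proof.
move=> sa sc; have sac := vf_B sa sc.
split=> [b b' sb sb'|f b sf sb]; rewrite /jac.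
  rewrite (B_addl sb sb' sc) (B_addr sb sb' sa) (B_addl sb sb' sac).
  rewrite (B_addr (vf_B sb sc) (vf_B sb' sc) sa) (B_addl (vf_B sa sb) (vf_B sa sb') sc).
  by apply: tvec_eq => F sF; rewrite !(tvecD, tvecB, tvecN); ring.
have sraf := vf_r sa sf; have srcf := vf_r sc sf; have sg := vf_grad sf.
have sab := vf_B sa sb; have sbc := vf_B sb sc; have spr := smooth_pr sb sc.
have e1 : B (fun x => f x *: b x) c =
    fun x => (- r c x f) *: b x + f x *: B b c x + pr b c x *: grad f x.
  by rewrite (B_scalel sf sb sc); apply: functional_extensionality_dep => x; rewrite scaleNr.
have sn := smooth_opp gN srcf.
rewrite e1 (B_addr (vf_add gN (vf_scale gN sn sb) (vf_scale gN sf sbc))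
  (vf_scale gN spr sg) sa).
rewrite (B_addr (vf_scale gN sn sb) (vf_scale gN sf sbc) sa).
rewrite (B_scaler sn sa sb) (B_scaler sf sa sbc) (B_scaler spr sa sg) (B_gradr q sa sf).
rewrite (B_scaler sf sa sb) (B_addl (vf_scale gN sraf sb) (vf_scale gN sf sab) sc).
rewrite (B_scalel sraf sb sc) (B_scalel sf sab sc) (B_scalel sf sb sac).
rewrite (courant_inv q sa sb sc) (tv_opp gN _ srcf).
rewrite -(anchor_morphism q sa sc sf).
apply: tvec_eq => F sF; rewrite !(tvecD, tvecB, tvecN, tvecZ); ring.
Qed.

(** By skew-symmetry in the first two arguments. *)
Lemma jac_l b c q : vf b -> vf c -> tensor_at q (fun a => jac a b c q).
Proof.
move=> sb sc; have [H1 H2] := jac_m q sb sc; split=> [a a' sa sa'|f a sf sa].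
  have saa := vf_add gN sa sa'.
  by rewrite (jac_skew q saa sb sc) H1// opprD -!jac_skew.
have sfa := vf_scale gN sf sa.
by rewrite (jac_skew q sfa sb sc) H2// -scalerN -jac_skew.
Qed.

Lemma courant_jacobi a b c q : vf a -> vf b -> vf c ->
  B a (B b c) q = B (B a b) c q + B b (B a c) q.
Proof.
move=> sa sb sc; apply/eqP; rewrite -subr_eq0; apply/eqP.
apply: (Gen_vanish (jac_l q sb sc)) sa => s Gs.
apply: (Gen_vanish (jac_m q (vf_Gen Gs) sc)) sb => t Gt.
apply: (Gen_vanish (jac_r q (vf_Gen Gs) (vf_Gen Gt))) sc => u Gu.
by rewrite /jac Gen_Ca3// subrr.
Qed.

(** The conditions on the generators [Gen] are the axioms and the morphism property
  of the anchor on them; [grad_ex] says that rho^* df is smooth and that rho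
  kills it.  Each axiom is extended one argument at a time. *)
Lemma courant_from_generators : is_courant_algebroid L.
Proof.
split=> //.
- by move=> a b sa sb q; exact: courant_sym.
- by move=> a b c sa sb sc q; exact: courant_inv.
- by move=> a b c sa sb sc q; exact: courant_jacobi.
Qed.

End CourantFromGenerators.

#[local] Opaque hlift.

(** * The lift of the B_n-Courant algebroid *)

Section Lift.
Context (R : realType) (M : smoothType R).
Hypothesis fM : framed M.
Let gM : good_atlas M := proj1 fM.
Let tM := framed_dual_frame fM.
Local Notation E := (total_space (bnE M)).
Let gE : good_atlas E := total_good_atlas fM.
Local Notation vf := (@smooth_sec R M (TB M)).
Local Notation vfE := (@smooth_sec R E (TB E)).
Local Notation bs := (@smooth_sec R M (bnE M)).
Local Notation bns := (@smooth_sec R M (bn_bundle M)).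
Implicit Types (p : M) (q : E) (X Y Z : section (TB M)) (f : M -> R) (F : E -> R).
Implicit Types (a b c : section (bn_bundle M)).

Variables (J : endo M) (nabla : connection_op (TB M)).
Hypothesis sJ : forall X, vf X -> vf (fun p => J p (X p)).
Hypothesis Hn : is_connection nabla.
Let D := nablaJ J nabla.
Let tE : forall q : E, has_dual_frame q := total_dual_frame fM sJ Hn.
Variable L : tuple_on (TB E).
Hypothesis HL : is_courant_lift (bn_courant M) D L.

Local Notation hor_lift := (hor_lift J nabla).
Local Notation vert_lift := (@vert_lift R M).

(** Kept from unfolding in the same way as [hor_lift]. *)
Fact bn_lift_key : {h : section (bn_bundle M) -> section (TB E) | h = phi_lift D}.
Proof. by exists (phi_lift D). Qed.
Definition bn_lift := sval bn_lift_key.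
Local Notation phi := bn_lift.
Lemma bn_liftE : phi = phi_lift D.
Proof. exact: (svalP bn_lift_key). Qed.

Lemma vf_bn_lift a : bns a -> vfE (phi a).
Proof. by rewrite bn_liftE; exact: (vf_phi_lift fM sJ Hn). Qed.

Lemma bn_lift_vanish (W : lmodType R) q (Phi : section (TB E) -> W) :
  tensor_at q Phi -> (forall a, bns a -> Phi (phi a) = 0) ->
  forall S, vfE S -> Phi S = 0.
Proof. by rewrite bn_liftE; exact: (lift_tensor_vanish fM sJ Hn). Qed.

Lemma hor_lift_add X Y q : vf X -> vf Y ->
  hor_lift (fun p => X p + Y p) q = hor_lift X q + hor_lift Y q.
Proof.
move=> sX sY; have sXY := vf_add gM sX sY; have [_ nD _ _ _] := Hn.
apply: (total_eq fM) => [f sf|Z sZ|]; rewrite tvecD.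
- by rewrite !(hor_lift_pull fM J Hn).
- by rewrite !(hor_lift_mom fM J Hn)// /mom nD// dualD.
- by rewrite !(hor_lift_height fM J Hn)// /mom linearD dualD opprD.
Qed.

Lemma hor_lift_scale f X q : smooth f -> vf X ->
  hor_lift (fun p => f p *: X p) q = f (base q) *: hor_lift X q.
Proof.
move=> sf sX; have sfX := vf_scale gM sf sX; have [_ _ nZ _ _] := Hn.
apply: (total_eq fM) => [g sg|Z sZ|]; rewrite tvecZ.
- by rewrite !(hor_lift_pull fM J Hn).
- by rewrite !(hor_lift_mom fM J Hn)// /mom nZ// dualZ.
- by rewrite !(hor_lift_height fM J Hn)// /mom linearZ dualZ mulrN.
Qed.

Lemma vert_lift_add (s t : section (bnE M)) q :
  vert_lift (fun p => s p + t p) q = vert_lift s q + vert_lift t q.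
Proof.
apply: (total_eq fM) => [f sf|Z sZ|]; rewrite tvecD.
- by rewrite !(vert_lift_pull fM)// addr0.
- by rewrite (vert_lift_mom fM _ q sZ) (vert_lift_mom fM s q sZ) (vert_lift_mom fM t q sZ).
- by rewrite !(vert_lift_height fM).
Qed.

Lemma vert_lift_eq (s t : section (bnE M)) q : s (base q) = t (base q) ->
  vert_lift s q = vert_lift t q.
Proof.
move=> st; apply: (total_eq fM) => [f sf|Z sZ|].
- by rewrite !(vert_lift_pull fM).
- by rewrite !(vert_lift_mom fM)// st.
- by rewrite !(vert_lift_height fM) st.
Qed.

Lemma phi_add a b q : bns a -> bns b ->
  phi (fun p => a p + b p) q = phi a q + phi b q.
Proof.
move=> [a1 a2] [b1 b2]; rewrite bn_liftE !phi_liftE.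
rewrite (hor_lift_add q a1 b1) (vert_lift_add (fun p => (a p).2) (fun p => (b p).2)).
by rewrite addrACA.
Qed.

Let HT : is_tuple L. Proof. by have [] := HL. Qed.
Let H4 : Ca4 L. Proof. by have [_ _ _ _ []] := HL. Qed.
Let H5 : Ca5 L. Proof. by have [_ _ _ _ []] := HL. Qed.

Lemma lift_pair a b : bns a -> bns b ->
  pair_sec L (phi a) (phi b) = pull (pair_sec (bn_courant M) a b).
Proof. by rewrite bn_liftE; have [_ H _ _ _] := HL => sa sb; apply/funext => q; exact: H. Qed.

Lemma lift_anchor a q : bns a -> anchor L q (phi a q) = hor_lift (fun p => (a p).1) q.
Proof. by rewrite bn_liftE; have [_ _ H _ _] := HL => sa; rewrite hor_liftE; exact: H. Qed.

Lemma lift_bracket a b : bns a -> bns b ->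
  bracket L (phi a) (phi b) = phi (bn_bracket a b).
Proof.
by rewrite bn_liftE; have [_ _ _ H _] := HL => sa sb; apply: functional_extensionality_dep => q; exact: H.
Qed.

Definition vert_sec (s : section (bnE M)) : section (bn_bundle M) := fun p => (0, s p).

Lemma vert_sec_smooth s : bs s -> bns (vert_sec s).
Proof. by move=> ss; split=> //; exact: (vf_zero gM). Qed.

Lemma phi_vert s q : phi (vert_sec s) q = vert_lift s q.
Proof. by rewrite bn_liftE phi_liftE (hor_lift0 fM J Hn) add0r. Qed.

Lemma phi_pair_vert s b q : bs s -> bns b ->
  pairing L (vert_lift s q) (phi b q) =
  ((s (base q)).1 : dual (tvec (base q))) ((b (base q)).1) + (s (base q)).2 * (b (base q)).2.2.
Proof.
move=> ss sb; rewrite -phi_vert.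
have := congr1 (fun G => G q) (lift_pair (vert_sec_smooth ss) sb).
rewrite /pair_sec/pull/= => ->; rewrite /bn_pairing/vert_sec.
by case: (s _) (b _) => [al f] [Y [be g]]; rewrite dual0 addr0.
Qed.

(** Only the value at the base point of q is used: the covector Z |-> Z^h F. *)
Definition grad_cov F q : section (cotangent M) := covec_of (fun Z _ => hor_lift Z q F).

Lemma grad_covE F q Z : vf Z -> grad_cov F q (base q) (Z (base q)) = hor_lift Z q F.
Proof.
move=> sZ; apply: (covec_ofE gM tM (Phi := fun Z _ => hor_lift Z q F)) => //.
split=> [X Y sX sY|f X sf sX]; first by rewrite hor_lift_add.
by rewrite hor_lift_scale.
Qed.

(** The vertical field that represents rho^* dF: it pairs with the lift of a
  section with vector part Y to Y^h F, the derivative of F along its anchor.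
  Because it is vertical, the anchor kills it. *)
Definition grad_vec F : section (TB E) := fun q =>
  vert_lift (fun p => (grad_cov F q p, 0 : R^o)) q.

Lemma grad_vec_mom F q Y : vf Y -> grad_vec F q (mom Y) = hor_lift Y q F.
Proof. by move=> sY; rewrite /grad_vec (vert_lift_mom fM)//= grad_covE. Qed.

Lemma grad_vec_pull F q f : smooth f -> grad_vec F q (pull f) = 0.
Proof. by move=> sf; rewrite /grad_vec (vert_lift_pull fM). Qed.

Lemma grad_vec_height F q : grad_vec F q (@height R M) = 0.
Proof. by rewrite /grad_vec (vert_lift_height fM). Qed.

(** At a given point, a smooth section of the bundle has the same value; this
  brings the formulas for lifts of smooth sections to bear. *)
Lemma grad_vecE F q : exists s, [/\ bs s,
  s (base q) = (grad_cov F q (base q), 0 : R^o) & grad_vec F q = vert_lift s q].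
Proof.
pose q' : E := existT _ (base q) (grad_cov F q (base q), 0 : R^o).
have [s ss sq] := section_through fM q'; exists s; split=> //.
by apply: vert_lift_eq; rewrite /= sq.
Qed.

Lemma vf_grad_vec F : smooth F -> vfE (grad_vec F).
Proof.
move=> sF; apply: (vf_total fM).
- by move=> f sf; apply: eq_smooth (smooth_cst gE 0) => q; exact: grad_vec_pull.
- move=> Y sY; apply: eq_smooth (vf_hor_lift fM sJ Hn sY sF) => q.
  exact: grad_vec_mom.
- by apply: eq_smooth (smooth_cst gE 0) => q; exact: grad_vec_height.
Qed.

Lemma grad_vec_pair F q (v : tvec q) : smooth F ->
  pairing L (grad_vec F q) v = anchor L q v F.
Proof.
move=> sF; have [S sS <-] := vf_extend gE tE v.
apply/eqP; rewrite -subr_eq0; apply/eqP.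
apply: (bn_lift_vanish (q := q) (W := R^o)
  (Phi := fun S => pairing L (grad_vec F q) (S q) - anchor L q (S q) F : R^o)) => //.
  split=> [S1 S2 _ _|f S1 _ _].
    rewrite (pairDr HT) linearD tvecD; ring.
  rewrite (pairZr HT) linearZ tvecZ /GRing.scale/=; ring.
move=> a sa; have [s [ss sE ->]] := grad_vecE F q.
rewrite phi_pair_vert// lift_anchor// sE mul0r addr0.
by have [sX _] := sa; rewrite (grad_covE F q sX) subrr.
Qed.

Lemma grad_vec_anchor F q : anchor L q (grad_vec F q) = 0.
Proof.
have [s [ss sE ->]] := grad_vecE F q.
by rewrite -phi_vert (lift_anchor _ (vert_sec_smooth ss)) (hor_lift0 fM J Hn).
Qed.

Lemma lift_grad_ex F : smooth F -> exists u : section (TB E),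
  [/\ vfE u, forall q v, pairing L (u q) v = anchor L q v F &
      forall q, anchor L q (u q) = 0].
Proof.
move=> sF; exists (grad_vec F); split.
- exact: vf_grad_vec.
- by move=> q v; exact: grad_vec_pair.
- exact: grad_vec_anchor.
Qed.

Definition lifted (S : section (TB E)) := exists2 a, bns a & S = phi a.

Lemma lift_grad_pull f q : smooth f ->
  grad L (pull f) q = phi (vert_sec (fun p => (differential f p, 0 : R^o))) q.
Proof.
move=> sf; have spf := smooth_pull fM sf.
rewrite (grad_u gE tE HT lift_grad_ex q spf (fun q v => grad_vec_pair v spf)).
rewrite phi_vert; apply: (total_eq fM) => [g sg|Y sY|].
- by rewrite grad_vec_pull// (vert_lift_pull fM).
- rewrite grad_vec_mom// (hor_lift_pull fM J Hn)// (vert_lift_mom fM)//=.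
  by rewrite (differentialE gM tM).
- by rewrite grad_vec_height (vert_lift_height fM).
Qed.

(** For a special complex structure the horizontal lift is a morphism of Lie
  algebras; everything else about lifted fields comes from B_n. *)
Lemma special_courant : special_complex J nabla -> is_courant_algebroid L.
Proof.
move=> [Hflat HdJ].
apply: (courant_from_generators gE tE HT H4 H5 lift_grad_ex (Gen := lifted)).
- by move=> S [a sa ->]; exact: vf_bn_lift.
- move=> W q Phi tPhi H S sS; apply: (bn_lift_vanish tPhi) => // a sa.
  by apply: H; exists a.
- move=> S T F q [a sa ->] [b sb ->] sF.
  have rE c : bns c -> anchor_sec L (phi c) = hor_lift (fun p => (c p).1).
    by move=> sc; apply: functional_extensionality_dep => x; exact: lift_anchor.
  rewrite (lift_bracket sa sb) (rE _ sa) (rE _ sb) (rE _ (bn_bracket_smooth fM sa sb)).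
  have [sX _] := sa; have [sY _] := sb.
  set X := fun p => (a p).1 in sX *; set Y := fun p => (b p).1 in sY *.
  have shX := vf_hor_lift fM sJ Hn sX; have shY := vf_hor_lift fM sJ Hn sY.
  rewrite -(lieE gE q shX shY sF); congr (tvec_fun _ F).
  rewrite -[fun p => (bn_bracket a b p).1]/(lie X Y).
  have sXY := vf_lie gM sX sY.
  apply: (total_eq fM) => [f sf|Z sZ|].
  + rewrite (lieE gE q shX shY (smooth_pull fM sf)).
    exact: (hor_lift_comm_pull fM J Hn q sX sY sf).
  + rewrite (lieE gE q shX shY (smooth_mom fM sZ)).
    apply/eqP; rewrite -subr_eq0; apply/eqP.
    have H := hor_lift_comm_mom fM J Hn q sX sY sZ.
    by apply: (etrans H); rewrite Hflat// dual0.
  + rewrite (lieE gE q shX shY (smooth_height fM)).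
    apply/eqP; rewrite -subr_eq0; apply/eqP.
    have H := hor_lift_comm_height fM sJ Hn q sX sY.
    by apply: (etrans H); rewrite HdJ// dual0 oppr0.
- move=> S T q [a sa ->] [b sb ->].
  have sab := bn_bracket_smooth fM sa sb; have sba := bn_bracket_smooth fM sb sa.
  rewrite (lift_bracket sa sb) (lift_bracket sb sa) (lift_pair sa sb).
  rewrite (lift_grad_pull q (bn_pair_smooth fM sa sb)) -(phi_add q sab sba).
  congr (phi _ q); apply: functional_extensionality_dep => p.
  exact: bn_Ca1.
- move=> S T V q [a sa ->] [b sb ->] [c sc ->].
  have sab := bn_bracket_smooth fM sa sb; have sac := bn_bracket_smooth fM sa sc.
  rewrite (lift_bracket sa sb) (lift_bracket sa sc) !lift_pair//.
  rewrite /anchor_sec lift_anchor// (hor_lift_pull fM J Hn)//; first last.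
  + exact: bn_pair_smooth.
  + by have [] := sa.
  exact: (bn_Ca2 fM (base q) sa sb sc).
- move=> S T V q [a sa ->] [b sb ->] [c sc ->].
  have sab := bn_bracket_smooth fM sa sb; have sac := bn_bracket_smooth fM sa sc.
  have sbc := bn_bracket_smooth fM sb sc.
  rewrite (lift_bracket sa sb) (lift_bracket sa sc) (lift_bracket sb sc).
  rewrite (lift_bracket sa sbc) (lift_bracket sab sc) (lift_bracket sb sac).
  rewrite -(phi_add q (bn_bracket_smooth fM sab sc) (bn_bracket_smooth fM sb sac)).
  congr (phi _ q); apply: functional_extensionality_dep => p.
  exact: bn_Ca3.
Qed.

(** By [jac_scaler], (Ca3) kills the defect of the anchor times phi c for every c.
  With c the section 1, whose lift takes the value 1 on the height, the
  commutator of two horizontal lifts is the lift of the Lie bracket; it is then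
  tested on the momenta and on the height. *)
Lemma courant_special : is_courant_algebroid L -> special_complex J nabla.
Proof.
move=> [_ _ _ H3].
(* The section X + 0 + 0, whose lift is the horizontal lift of X. *)
pose hs X : section (bn_bundle M) := fun p => (X p, 0).
have shs X : vf X -> bns (hs X).
  by move=> sX; split=> //; split=> [Z sZ|]; exact: (smooth_cst gM 0).
have s1 := bs_vert_one fM.
have sone := vert_sec_smooth s1.
have key X Y q F : vf X -> vf Y -> smooth F ->
  hor_lift X q (fun x => hor_lift Y x F) - hor_lift Y q (fun x => hor_lift X x F)
  - hor_lift (lie X Y) q F = 0.
  move=> sX sY sF.
  have sa := shs _ sX; have sb := shs _ sY.
  have va := vf_bn_lift sa; have vb := vf_bn_lift sb.
  have vc := vf_bn_lift sone.
  have jac0 S : vfE S -> jac L (phi (hs X)) (phi (hs Y)) S q = 0.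
    by move=> sS; apply/eqP; rewrite subr_eq0; apply/eqP; exact: (H3 _ _ _ va vb sS q).
  have := jac_scaler gE HT H4 q sF va vb vc.
  rewrite (jac0 _ (vf_scale gE sF vc)) (jac0 _ vc) scaler0 add0r => /esym E0.
  have := congr1 (fun v : tvec q => v (@height R M)) E0.
  rewrite tvecZ tvec0 phi_vert (vert_lift_height fM) mulr1.
  rewrite /anchor_defect (lift_bracket sa sb).
  have rE c : bns c -> anchor_sec L (phi c) = hor_lift (fun p => (c p).1).
    by move=> sc; apply: functional_extensionality_dep => x; exact: lift_anchor.
  by rewrite (rE _ sa) (rE _ sb) (rE _ (bn_bracket_smooth fM sa sb)).
have sep p (w : tvec p) : (forall al : dual (tvec p), al w = 0) -> w = 0.
  move=> H; apply: tvec_eq => f sf; rewrite tvec0 -(differentialE gM tM w sf).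
  exact: H.
split=> [X Y Z sX sY sZ p|X Y sX sY p]; apply: sep => al.
  pose q : E := existT _ p (al, 0 : R^o).
  exact: (etrans (esym (hor_lift_comm_mom fM J Hn q sX sY sZ)) (key X Y q _ sX sY (smooth_mom fM sZ))).
pose q : E := existT _ p (al, 0 : R^o).
apply/eqP; rewrite -oppr_eq0; apply/eqP.
exact: (etrans (esym (hor_lift_comm_height fM sJ Hn q sX sY)) (key X Y q _ sX sY (smooth_height fM))).
Qed.

End Lift.

Theorem corollary4p15 (R : realType) (n : nat) (T : topologicalType)
    (A : set (chart R T n)) (HM : is_manifold A)
    (J : endo (SmoothType A)) (nabla : connection_op (TB (SmoothType A)))
    (HJ : almost_complex J) (Hnabla : is_connection nabla)
    (Htf : torsion_free nabla)
    (L : tuple_on (TB (total_space (bnE (SmoothType A)))))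
    (HL : is_courant_lift (bn_courant (SmoothType A)) (nablaJ J nabla) L) :
  is_courant_algebroid L <-> special_complex J nabla.
Proof.
have fM := manifold_framed HM; have [sJ _] := HJ.
split; first exact: (courant_special fM sJ Hnabla HL).
exact: (special_courant fM sJ Hnabla HL).
Qed.
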